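(* Let $n\ge 1$. The Lie algebra $L^P(\mathrm{Brun}_n)$ is a free Lie algebra (over $\mathbb{Z}$) with $\mathcal{K}(n)_1$ as a set of free generators.
   Context: $P_n$ is the pure braid group on $n$ strands of the disc ($P_0$ and $P_1$ are trivial), with its standard generators $a_{i,j}$, $1\le i<j\le n$. The Brunnian subgroup $\mathrm{Brun}_n\le P_n$ consists of the pure braids that become trivial after removing any one of their strands. For a group $G$, $\Gamma_1(G)=G$, $\Gamma_{i+1}(G)=[\Gamma_i(G),G]$, and $L(G)=\bigoplus_{i\ge1}\Gamma_i(G)/\Gamma_{i+1}(G)$ is the associated graded Lie algebra over $\mathbb{Z}$ with bracket induced by group commutators. $A_{i,j}\in L_1(P_n)$ denotes the class of $a_{i,j}$; $L(P_n)$ is generated by the $A_{i,j}$, subject to the relations $[A_{i,j},A_{s,t}]=0$ if $\{i,j\}\cap\{s,t\}=\emptyset$, and $[A_{i,j},A_{i,k}+A_{j,k}]=0$, $[A_{i,k},A_{i,j}+A_{j,k}]=0$ if $i<j<k$. The relative Lie algebra is $L^P(\mathrm{Brun}_n)=\bigoplus_{q\ge1}(\Gamma_q(P_n)\cap\mathrm{Brun}_n)/(\Gamma_{q+1}(P_n)\cap\mathrm{Brun}_n)$, a Lie subalgebra (in fact ideal) of $L(P_n)$ via the natural inclusion. A Lie monomial on the letters $A_{1,n},\dots,A_{n-1,n}$ is a single letter or an iterated bracket of letters under any bracket arrangement; monomials are treated as formal expressions and evaluated in $L(P_n)$. Sets of Lie monomials $\mathcal{K}(n)_k$, $1\le k\le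 n$, are defined recursively in reverse order: (1) $\mathcal{K}(n)_n=\{A_{1,n},A_{2,n},\dots,A_{n-1,n}\}$. (2) Given $\mathcal{K}(n)_{k+1}$ with $1\le k<n$, let $\mathcal{A}_k$ be the set of those $W\in\mathcal{K}(n)_{k+1}$ in which the letter $A_{k,n}$ does not occur. (3) $\mathcal{K}(n)_k$ is the set of all monomials $W'$ and $[\cdots[[W',W_1],W_2],\dots,W_t]$ with $W'\in\mathcal{K}(n)_{k+1}\smallsetminus\mathcal{A}_k$, $t\ge1$ and $W_1,\dots,W_t\in\mathcal{A}_k$. *)

(* Defs.v *)
From HB Require Import structures.
From mathcomp Require Import all_boot all_order all_algebra.
From mathcomp Require Import boolp classical_sets zify.

Set Implicit Arguments.
Unset Strict Implicit.
Unset Printing Implicit Defensive.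

Import GRing.Theory.

Local Open Scope classical_set_scope.
Local Open Scope quotient_scope.
Local Open Scope ring_scope.

HB.mixin Record Zmodule_isLieRing V of GRing.Zmodule V := {
  lieb : V -> V -> V;
  liebDl : forall x y z, lieb (x + y) z = lieb x z + lieb y z;
  liebDr : forall x y z, lieb x (y + z) = lieb x y + lieb x z;
  liebxx : forall x, lieb x x = 0;
  lieb_jacobi : forall x y z,
    lieb (lieb x y) z + lieb (lieb y z) x + lieb (lieb z x) y = 0
}.

#[short(type="lieRingType")]
HB.structure Definition LieRing :=
  {V of Zmodule_isLieRing V & GRing.Zmodule V}.

Definition lie_hom (L M : lieRingType) (phi : L -> M) : Prop :=
  {morph phi : x y / x + y} /\ {morph phi : x y / lieb x y}.

Definition free_lie (X : Type) (L : lieRingType) (gen : X -> L) : Prop :=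
  forall (M : lieRingType) (f : X -> M),
    exists! phi : L -> M, lie_hom phi /\ (forall x, phi (gen x) = f x).

Inductive lie_monomial (X : Type) : Type :=
| Letter of X
| Bracket of lie_monomial X & lie_monomial X.

Fixpoint lie_eval (X : Type) (L : lieRingType) (a : X -> L)
    (W : lie_monomial X) : L :=
  match W with
  | Letter x => a x
  | Bracket U V => lieb (lie_eval a U) (lie_eval a V)
  end.

Fixpoint occurs (X : eqType) (x : X) (W : lie_monomial X) : bool :=
  match W with
  | Letter y => x == y
  | Bracket U V => occurs x U || occurs x V
  end.

Section DirectSum.
Variable V : nat -> zmodType.

Record dirsum := DirSum {
  dirsum_fun :> forall i, V i;
  dirsum_finite : exists N, forall i, (N <= i)%N -> dirsum_fun i = 0 }.

Lemma dirsum_eq (u v : dirsum) : (forall i, u i = v i) -> u = v.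
Proof.
case: u v => [u hu] [v hv] /= uv.
have {}uv : u = v by exact: functional_extensionality_dep.
by move: hv; rewrite -uv => hv; congr DirSum; exact: Prop_irrelevance.
Qed.

HB.instance Definition _ := gen_eqMixin dirsum.
HB.instance Definition _ := gen_choiceMixin dirsum.

Fact dirsum_zero_finite : exists N, forall i, (N <= i)%N -> 0 = 0 :> V i.
Proof. by exists 0%N. Qed.
Fact dirsum_opp_finite (u : dirsum) :
  exists N, forall i, (N <= i)%N -> - u i = 0.
Proof.
by case: u => u [N uN]; exists N => i /uN /= ->; rewrite oppr0.
Qed.
Fact dirsum_add_finite (u v : dirsum) :
  exists N, forall i, (N <= i)%N -> u i + v i = 0.
Proof.
case: u v => [u [N uN]] [v [M vM]]; exists (maxn N M) => i /=.
by rewrite geq_max => /andP[/uN -> /vM ->]; rewrite addr0.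
Qed.

Definition dirsum_zero := DirSum dirsum_zero_finite.
Definition dirsum_opp u := DirSum (dirsum_opp_finite u).
Definition dirsum_add u v := DirSum (dirsum_add_finite u v).

Fact dirsum_addA : associative dirsum_add.
Proof. by move=> u v w; apply: dirsum_eq => i /=; rewrite addrA. Qed.
Fact dirsum_addC : commutative dirsum_add.
Proof. by move=> u v; apply: dirsum_eq => i /=; rewrite addrC. Qed.
Fact dirsum_add0 : left_id dirsum_zero dirsum_add.
Proof. by move=> u; apply: dirsum_eq => i /=; rewrite add0r. Qed.
Fact dirsum_addN : left_inverse dirsum_zero dirsum_opp dirsum_add.
Proof. by move=> u; apply: dirsum_eq => i /=; rewrite addNr. Qed.

HB.instance Definition _ := GRing.isZmodule.Build dirsum
  dirsum_addA dirsum_addC dirsum_add0 dirsum_addN.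

Lemma dirsumD (u v : dirsum) i : (u + v) i = u i + v i. Proof. by []. Qed.
Lemma dirsum0 i : (0 : dirsum) i = 0. Proof. by []. Qed.

End DirectSum.

Local Close Scope ring_scope.
Local Open Scope group_scope.

Section Subgroups.
Variable G : groupType.
Implicit Types (A H S : set G) (x y z : G).

Definition subgroup A : Prop :=
  [/\ A 1, forall x y, A x -> A y -> A (x * y) & forall x, A x -> A x^-1].

Definition generated S : set G := smallest subgroup S.

Lemma generated_subgroup S : subgroup (generated S).
Proof.
split=> [|x y Sx Sy|x Sx] A AS; have [[A1 AM AV] SA] := AS.
- exact: A1.
- by apply: (AM); [exact: Sx|exact: Sy].
- by apply: AV; exact: Sx.
Qed.

Lemma Hall_Witt x y z :
  [~ x, y^-1, z] ^ y * [~ y, z^-1, x] ^ z * [~ z, x^-1, y] ^ x = 1.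
Proof.
pose a x y z : G := x * z * y ^ x.
suffices hw_aux u v w: [~ u, v^-1, w] ^ v = (a u v w)^-1 * (a v w u).
  by rewrite !hw_aux; move: a {hw_aux} => a; rewrite 2!mulgA !mulgK mulVg.
rewrite /a commgEr conjMg -conjgM /commg !conjgE !invgM !invgK !mulgA.
by rewrite ?(mulgK, mulgVK, mulgV, mulVg, mul1g).
Qed.

Lemma commMgJ x y z : [~ x * y, z] = [~ x, z] ^ y * [~ y, z].
Proof.
by rewrite /commg !conjgE !invgM !mulgA !(mulgK, mulgVK).
Qed.

Lemma commgMJ x y z : [~ x, y * z] = [~ x, z] * [~ x, y] ^ z.
Proof.
by rewrite /commg !conjgE !invgM !mulgA !(mulgK, mulgVK).
Qed.

Lemma subgroup_conj A x y : subgroup A -> A x -> A y -> A (x ^ y).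
Proof. by case=> _ AM AV Ax Ay; apply: (AM); [exact: AV|exact: AM]. Qed.

Lemma subgroup_comm A x y : subgroup A -> A x -> A y -> A [~ x, y].
Proof.
move=> sgA Ax Ay; have [_ AM AV] := sgA.
by apply: (AM); [exact: AV|exact: subgroup_conj].
Qed.

End Subgroups.

(* ns k is the term of degree k + 1: terms are numbered from 0, so that the
   requirement [G_p, G_q] <= G_(p + q) becomes nseries_comm. *)
Record nseries (G : groupType) := NSeries {
  ns :> nat -> set G;
  ns_subgroup : forall k, subgroup (ns k);
  ns_desc : forall k, ns k.+1 `<=` ns k;
  ns_comm : forall i j x y, ns i x -> ns j y -> ns (i + j).+1 [~ x, y] }.

Section LowerCentralSeries.
Variables (G : groupType) (A : set G).

(* lcs k is Gamma_(k + 1)(A). *)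
Fixpoint lcs (k : nat) : set G :=
  if k is k'.+1 then
    generated [set z | exists x y, [/\ lcs k' x, A y & z = [~ x, y]]]
  else A.

Hypothesis sgA : subgroup A.

Lemma lcs_subgroup k : subgroup (lcs k).
Proof. by case: k => [|k] //=; exact: generated_subgroup. Qed.

Lemma lcs_comm1 k x y : lcs k x -> A y -> lcs k.+1 [~ x, y].
Proof. by move=> kx Ay; apply: sub_gen_smallest; exists x, y. Qed.

Lemma lcs_sub0 k : lcs k `<=` A.
Proof.
elim: k => // k IH; apply: smallest_sub => // _ [x [y [/IH Ax Ay ->]]].
exact: subgroup_comm.
Qed.

Lemma lcs_desc k : lcs k.+1 `<=` lcs k.
Proof.
elim: k => [|k IH]; first exact: lcs_sub0.
apply: smallest_sub; first exact: lcs_subgroup.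
by move=> _ [x [y [/IH kx Ay ->]]]; exact: lcs_comm1.
Qed.

Lemma lcs_conj k x y : lcs k x -> A y -> lcs k (x ^ y).
Proof.
move=> kx Ay; have [_ kM _] := lcs_subgroup k.
have -> : x ^ y = x * [~ x, y] by rewrite /commg mulgA mulgV mul1g.
by apply: kM => //; apply: lcs_desc; exact: lcs_comm1.
Qed.

Lemma lcs_comm i j x y : lcs i x -> lcs j y -> lcs (i + j).+1 [~ x, y].
Proof.
elim: j i x y => [|j IH] i x y ix jy; first by rewrite addn0; exact: lcs_comm1.
have [A1 AM AV] := sgA; rewrite addnS; set N := lcs (i + j).+2.
have [N1 NM NV] : subgroup N by exact: lcs_subgroup.
suff: [set y | A y /\ N [~ x, y]] y by case.
apply: (jy : generated _ _); split; last first.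
  move=> _ [z [w [jz Aw ->]]].
  have Az := lcs_sub0 jz; have Ax := lcs_sub0 ix.
  have [Az' Aw' Ax'] : [/\ A z^-1, A w^-1 & A x^-1] by split; exact: AV.
  split; first exact: subgroup_comm.
  have := Hall_Witt z w^-1 x; rewrite invgK => hw.
  have N2 : N ([~ w^-1, x^-1, z] ^ x).
    apply: lcs_conj => //; rewrite /N -addSn; apply: IH => //.
    have [_ _ iV] := lcs_subgroup i; have [_ _ iSV] := lcs_subgroup i.+1.
    by rewrite -invgR; apply: iSV; apply: lcs_comm1 => //; exact: iV.
  have N3 : N ([~ x, z^-1, w^-1] ^ z).
    apply: lcs_conj => //; apply: lcs_comm1 => //; apply: IH => //.
    by have [_ _] := lcs_subgroup j; apply.
  have N4 : N ([~ z, w, x] ^ w^-1).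
    have -> : [~ z, w, x] ^ w^-1 =
        ([~ w^-1, x^-1, z] ^ x * [~ x, z^-1, w^-1] ^ z)^-1.
      by apply: invg_inj; rewrite invgK; apply: mulg1_eq; rewrite mulgA.
    by apply: (NV); exact: NM.
  have := lcs_conj N4 Aw; rewrite conjgKV => N5.
  by rewrite -invgR; exact: NV.
split=> [|u v [Au Nu] [Av Nv]|u [Au Nu]].
- by split=> //; rewrite commg1.
- split; first exact: AM.
  by rewrite commgMJ; apply: (NM) => //; exact: lcs_conj.
- split; first exact: AV.
  have : [~ x, u^-1] * [~ x, u] ^ u^-1 = 1 by rewrite -commgMJ mulgV commg1.
  move=> /eqP; rewrite mulg_eq1 => /eqP ->; apply: (NV).
  by apply: lcs_conj => //; exact: AV.
Qed.

Definition lcs_nseries : nseries G :=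
  NSeries lcs_subgroup lcs_desc lcs_comm.

End LowerCentralSeries.

Section Restriction.
Variables (G : groupType) (F : nseries G) (H : set G).
Hypothesis sgH : subgroup H.

Fact ns_restr_subgroup k : subgroup (F k `&` H).
Proof.
have [F1 FM FV] := ns_subgroup F k; have [H1 HM HV] := sgH.
split=> // [x y [? ?] [? ?]|x [? ?]]; split.
- exact: FM.
- exact: HM.
- exact: FV.
- exact: HV.
Qed.
Fact ns_restr_desc k : F k.+1 `&` H `<=` F k `&` H.
Proof. by move=> x [/ns_desc]. Qed.
Fact ns_restr_comm i j x y : (F i `&` H) x -> (F j `&` H) y ->
  (F (i + j).+1 `&` H) [~ x, y].
Proof.
move=> [Fx Hx] [Fy Hy]; split; [exact: ns_comm|exact: subgroup_comm].
Qed.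

Definition ns_restr : nseries G :=
  NSeries ns_restr_subgroup ns_restr_desc ns_restr_comm.

End Restriction.

Section Piece.
Variables (G : groupType) (F : nseries G) (k : nat).

Definition piece_rel : rel (F k) :=
  fun x y => `[< F k.+1 ((\val x)^-1 * \val y) >].

Fact piece_rel_refl : reflexive piece_rel.
Proof.
by move=> x; apply/asboolP; rewrite mulVg; have [] := ns_subgroup F k.+1.
Qed.
Fact piece_rel_sym : symmetric piece_rel.
Proof.
have [_ _ FV] := ns_subgroup F k.+1.
by move=> x y; apply/asboolP/asboolP => /FV; rewrite invgM invgK.
Qed.
Fact piece_rel_trans : transitive piece_rel.
Proof.
have [_ FM _] := ns_subgroup F k.+1.
move=> y x z /asboolP xy /asboolP yz; apply/asboolP.
by have := FM _ _ xy yz; rewrite -mulgA mulVKg.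
Qed.
Canonical piece_equiv :=
  EquivRel piece_rel piece_rel_refl piece_rel_sym piece_rel_trans.

Definition piece := {eq_quot piece_equiv}.
HB.instance Definition _ := Choice.on piece.

Fact piece_one_subproof : 1 \in F k.
Proof. by apply/mem_set; have [] := ns_subgroup F k. Qed.

(* The class of g, with junk value 0 when g is not in F k. *)
Definition cls (g : G) : piece :=
  \pi_{eq_quot piece_equiv} (insubd (exist _ 1 piece_one_subproof : F k) g).

Definition lift (c : piece) : G := \val (repr (c : {eq_quot piece_equiv})).

Lemma liftP c : F k (lift c).
Proof. exact: set_mem (valP (repr c)). Qed.

Lemma liftK : cancel lift cls.
Proof. by move=> c; rewrite /cls /lift valKd reprK. Qed.

Lemma cls_eqP x y : F k x -> F k y -> cls x = cls y <-> F k.+1 (x^-1 * y).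
Proof.
move=> /mem_set Fx /mem_set Fy; split.
  move=> /eqP; rewrite /cls eqmodE => /asboolP.
  by rewrite !insubdK.
move=> xy; apply/eqP; rewrite /cls eqmodE; apply/asboolP.
by rewrite !insubdK.
Qed.

Lemma cls_lift x : F k x -> F k.+1 (x^-1 * lift (cls x)).
Proof. by move=> Fx; apply/cls_eqP => //; rewrite ?liftK //; exact: liftP. Qed.

Definition piece_zero : piece := cls 1.
Definition piece_add (c d : piece) : piece := cls (lift c * lift d).
Definition piece_opp (c : piece) : piece := cls (lift c)^-1.

Lemma ns_conj x y : F k x -> F 0%N y -> F k (x ^ y).
Proof.
move=> Fx Fy; have [_ FM _] := ns_subgroup F k.
have -> : x ^ y = x * [~ x, y] by rewrite /commg mulgA mulgV mul1g.
by apply: (FM) => //; apply: ns_desc; rewrite -[k in k.+1]addn0; exact: ns_comm.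
Qed.

Lemma ns_le j : (j <= k)%N -> F k `<=` F j.
Proof.
move=> /subnK <-; elim: (k - j)%N => // i IH x.
by rewrite addSn => /ns_desc; exact: IH.
Qed.

End Piece.

Section PieceTheory.
Variables (G : groupType) (F : nseries G) (k : nat).
Local Notation cls := (cls F k).
Local Notation piece := (piece F k).

Lemma cls_add x y : F k x -> F k y -> cls (x * y) = piece_add (cls x) (cls y).
Proof.
move=> Fx Fy; have [_ FM _] := ns_subgroup F k.
have [_ FM' _] := ns_subgroup F k.+1.
apply/cls_eqP; [exact: FM|by apply: (FM); exact: liftP|].
set x' := lift _; set y' := lift _.
have -> : (x * y)^-1 * (x' * y') = (x^-1 * x') ^ y * (y^-1 * y').
  by rewrite /conjg invgM !mulgA !(mulgK, mulgVK).
apply: (FM'); last exact: cls_lift.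
by apply: ns_conj; [exact: cls_lift|exact: ns_le Fy].
Qed.

Fact piece_addA : associative (@piece_add _ F k).
Proof.
move=> a b c; rewrite -(liftK a) -(liftK b) -(liftK c).
have [_ FM _] := ns_subgroup F k.
have [Fa Fb Fc] := And3 (liftP a) (liftP b) (liftP c).
by rewrite -!cls_add ?mulgA //; exact: FM.
Qed.
Fact piece_addC : commutative (@piece_add _ F k).
Proof.
move=> a b; rewrite -(liftK a) -(liftK b).
have [_ FM FV] := ns_subgroup F k; have [Fa Fb] := conj (liftP a) (liftP b).
rewrite -!cls_add //; apply/cls_eqP; [exact: FM|exact: FM|].
have -> : (lift a * lift b)^-1 * (lift b * lift a) = [~ lift b, lift a].
  by rewrite /commg /conjg invgM !mulgA.
by apply: ns_le (ns_comm Fb Fa); rewrite ltnS leq_addr.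
Qed.
Fact piece_add0 : left_id (@piece_zero _ F k) (@piece_add _ F k).
Proof.
move=> a; rewrite -(liftK a) /piece_zero.
have [F1 _ _] := ns_subgroup F k; have Fa := liftP a.
by rewrite -cls_add // mul1g.
Qed.
Fact piece_addN :
  left_inverse (@piece_zero _ F k) (@piece_opp _ F k) (@piece_add _ F k).
Proof.
move=> a; rewrite -[X in piece_add _ X](liftK a) /piece_zero /piece_opp.
have [_ _ FV] := ns_subgroup F k; have Fa := liftP a.
by rewrite -cls_add ?mulVg //; exact: FV.
Qed.

HB.instance Definition _ := GRing.isZmodule.Build piece
  piece_addA piece_addC piece_add0 piece_addN.

Local Open Scope ring_scope.

Lemma clsM x y : F k x -> F k y -> cls (x * y)%g = cls x + cls y.
Proof. exact: cls_add. Qed.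

Lemma cls1 : cls 1%g = 0. Proof. by []. Qed.

Lemma clsV x : F k x -> cls x^-1%g = - cls x.
Proof.
move=> Fx; have [_ _ FV] := ns_subgroup F k.
by apply/eqP; rewrite -addr_eq0 -clsM ?mulVg ?cls1 //; exact: FV.
Qed.

Lemma cls_eq0P x : F k x -> cls x = 0 <-> F k.+1 x.
Proof.
have [F1 _ _] := ns_subgroup F k; have [_ _ FV] := ns_subgroup F k.+1.
move=> Fx; rewrite -cls1 cls_eqP // mulg1; split=> /FV //.
by rewrite invgK.
Qed.

Lemma lift0 : F k.+1 (lift (0 : piece)).
Proof. by apply/cls_eq0P; rewrite ?liftK //; exact: liftP. Qed.

End PieceTheory.

Section Graded.
Variables (G : groupType) (F : nseries G).
Implicit Types (x y z : G) (i j k : nat).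
Local Open Scope ring_scope.

(* gr F is the direct sum over q >= 1 of ns F q.-1 / ns F q. *)
Definition gr := dirsum (piece F).
HB.instance Definition _ := GRing.Zmodule.on gr.
Implicit Types u v w : gr.

Fact hom_finite q x : exists N, forall k, (N <= k)%N ->
  cls F k (if k == q then x else 1%g) = 0.
Proof. by exists q.+1 => k qk; rewrite gtn_eqF. Qed.

Definition hom q x : gr := DirSum (hom_finite q x).

Lemma hom_in q x k : F q x -> F k (if k == q then x else 1%g).
Proof. by case: eqP => [->|_] //; have [] := ns_subgroup F k. Qed.

Lemma homM q x y : F q x -> F q y -> hom q (x * y)%g = hom q x + hom q y.
Proof.
move=> qx qy; apply: dirsum_eq => k; rewrite dirsumD /=.
rewrite -clsM; [|exact: hom_in..].
by case: eqP => // _; rewrite mulg1.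
Qed.

Lemma hom_eq0 q x : F q.+1 x -> hom q x = 0.
Proof.
move=> qx; apply: dirsum_eq => k; rewrite dirsum0 /=; case: eqP => [->|//].
by apply/cls_eq0P => //; exact: ns_desc.
Qed.

Lemma hom1 q : hom q 1%g = 0.
Proof. by apply: hom_eq0; have [] := ns_subgroup F q.+1. Qed.

Lemma homV q x : F q x -> hom q x^-1%g = - hom q x.
Proof.
move=> qx; have [_ _ FV] := ns_subgroup F q.
by apply/eqP; rewrite -addr_eq0 -homM ?mulVg ?hom1 //; exact: FV.
Qed.

Lemma homJ q x y : F q x -> F 0%N y -> hom q (x ^ y)%g = hom q x.
Proof.
move=> qx qy; have -> : (x ^ y = x * [~ x, y])%g.
  by rewrite /commg mulgA mulgV mul1g.
have xy : F q.+1 [~ x, y]%g by rewrite -[q in q.+1]addn0; exact: ns_comm.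
by rewrite homM ?(hom_eq0 xy) ?addr0 //; exact: ns_desc.
Qed.

Lemma gr_ind (P : gr -> Prop) : P 0 ->
  (forall q x u, F q x -> P u -> P (hom q x + u)) -> forall u, P u.
Proof.
move=> P0 PD u; have [N] := dirsum_finite u.
elim: N u => [|N IH] u uN.
  by have -> : u = 0 by apply: dirsum_eq => i; rewrite uN.
rewrite -[u](subrKC (hom N (lift (u N)))); apply: PD; first exact: liftP.
apply: IH => i; rewrite leq_eqVlt => /orP[/eqP <-|Ni].
  by rewrite dirsumD /= eqxx liftK subrr.
by rewrite dirsumD /= (uN _ Ni) gtn_eqF // cls1 subr0.
Qed.

Definition gr_bracket_fun u v k : piece F k :=
  \sum_(i < k) cls F k [~ lift (u i), lift (v (k.-1 - i)%N)]%g.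

Fact cls_comm0l i j k (c : piece F i) (d : piece F j) :
  k = (i + j).+1 -> c = 0 -> cls F k [~ lift c, lift d]%g = 0.
Proof.
move=> -> ->; have h := ns_comm (lift0 F i) (liftP d).
by apply/cls_eq0P => //; exact: ns_desc.
Qed.
Fact cls_comm0r i j k (c : piece F i) (d : piece F j) :
  k = (i + j).+1 -> d = 0 -> cls F k [~ lift c, lift d]%g = 0.
Proof.
move=> -> ->; have := ns_comm (liftP c) (lift0 F j); rewrite addnS => h.
by apply/cls_eq0P => //; exact: ns_desc.
Qed.

Fact ord_predE k (i : 'I_k) : k = (i + (k.-1 - i)).+1.
Proof. by case: k i => [[]//|k] i /=; rewrite subnKC // -ltnS. Qed.

Fact gr_bracket_finite u v :
  exists N, forall k, (N <= k)%N -> gr_bracket_fun u v k = 0.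
Proof.
have [N uN] := dirsum_finite u; have [M vM] := dirsum_finite v.
exists (N + M)%N => k NMk; apply: big1 => i _.
have kE := ord_predE i.
case: (leqP N i) => [/uN|iN]; first exact: cls_comm0l.
apply: cls_comm0r => //; apply: vM; rewrite -ltnS -(ltn_add2l i) addnS -kE.
by apply: leq_trans _ NMk; rewrite ltn_add2r.
Qed.

(* In degree p + q, the commutators of the components of degrees p and q. *)
Definition gr_bracket u v : gr := DirSum (gr_bracket_finite u v).

Lemma cls_commMl i j k x x' y : k = (i + j).+1 -> F i x -> F i x' -> F j y ->
  cls F k [~ x * x', y]%g = cls F k [~ x, y]%g + cls F k [~ x', y]%g.
Proof.
move=> -> ix ix' jy; have xy := ns_comm ix jy; have x'y := ns_comm ix' jy.
have F0x' : F 0%N x' by exact: ns_le ix'.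
rewrite commMgJ clsM //; last exact: ns_conj.
congr (_ + _); apply/esym/cls_eqP => //; first exact: ns_conj.
by apply: ns_le (ns_comm xy ix'); rewrite ltnS leq_addr.
Qed.

Lemma cls_commMr i j k x y y' : k = (i + j).+1 -> F i x -> F j y -> F j y' ->
  cls F k [~ x, y * y']%g = cls F k [~ x, y]%g + cls F k [~ x, y']%g.
Proof.
move=> kE ix jy jy'; rewrite -invgR clsV; last first.
  by rewrite kE addnC; apply: ns_comm => //; have [_ FM _] := ns_subgroup F j;
     exact: FM.
rewrite (cls_commMl _ jy jy' ix) 1?addnC // opprD -!clsV ?invgR //.
  by rewrite kE addnC; exact: ns_comm.
by rewrite kE addnC; exact: ns_comm.
Qed.

Lemma cls_comm_lift i j k x y : k = (i + j).+1 -> F i x -> F j y ->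
  cls F k [~ lift (cls F i x), lift (cls F j y)]%g = cls F k [~ x, y]%g.
Proof.
move=> kE ix jy; have ix' := cls_lift ix; have jy' := cls_lift jy.
set x' := lift _ in ix' *; set y' := lift _ in jy' *.
rewrite -[x'](mulVKg x) -[y'](mulVKg y).
move: (x^-1 * x')%g (y^-1 * y')%g ix' jy' => {x' y'} s t si tj.
have [Fs Ft] := conj (ns_desc si) (ns_desc tj).
have [_ FM _] := ns_subgroup F j.
rewrite (cls_commMl kE) //; last exact: FM.
rewrite !(cls_commMr kE) // -!addrA -[RHS]addr0; congr (_ + _).
have z1 : cls F k [~ x, t]%g = 0.
  have := ns_comm ix tj; rewrite addnS -kE => h.
  by apply/cls_eq0P => //; exact: ns_desc.
have z2 y0 : F j y0 -> cls F k [~ s, y0]%g = 0.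
  move=> jy0; have := ns_comm si jy0; rewrite addSn -kE => h.
  by apply/cls_eq0P => //; exact: ns_desc.
by rewrite z1 !z2 // !addr0.
Qed.

Fact gr_bracketDl u v w :
  gr_bracket (u + v) w = gr_bracket u w + gr_bracket v w.
Proof.
apply: dirsum_eq => k; rewrite dirsumD /= -big_split /=.
apply: eq_bigr => i _; rewrite dirsumD; have kE := ord_predE i.
rewrite -(cls_commMl kE); try exact: liftP.
have [_ FM _] := ns_subgroup F i.
rewrite -[RHS](cls_comm_lift kE); try exact: liftP.
  by rewrite clsM ?liftK //; exact: liftP.
by apply: FM; exact: liftP.
Qed.

Fact gr_bracketDr u v w :
  gr_bracket u (v + w) = gr_bracket u v + gr_bracket u w.
Proof.
apply: dirsum_eq => k; rewrite dirsumD /= -big_split /=.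
apply: eq_bigr => i _; rewrite dirsumD; have kE := ord_predE i.
rewrite -(cls_commMr kE); try exact: liftP.
have [_ FM _] := ns_subgroup F (k.-1 - i)%N.
rewrite -[RHS](cls_comm_lift kE); try exact: liftP.
  by rewrite clsM ?liftK //; exact: liftP.
by apply: FM; exact: liftP.
Qed.

Lemma gr_bracket_hom i j x y : F i x -> F j y ->
  gr_bracket (hom i x) (hom j y) = hom (i + j).+1 [~ x, y]%g.
Proof.
move=> ix jy; apply: dirsum_eq => k /=.
have E (a : 'I_k) : cls F k [~ lift (hom i x a), lift (hom j y (k.-1 - a)%N)]%g
    = if (nat_of_ord a == i) && ((k.-1 - a)%N == j)
      then cls F k [~ x, y]%g else 0.
  rewrite /= (cls_comm_lift (ord_predE a)); [|exact: hom_in..].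
  by case: eqP => _; case: eqP => _ //=; rewrite ?commg1 ?comm1g ?cls1.
rewrite /gr_bracket_fun (eq_bigr _ (fun a _ => E a)).
case: (eqVneq k (i + j).+1) => [kE|kE].
  have ik : (i < k)%N by rewrite kE ltnS leq_addr.
  rewrite (bigD1 (Ordinal ik)) //= big1 ?addr0 => [|a].
    by rewrite eqxx kE /= addKn eqxx.
  by rewrite -val_eqE /= => /negPf ->.
rewrite cls1; apply: big1 => a _; case: ifP => // /andP[/eqP ai /eqP aj].
by case/eqP: kE; rewrite -ai -aj; exact: ord_predE.
Qed.

Let brN u v : gr_bracket (- u) v = - gr_bracket u v.
Proof.
have br0 : gr_bracket 0 v = 0.
  by apply: (addrI (gr_bracket 0 v)); rewrite -gr_bracketDl !addr0.
by apply/eqP; rewrite -addr_eq0 -gr_bracketDl addNr br0.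
Qed.
Let brNr u v : gr_bracket u (- v) = - gr_bracket u v.
Proof.
have br0 : gr_bracket u 0 = 0.
  by apply: (addrI (gr_bracket u 0)); rewrite -gr_bracketDr !addr0.
by apply/eqP; rewrite -addr_eq0 -gr_bracketDr addNr br0.
Qed.
Let br0 v : gr_bracket 0 v = 0.
Proof. by rewrite -[0 in LHS](subrr 0) gr_bracketDl brN subrr. Qed.
Let br0r v : gr_bracket v 0 = 0.
Proof. by rewrite -[0 in LHS](subrr 0) gr_bracketDr brNr subrr. Qed.

Fact gr_bracketC u v : gr_bracket u v = - gr_bracket v u.
Proof.
elim/gr_ind: u => [|i x u ix IHu]; first by rewrite br0 br0r oppr0.
rewrite gr_bracketDl gr_bracketDr IHu opprD; congr (_ + _).
elim/gr_ind: v {u IHu} => [|j y v jy IHv]; first by rewrite br0 br0r oppr0.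
rewrite gr_bracketDl gr_bracketDr IHv opprD; congr (_ + _).
rewrite !gr_bracket_hom // addnC -homV ?invgR //; exact: ns_comm.
Qed.

Fact gr_bracketxx u : gr_bracket u u = 0.
Proof.
elim/gr_ind: u => [|i x u ix IHu]; first by rewrite br0.
rewrite gr_bracketDl !gr_bracketDr IHu addr0 gr_bracket_hom // commgg hom1 add0r.
by rewrite gr_bracketC addNr.
Qed.

Fact gr_bracket_jacobi u v w :
  gr_bracket (gr_bracket u v) w + gr_bracket (gr_bracket v w) u
  + gr_bracket (gr_bracket w u) v = 0.
Proof.
pose J u v w := gr_bracket (gr_bracket u v) w + gr_bracket (gr_bracket v w) u
  + gr_bracket (gr_bracket w u) v.
have JC a b c : J a b c = J b c a by rewrite /J -addrA addrC.
have J0 a b : J 0 a b = 0 by rewrite /J !(br0, br0r) !addr0.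
have JD a a' b c : J (a + a') b c = J a b c + J a' b c.
  rewrite /J !(gr_bracketDl, gr_bracketDr).
  set a1 := gr_bracket (gr_bracket a b) c; set a2 := gr_bracket _ a.
  by rewrite (addrACA (a1 + a2)) (addrACA a1).
rewrite -/(J u v w).
elim/gr_ind: u => [|i x u ix IHu]; first exact: J0.
rewrite JD IHu addr0 JC {u IHu}.
elim/gr_ind: v => [|j y v jy IHv]; first exact: J0.
rewrite JD IHv addr0 JC {v IHv}.
elim/gr_ind: w => [|l z w lz IHw]; first exact: J0.
rewrite JD IHw addr0 JC {w IHw}.
have [_ _ FVi] := ns_subgroup F i; have [_ _ FVj] := ns_subgroup F j.
have [_ _ FVl] := ns_subgroup F l.
pose K := ((i + j).+1 + l).+1.
have K2 : ((j + l).+1 + i).+1 = K by rewrite /K !addSn addnC addnA.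
have K3 : ((l + i).+1 + j).+1 = K by rewrite /K !addSn -addnA addnC.
have c1 : F K [~ x, y^-1, z]%g by do 2?apply: ns_comm => //; exact: FVj.
have c2 : F K [~ y, z^-1, x]%g.
  by rewrite -K2; do 2?apply: ns_comm => //; exact: FVl.
have c3 : F K [~ z, x^-1, y]%g.
  by rewrite -K3; do 2?apply: ns_comm => //; exact: FVi.
have [x0 y0 z0] : [/\ F 0%N x, F 0%N y & F 0%N z].
  by split; [exact: ns_le ix|exact: ns_le jy|exact: ns_le lz].
have [_ FM _] := ns_subgroup F K.
have := congr1 (hom K) (Hall_Witt x y z).
have hM3 a b c : F K a -> F K b -> F K c ->
    hom K (a * b * c)%g = hom K a + hom K b + hom K c.
  by move=> Ka Kb Kc; rewrite !homM //; exact: FM.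
rewrite hom1 hM3; [|exact: ns_conj..].
rewrite (homJ c1 y0) (homJ c2 z0) (homJ c3 x0).
have h1 : hom K [~ x, y^-1, z]%g
    = - gr_bracket (gr_bracket (hom i x) (hom j y)) (hom l z).
  rewrite -brN -brNr -homV // gr_bracket_hom //; last exact: FVj.
  by rewrite gr_bracket_hom //; apply: ns_comm => //; exact: FVj.
have h2 : hom K [~ y, z^-1, x]%g
    = - gr_bracket (gr_bracket (hom j y) (hom l z)) (hom i x).
  rewrite -K2 -brN -brNr -homV // gr_bracket_hom //; last exact: FVl.
  by rewrite gr_bracket_hom //; apply: ns_comm => //; exact: FVl.
have h3 : hom K [~ z, x^-1, y]%g
    = - gr_bracket (gr_bracket (hom l z) (hom i x)) (hom j y).
  rewrite -K3 -brN -brNr -homV // gr_bracket_hom //; last exact: FVi.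
  by rewrite gr_bracket_hom //; apply: ns_comm => //; exact: FVi.
rewrite h1 h2 h3 -!opprD => /eqP; rewrite oppr_eq0 => /eqP E.
exact: E.
Qed.

HB.instance Definition _ := Zmodule_isLieRing.Build gr
  gr_bracketDl gr_bracketDr gr_bracketxx gr_bracket_jacobi.

Lemma lieb_hom i j x y : F i x -> F j y ->
  lieb (hom i x) (hom j y) = hom (i + j).+1 [~ x, y]%g.
Proof. exact: gr_bracket_hom. Qed.

End Graded.

Section RelativeInclusion.
Variables (G : groupType) (F : nseries G) (H : set G).
Hypothesis sgH : subgroup H.
Local Notation FH := (ns_restr F sgH).
Local Open Scope ring_scope.

Fact rel_incl_finite (u : gr FH) :
  exists N, forall k, (N <= k)%N -> cls F k (lift (u k)) = 0.
Proof.
have [N uN] := dirsum_finite u; exists N => k /uN ->.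
by have [h _] := lift0 FH k; apply/cls_eq0P => //; exact: ns_desc.
Qed.

(* The map induced by the inclusions of F k `&` H in F k. *)
Definition rel_incl (u : gr FH) : gr F := DirSum (rel_incl_finite u).

Lemma rel_inclD : {morph rel_incl : u v / u + v}.
Proof.
move=> u v; apply: dirsum_eq => k; rewrite !dirsumD /=.
have [[Fu _] [Fv _]] := conj (liftP (u k)) (liftP (v k)).
have [_ FM _] := ns_subgroup F k; have [_ FHM _] := ns_subgroup FH k.
rewrite -clsM //; apply/cls_eqP; last 1 first; last exact: FM.
  suff [] : FH k.+1 ((lift (u k + v k))^-1 * (lift (u k) * lift (v k)))%g by [].
  apply/cls_eqP; [exact: liftP|by apply: FHM; exact: liftP|].
  by rewrite clsM ?liftK //; exact: liftP.
by have [] := liftP (u k + v k).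
Qed.

Lemma rel_incl_hom q x : F q x -> H x -> rel_incl (hom FH q x) = hom F q x.
Proof.
move=> qx Hx; apply: dirsum_eq => k /=; have h : FH q x by [].
have := cls_lift (hom_in k h); set y := lift _ => -[xy _].
by apply/esym/cls_eqP => //; [exact: hom_in|have [] := liftP (hom FH q x k)].
Qed.

Lemma rel_incl_lie_hom : lie_hom rel_incl.
Proof.
split; first exact: rel_inclD.
have lieb0l (L : lieRingType) (z : L) : lieb 0 z = 0.
  by apply: (addrI (lieb 0 z)); rewrite -liebDl !addr0.
have lieb0r (L : lieRingType) (z : L) : lieb z 0 = 0.
  by apply: (addrI (lieb z 0)); rewrite -liebDr !addr0.
have incl0 : rel_incl 0 = 0.
  by apply: (addrI (rel_incl 0)); rewrite -rel_inclD !addr0.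
elim/gr_ind => [v|i x u ix IHu v]; first by rewrite lieb0l incl0 lieb0l.
rewrite liebDl !rel_inclD liebDl IHu; congr (_ + _); move: ix => [ix Hx].
elim/gr_ind: v => [|j y v jy IHv]; first by rewrite lieb0r incl0 lieb0r.
rewrite liebDr !rel_inclD liebDr IHv; congr (_ + _); move: jy => [jy Hy].
rewrite lieb_hom // !rel_incl_hom ?lieb_hom //; first exact: ns_comm.
exact: subgroup_comm.
Qed.

Lemma rel_incl_inj : injective rel_incl.
Proof.
move=> u v uv; apply/eqP; rewrite -subr_eq0; set w := u - v.
have : rel_incl w = 0.
  by apply: (addIr (rel_incl v)); rewrite -rel_inclD subrK add0r.
move=> w0; apply/eqP; apply: dirsum_eq => k; rewrite dirsum0 -(liftK (w k)).
have [Fw Hw] := liftP (w k); apply/cls_eq0P => //; split=> //.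
by apply/cls_eq0P => //; rewrite -[LHS]/(rel_incl w k) w0.
Qed.

End RelativeInclusion.

Section Presentation.
Variable X : choiceType.

(* (x, false) is the generator x and (x, true) its inverse. *)
Definition word := seq (X * bool).
HB.instance Definition _ := Choice.on word.

Variable R : word -> word -> Prop.

Inductive word_eqv : word -> word -> Prop :=
| WordRel u v of R u v : word_eqv u v
| WordCancel x b : word_eqv [:: (x, b); (x, ~~ b)] [::]
| WordCat u u' v v' of word_eqv u u' & word_eqv v v' :
    word_eqv (u ++ v) (u' ++ v')
| WordRefl u : word_eqv u u
| WordSym u v of word_eqv u v : word_eqv v u
| WordTrans u v w of word_eqv u v & word_eqv v w : word_eqv u w.

Definition word_rel : rel word := fun u v => `[< word_eqv u v >].

Fact word_rel_refl : reflexive word_rel.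
Proof. by move=> u; apply/asboolP; exact: WordRefl. Qed.
Fact word_rel_sym : symmetric word_rel.
Proof. by move=> u v; apply/asboolP/asboolP; exact: WordSym. Qed.
Fact word_rel_trans : transitive word_rel.
Proof.
by move=> v u w /asboolP uv /asboolP vw; apply/asboolP; exact: WordTrans vw.
Qed.
Canonical word_equiv :=
  EquivRel word_rel word_rel_refl word_rel_sym word_rel_trans.

Definition presented := {eq_quot word_equiv}.
HB.instance Definition _ := Choice.on presented.

Definition word_class (w : word) : presented := \pi_{eq_quot word_equiv} w.
Definition word_repr (g : presented) : word :=
  repr (g : {eq_quot word_equiv}).

Lemma word_classP u v : word_class u = word_class v <-> word_eqv u v.
Proof.
split; first by move=> /eqP; rewrite /word_class eqmodE => /asboolP.
by move=> uv; apply/eqP; rewrite /word_class eqmodE; apply/asboolP.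
Qed.

Lemma word_reprK : cancel word_repr word_class.
Proof. by move=> g; rewrite /word_class reprK. Qed.

Lemma word_repr_eqv w : word_eqv (word_repr (word_class w)) w.
Proof. by apply/word_classP; rewrite word_reprK. Qed.

Definition word_inv (w : word) : word := rev [seq (l.1, ~~ l.2) | l <- w].

Lemma word_invK : involutive word_inv.
Proof.
move=> w; rewrite /word_inv map_rev revK -map_comp -[RHS]map_id.
by apply: eq_map => -[x b] /=; rewrite negbK.
Qed.

Lemma word_catV w : word_eqv (w ++ word_inv w) [::].
Proof.
elim: w => [|[x b] w IH]; first exact: WordRefl.
have -> : ((x, b) :: w) ++ word_inv ((x, b) :: w) =
    [:: (x, b)] ++ ((w ++ word_inv w) ++ [:: (x, ~~ b)]).
  by rewrite /word_inv /= rev_cons -cats1 catA.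
apply: WordTrans (WordCancel x b); apply: (WordCat (WordRefl [:: (x, b)])).
exact: (WordCat IH (WordRefl [:: (x, ~~ b)])).
Qed.

Lemma word_inv_eqv u v : word_eqv u v -> word_eqv (word_inv u) (word_inv v).
Proof.
move=> uv; rewrite -[word_inv u]cats0.
apply: (WordTrans (v := word_inv u ++ (v ++ word_inv v))).
  by apply: WordCat; [exact: WordRefl|exact/WordSym/word_catV].
rewrite catA -[X in word_eqv _ X]cat0s; apply: WordCat; last exact: WordRefl.
apply: (WordTrans (v := word_inv u ++ u)).
  by apply: WordCat; [exact: WordRefl|exact: WordSym].
by rewrite -[X in _ ++ X]word_invK; exact: word_catV.
Qed.

Definition presented_one : presented := word_class [::].
Definition presented_mul (g h : presented) : presented :=
  word_class (word_repr g ++ word_repr h).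
Definition presented_inv (g : presented) : presented :=
  word_class (word_inv (word_repr g)).

Lemma presented_mulE u v :
  presented_mul (word_class u) (word_class v) = word_class (u ++ v).
Proof. by apply/word_classP; apply: WordCat; exact: word_repr_eqv. Qed.
Lemma presented_invE u : presented_inv (word_class u) = word_class (word_inv u).
Proof. by apply/word_classP/word_inv_eqv; exact: word_repr_eqv. Qed.

Fact presented_mulA : associative presented_mul.
Proof.
move=> f g h; rewrite -(word_reprK f) -(word_reprK g) -(word_reprK h).
by rewrite !presented_mulE catA.
Qed.
Fact presented_mul1g : left_id presented_one presented_mul.
Proof. by move=> g; rewrite -(word_reprK g) presented_mulE. Qed.
Fact presented_mulg1 : right_id presented_one presented_mul.
Proof. by move=> g; rewrite -(word_reprK g) presented_mulE cats0. Qed.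
Fact presented_mulgV : right_inverse presented_one presented_inv presented_mul.
Proof.
move=> g; rewrite -(word_reprK g) presented_invE presented_mulE.
exact/word_classP/word_catV.
Qed.
Fact presented_mulVg : left_inverse presented_one presented_inv presented_mul.
Proof.
move=> g; rewrite -(word_reprK g) presented_invE presented_mulE.
by apply/word_classP; rewrite -[X in _ ++ X]word_invK; exact: word_catV.
Qed.

HB.instance Definition _ := isGroup.Build presented presented_mulA
  presented_mul1g presented_mulg1 presented_mulVg presented_mulgV.

Lemma word_class_cat u v : word_class (u ++ v) = word_class u * word_class v.
Proof. by rewrite -presented_mulE. Qed.
Lemma word_class_inv u : word_class (word_inv u) = (word_class u)^-1.
Proof. by rewrite -presented_invE. Qed.

End Presentation.

(* Strands and positions are numbered 0, ..., n - 1, and the generator i of the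
   braid group on n strands crosses positions i and i + 1. *)
Inductive braid_relation (n : nat) : word 'I_n.-1 -> word 'I_n.-1 -> Prop :=
| FarComm (i j : 'I_n.-1) of i.+1 < j :
    braid_relation [:: (i, false); (j, false)] [:: (j, false); (i, false)]
| YangBaxter (i j : 'I_n.-1) of j = i.+1 :> nat :
    braid_relation [:: (i, false); (j, false); (i, false)]
                   [:: (j, false); (i, false); (j, false)].

Notation braid n := (presented (@braid_relation n)).

(* The generator sigma_i, extended by 1 outside its range. *)
Definition sigma (n i : nat) : braid n :=
  if insub i is Some k then word_class _ [:: (k, false)] else 1.

Definition crossing (i p : nat) : nat :=
  if p == i then i.+1 else if p == i.+1 then i else p.

(* The final position of the strand starting in position p. *)
Fixpoint track (n : nat) (w : word 'I_n.-1) (p : nat) : nat :=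
  if w is (i, _) :: w' then track w' (crossing i p) else p.

(* The braid obtained by removing the strand starting in position p: crossings
   involving that strand disappear, and positions above it go down by one. *)
Fixpoint remove_word (n : nat) (w : word 'I_n.-1) (p : nat) : braid n.-1 :=
  if w is (i, b) :: w' then
    let s := sigma n.-1 (unbump p i) in
    (if (p == i) || (p == i.+1) then 1 else if b then s^-1 else s)
      * remove_word w' (crossing i p)
  else 1.

Definition endpoint (n : nat) (g : braid n) : nat -> nat :=
  track (word_repr g).
Definition remove_strand (n : nat) (g : braid n) : nat -> braid n.-1 :=
  remove_word (word_repr g).

Definition pure (n : nat) : set (braid n) :=
  [set g | forall p, p < n -> endpoint g p = p].

Definition brunnian (n : nat) : set (braid n) :=
  [set g | pure g /\ forall p, p < n -> remove_strand g p = 1].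

Section BraidTheory.
Variable n : nat.
Implicit Types (u v w : word 'I_n.-1) (p i j : nat) (g h : braid n).

Lemma crossingK i : involutive (crossing i).
Proof.
move=> p; rewrite /crossing.
have [->|pi] := eqVneq p i; first by rewrite gtn_eqF // eqxx.
have [->|pSi] := eqVneq p i.+1; first by rewrite eqxx.
by rewrite (negPf pi) (negPf pSi).
Qed.

Lemma crossing_lt (i : 'I_n.-1) p : p < n -> crossing i p < n.
Proof.
have : i.+1 < n by rewrite -ltn_predRL.
by rewrite /crossing; case: eqP => //; case: eqP => // _ _; lia.
Qed.

Lemma track_lt w p : p < n -> track w p < n.
Proof. by elim: w p => [|[i b] w IH] p //= pn; apply/IH/crossing_lt. Qed.

Lemma track_cat u v p : track (u ++ v) p = track v (track u p).
Proof. by elim: u p => [|[i b] u IH] p //=. Qed.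

Lemma remove_word_cat u v p :
  remove_word (u ++ v) p = remove_word u p * remove_word v (track u p).
Proof.
by elim: u p => [|[i b] u IH] p /=; rewrite ?mul1g // IH mulgA.
Qed.

Lemma sigma_far m i j : i.+1 < j ->
  sigma m i * sigma m j = sigma m j * sigma m i.
Proof.
move=> ij; rewrite /sigma.
case: insubP => [i' _ iE|_]; last by rewrite mul1g mulg1.
case: insubP => [j' _ jE|_]; last by rewrite mul1g mulg1.
rewrite -!word_class_cat; apply/word_classP/WordRel/FarComm.
by rewrite iE jE.
Qed.

Lemma sigma_braid m i : i.+1 < m.-1 ->
  sigma m i * sigma m i.+1 * sigma m i =
  sigma m i.+1 * sigma m i * sigma m i.+1.
Proof.
move=> im; have i_m := ltnW im; rewrite /sigma.
rewrite (insubT (fun k => k < m.-1) im) (insubT (fun k => k < m.-1) i_m).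
set u := [:: _]; set v := [:: _].
rewrite -(word_class_cat _ u v) -(word_class_cat _ v u) -!word_class_cat.
by apply/word_classP/WordRel/YangBaxter.
Qed.

Let rl p i : braid n.-1 :=
  if (p == i) || (p == i.+1) then 1 else sigma n.-1 (unbump p i).

Let rl_lt p i : p < i -> rl p i = sigma n.-1 i.-1.
Proof.
by move=> pi; rewrite /rl /unbump pi subn1 ltn_eqF // ltn_eqF //; lia.
Qed.
Let rl_gt p i : i.+1 < p -> rl p i = sigma n.-1 i.
Proof.
move=> pi; rewrite /rl /unbump gtn_eqF ?(ltnW pi) // gtn_eqF //=.
by rewrite ltnNge (ltnW (ltnW pi)) subn0.
Qed.
Let rl_lo i : rl i i = 1. Proof. by rewrite /rl eqxx. Qed.
Let rl_hi i : rl i.+1 i = 1. Proof. by rewrite /rl eqxx orbT. Qed.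
Let crossing_lt_out i p : p < i -> crossing i p = p.
Proof. by move=> pi; rewrite /crossing !ltn_eqF //; lia. Qed.
Let crossing_gt_out i p : i.+1 < p -> crossing i p = p.
Proof. by move=> pi; rewrite /crossing !gtn_eqF //; lia. Qed.
Let crossing_lo i : crossing i i = i.+1.
Proof. by rewrite /crossing eqxx. Qed.
Let crossing_hi i : crossing i i.+1 = i.
Proof. by rewrite /crossing eqxx gtn_eqF. Qed.
Local Ltac cross := repeat first
  [ rewrite crossing_lo | rewrite crossing_hi
  | rewrite rl_lo | rewrite rl_hi
  | match goal with
    | |- context [crossing ?i ?p] =>
      first [ rewrite (@crossing_lt_out i p); [|by lia]
            | rewrite (@crossing_gt_out i p); [|by lia] ]
    | |- context [rl ?p ?i] =>
      first [ rewrite (@rl_lt p i); [|by lia] | rewrite (@rl_gt p i); [|by lia] ]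
    end ];
  rewrite ?mulg1 ?mul1g.

Lemma remove_word_eqv u v : word_eqv (@braid_relation n) u v ->
  forall p, p < n -> track u p = track v p /\ remove_word u p = remove_word v p.
Proof.
elim=> {u v} [_ _ [i j ij|i j ji]|i b|u u' v v' _ IHu _ IHv|//|u v _ IH|
              u v w _ IHu _ IHv] p pn.
- rewrite /= -!/(rl _ _) !mulg1.
  move: {i j}(nat_of_ord i) (nat_of_ord j) ij => i j ij.
  case: (ltngtP p i) => [pi|ip|->]; last by cross.
    by cross; split=> //; apply: sigma_far; lia.
  case: (ltngtP p i.+1) => [|{}ip|->]; [by lia| |by cross].
  case: (ltngtP p j) => [pj|jp|->]; last by cross.
    by cross; split=> //; apply: sigma_far; lia.
  case: (ltngtP p j.+1) => [|{}jp|->]; [by lia| |by cross].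
  by cross; split=> //; apply: sigma_far; lia.
- rewrite /= -!/(rl _ _) !mulg1 !mulgA.
  have := ltn_ord j; rewrite ji; move: {i j ji}(nat_of_ord i) => i jn.
  case: (ltngtP p i) => [pi|ip|->]; last by cross.
    cross; split=> //.
    by case: i pi jn => // i _ jn; apply: sigma_braid; lia.
  case: (ltngtP p i.+1) => [|{}ip|->]; [by lia| |by cross].
  case: (ltngtP p i.+2) => [|{}ip|->]; [by lia| |by cross].
  by cross; split=> //; apply: sigma_braid; lia.
- rewrite /= crossingK mulg1; split=> //.
  rewrite /crossing; have [->|pi] := eqVneq p i.
    by rewrite /= eqxx orbT mulg1.
  have [->|pSi] := eqVneq p i.+1; first by rewrite eqxx /= mulg1.
  by rewrite (negPf pi) (negPf pSi) /=; case: b; rewrite ?mulVg ?mulgV.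
- have [tu ru] := IHu p pn; have [tv rv] := IHv _ (track_lt u pn).
  by rewrite !track_cat !remove_word_cat ru rv -tu tv.
- by have [-> ->] := IH p pn.
- by have [-> ->] := IHu p pn; exact: IHv.
Qed.

Lemma endpoint_class w p : p < n -> endpoint (word_class _ w) p = track w p.
Proof. by move=> pn; have [] := remove_word_eqv (word_repr_eqv _ w) pn. Qed.

Lemma remove_strand_class w p : p < n ->
  remove_strand (word_class _ w) p = remove_word w p.
Proof. by move=> pn; have [] := remove_word_eqv (word_repr_eqv _ w) pn. Qed.

Lemma endpoint_lt g p : p < n -> endpoint g p < n.
Proof. exact: track_lt. Qed.

Lemma endpointM g h p : p < n -> endpoint (g * h) p = endpoint h (endpoint g p).
Proof.
move=> pn; rewrite -{1}(word_reprK g) -{1}(word_reprK h) -word_class_cat.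
by rewrite endpoint_class // track_cat.
Qed.

Lemma remove_strandM g h p : p < n ->
  remove_strand (g * h) p = remove_strand g p * remove_strand h (endpoint g p).
Proof.
move=> pn; rewrite -{1}(word_reprK g) -{1}(word_reprK h) -word_class_cat.
by rewrite remove_strand_class // remove_word_cat.
Qed.

Lemma endpoint1 p : p < n -> endpoint (1 : braid n) p = p.
Proof. by move=> pn; rewrite -[1]/(word_class _ [::]) endpoint_class. Qed.

Lemma remove_strand1 p : p < n -> remove_strand (1 : braid n) p = 1.
Proof.
move=> pn; rewrite -[X in remove_strand X]/(word_class _ [::]).
by rewrite remove_strand_class.
Qed.

Lemma endpointV g p : p < n -> endpoint g^-1 (endpoint g p) = p.
Proof. by move=> pn; rewrite -endpointM // mulgV endpoint1. Qed.

Lemma pure_subgroup : subgroup (@pure n).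
Proof.
split=> [p /endpoint1 //|g h Pg Ph p pn|g Pg p pn].
- by rewrite endpointM // Pg // Ph.
- by have := endpointV g pn; rewrite Pg.
Qed.

Lemma pureJ g h : pure g -> pure (g ^ h).
Proof.
move=> Pg p pn; rewrite /conjg endpointM // endpointM ?endpoint_lt //.
by rewrite Pg ?endpoint_lt // -endpointM // mulVg endpoint1.
Qed.

Lemma brunnian_subgroup : subgroup (@brunnian n).
Proof.
have [P1 PM PV] := pure_subgroup.
split=> [|g h [Pg Bg] [Ph Bh]|g [Pg Bg]].
- by split=> [|p pn]; [exact: P1|exact: remove_strand1].
- by split=> [|p pn]; [exact: PM|rewrite remove_strandM // Pg // Bg // Bh // mulg1].
- split=> [|p pn]; first exact: PV.
  have := remove_strand1 pn; rewrite -[X in remove_strand X](mulgV g).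
  by rewrite remove_strandM // Bg // Pg // mul1g.
Qed.

(* The standard generator a_(i + 1, j + 1), for i < j < n:
   sigma_(j-1) ... sigma_(i+1) sigma_i^2 sigma_(i+1)^-1 ... sigma_(j-1)^-1. *)
Definition pure_gen i j : braid n :=
  let c := \prod_(k <- rev (iota i.+1 (j - i.+1))) sigma n k in
  c * sigma n i ^+ 2 * c^-1.

Lemma pure_gen_pure i j : pure (pure_gen i j).
Proof.
rewrite /pure_gen /=; set c := \prod_(_ <- _) _.
have -> : c * sigma n i ^+ 2 * c^-1 = (sigma n i ^+ 2) ^ c^-1.
  by rewrite conjgE invgK -mulgA.
apply: pureJ => p pn; rewrite expgS expg1 endpointM // /sigma.
case: insubP => [k _ _|_]; last by rewrite !endpoint1.
rewrite (endpoint_class _ pn) /= endpoint_class /= ?crossingK //.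
exact: crossing_lt.
Qed.

End BraidTheory.

Definition lie_pure (n : nat) : lieRingType :=
  gr (lcs_nseries (pure_subgroup n)).

Definition lie_brunnian (n : nat) : lieRingType :=
  gr (ns_restr (lcs_nseries (pure_subgroup n)) (brunnian_subgroup n)).

(* A_(i + 1, j + 1) *)
Definition lie_gen (n i j : nat) : lie_pure n :=
  hom (lcs_nseries (pure_subgroup n)) 0 (pure_gen n i j).

(* The letter k stands for A_(k + 1, n). *)
Definition letters (n : nat) : set (lie_monomial 'I_n.-1) :=
  [set W | exists k, W = Letter k].
Arguments letters : clear implicits.

Definition eval_monomial (n : nat) (W : lie_monomial 'I_n.-1) : lie_pure n :=
  lie_eval (fun k : 'I_n.-1 => lie_gen n k n.-1) W.

(* The left-normed brackets [...[[W', W_1], W_2], ..., W_t], for t >= 0, where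
   W' and the W_i are in S, the letter k occurs in W' and in none of the W_i. *)
Inductive K_step (X : eqType) (k : X) (S : set (lie_monomial X)) :
    set (lie_monomial X) :=
| KStart W of S W & occurs k W : K_step k S W
| KBracket W V of K_step k S W & S V & ~~ occurs k V :
    K_step k S (Bracket W V).

(* K n k is K(n)_k for 1 <= k <= n: the steps for the letters numbered n - 2,
   ..., k - 1, that is A_(n - 1, n), ..., A_(k, n), in this order. *)
Definition K (n k : nat) : set (lie_monomial 'I_n.-1) :=
  foldr (@K_step _) (letters n) (drop k.-1 (enum 'I_n.-1)).
Arguments K : clear implicits.

Lemma K_last n : K n n = letters n.
Proof. by rewrite /K drop_oversize // size_enum_ord. Qed.

Lemma K_rec n (k : 'I_n.-1) : K n k.+1 = K_step k (K n k.+2).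
Proof.
by rewrite /K /= (drop_nth k) ?size_enum_ord //= nth_ord_enum.
Qed.

(* Main.v *)
From HB Require Import structures.
Require Import Defs.
From mathcomp Require Import all_boot all_order all_algebra.
From mathcomp Require Import boolp classical_sets zify.

Set Implicit Arguments.
Unset Strict Implicit.
Unset Printing Implicit Defensive.

Import GRing.Theory.
Local Open Scope quotient_scope.
Local Open Scope classical_set_scope.
Local Open Scope ring_scope.

(** Let F be the kernel of the removal of the last strand of P_n. Brunnian
    braids lie in F, which is generated by a_(1,n), ..., a_(n-1,n), and P_n is
    the product of F and of a copy of P_(n-1) that acts trivially on the
    abelianization of F. For such products, Falk and Randell showed that
    Gamma_q(P_n) meets F in Gamma_q(F) ([lcs_almost_direct], [lcs_kernel]).
    Hence the class of a Brunnian braid in L(P_n) is a Lie polynomial in the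
    letters A_(1,n), ..., A_(n-1,n) ([kernel_Phi]).

    These letters generate a free Lie ring ([Phi_inj]). To see this, let braids
    with a marked strand act on the power series over Z in one noncommuting
    variable X_j for each other strand ([rep]): crossings of two other strands
    act by Artin automorphisms of the x_j = 1 + X_j, and the marked strand
    multiplies by x_j or its inverse when it crosses the strand j on one side,
    while crossings on the other side do nothing. When the last strand is
    marked, a_(j,n) acts as the multiplication by x_j, and an element of
    Gamma_q(P_n) changes a series only in degrees that are higher by q or more.
    Leading terms thus define an additive map from L(P_n) to power series,
    which sends a Lie polynomial in the A_(j,n) to the same polynomial in the
    X_j ([Theta_Phi]). By the theorem of Magnus and Witt ([iota_inj]), no
    nonzero element of the free Lie ring vanishes as a power series.

    That theorem and the analysis of the sets K(n)_k rest on the same device,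
    Lazard elimination. If the letters are divided into two kinds, W' and W,
    then the brackets [...[W', W_1], ..., W_t] generate freely the ideal
    generated by the letters W', and they span it together with the subring of
    the W ([elim_span], [elim_map_inj]). To pass from an alphabet to the
    brackets, the free Lie ring is made to act on the power series in the new
    letters, the W' as multiplications and the W as derivations
    ([elim_act_span]). Eliminating letters of least weight one after the other,
    until all remaining letters are too heavy, proves the theorem of Magnus and
    Witt. Eliminating the monomials without A_(k,n), for each k in turn, shows
    that K(n)_1 generates freely ([K_free]) the Lie polynomials that become
    zero when any single letter is set to zero ([K_span]).

    Removing the strand k < n from an element of F sets X_k to zero in its
    power series ([remove_rep]). So the class of a Brunnian braid is a Lie
    polynomial that dies when any letter is set to zero ([brunnian_kill]), and
    therefore a Lie polynomial in K(n)_1. Conversely each monomial of K(n)_1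
    contains all letters, so the iterated commutator of the a_(j,n) that it
    describes becomes trivial when any strand is removed
    ([brunnian_group_eval]), and its class lies in the relative Lie algebra. *)

Local Notation hom := Defs.hom.
Local Notation lift := Defs.lift.

(** * Lie rings, free Lie rings and spans of brackets *)

Section Additive.
Variables (M N : zmodType) (h : M -> N).
Hypothesis hD : {morph h : x y / x + y}.

Lemma morphD0 : h 0 = 0.
Proof. by apply: (addrI (h 0)); rewrite -hD !addr0. Qed.

Lemma morphDN x : h (- x) = - h x.
Proof. by apply/eqP; rewrite -addr_eq0 -hD addNr morphD0. Qed.

Lemma morphDB x y : h (x - y) = h x - h y.
Proof. by rewrite hD morphDN. Qed.

Lemma morphDMz x (k : int) : h (x *~ k) = h x *~ k.
Proof.
have hn n : h (x *+ n) = h x *+ n.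
  by elim: n => [|n IH]; rewrite ?mulr0n ?morphD0 // !mulrS hD IH.
by case: k => n; rewrite ?NegzE ?mulrNz -?pmulrn ?morphDN hn.
Qed.

Lemma morphD_sum (I : Type) (r : seq I) (p : pred I) (F : I -> M) :
  h (\sum_(i <- r | p i) F i) = \sum_(i <- r | p i) h (F i).
Proof. by apply: (big_morph h) => //; exact: morphD0. Qed.

End Additive.

Section LieBasics.
Variable L : lieRingType.
Implicit Types x y z : L.

Lemma lieb0l x : lieb 0 x = 0.
Proof. exact: (morphD0 (h := lieb^~ x) (fun y z => liebDl y z x)). Qed.

Lemma lieb0r x : lieb x 0 = 0.
Proof. exact: (morphD0 (liebDr x)). Qed.

Lemma liebNl x y : lieb (- x) y = - lieb x y.
Proof. exact: (morphDN (h := lieb^~ y) (fun z t => liebDl z t y)). Qed.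

Lemma liebNr x y : lieb x (- y) = - lieb x y.
Proof. exact: (morphDN (liebDr x)). Qed.

Lemma liebC x y : lieb x y = - lieb y x.
Proof.
have := liebxx (x + y); rewrite liebDl !liebDr !liebxx add0r addr0 => /eqP.
by rewrite addr_eq0 => /eqP.
Qed.

Lemma lieb_derl x y z :
  lieb (lieb x y) z = lieb (lieb x z) y + lieb x (lieb y z).
Proof.
have /eqP := lieb_jacobi x y z; rewrite -addrA addr_eq0 => /eqP ->.
by rewrite (liebC _ x) (liebC z) liebNl opprD !opprK addrC.
Qed.

Lemma lieb_derr x y z :
  lieb x (lieb y z) = lieb (lieb x y) z - lieb (lieb x z) y.
Proof. by rewrite lieb_derl addrAC subrr add0r. Qed.

End LieBasics.

Section LieHom.
Variables (L M : lieRingType) (phi : L -> M).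
Hypothesis hphi : lie_hom phi.

Lemma lie_homD x y : phi (x + y) = phi x + phi y.
Proof. by case: hphi => h _; exact: h. Qed.

Lemma lie_hom_br x y : phi (lieb x y) = lieb (phi x) (phi y).
Proof. by case: hphi => _; exact. Qed.

Lemma lie_hom0 : phi 0 = 0.
Proof. exact: morphD0 lie_homD. Qed.

Lemma lie_homN x : phi (- x) = - phi x.
Proof. exact: (morphDN lie_homD). Qed.

Lemma lie_homB x y : phi (x - y) = phi x - phi y.
Proof. exact: (morphDB lie_homD). Qed.

Lemma lie_homMz x (k : int) : phi (x *~ k) = phi x *~ k.
Proof. exact: (morphDMz lie_homD). Qed.

Lemma lie_hom_inj : (forall x, phi x = 0 -> x = 0) -> injective phi.
Proof.
move=> h x y xy; apply/eqP; rewrite -subr_eq0; apply/eqP/h.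
by rewrite lie_homB xy subrr.
Qed.

Lemma lie_hom_eval X (a : X -> L) W :
  phi (lie_eval a W) = lie_eval (fun x => phi (a x)) W.
Proof. by elim: W => //= U IHU V IHV; rewrite lie_hom_br IHU IHV. Qed.

End LieHom.

Lemma lie_hom_comp (L M N : lieRingType) (psi : M -> N) (phi : L -> M) :
  lie_hom psi -> lie_hom phi -> lie_hom (psi \o phi).
Proof.
by move=> hpsi hphi; split=> x y /=; rewrite ?(lie_homD hphi) ?(lie_homD hpsi)
  ?(lie_hom_br hphi) ?(lie_hom_br hpsi).
Qed.

Inductive lie_term (X : Type) : Type :=
| TVar of X
| TZero
| TOpp of lie_term X
| TAdd of lie_term X & lie_term X
| TBr of lie_term X & lie_term X.
Arguments TZero {X}.

Fixpoint teval (X : Type) (L : lieRingType) (f : X -> L) (t : lie_term X) : L :=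
  match t with
  | TVar x => f x
  | TZero => 0
  | TOpp t => - teval f t
  | TAdd t u => teval f t + teval f u
  | TBr t u => lieb (teval f t) (teval f u)
  end.

HB.instance Definition _ (X : Type) := gen_eqMixin (lie_term X).
HB.instance Definition _ (X : Type) := gen_choiceMixin (lie_term X).

Section FreeLie.
Variable X : Type.

(** Terms are identified when they agree in all Lie rings. The Lie ring axioms
    and the universal property then hold by evaluation, without normal
    forms. *)
Definition term_rel : rel (lie_term X) := fun t u =>
  `[< forall (L : lieRingType) (f : X -> L), teval f t = teval f u >].

Fact term_rel_refl : reflexive term_rel.
Proof. by move=> t; apply/asboolP. Qed.
Fact term_rel_sym : symmetric term_rel.
Proof. by move=> t u; apply/asboolP/asboolP => h L f; rewrite h. Qed.
Fact term_rel_trans : transitive term_rel.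
Proof.
by move=> u t v /asboolP tu /asboolP uv; apply/asboolP => L f; rewrite tu uv.
Qed.
Canonical term_equiv :=
  EquivRel term_rel term_rel_refl term_rel_sym term_rel_trans.

Definition flie := {eq_quot term_equiv}.
HB.instance Definition _ := Choice.on flie.

Definition tcls (t : lie_term X) : flie := \pi_{eq_quot term_equiv} t.
Definition trepr (u : flie) : lie_term X :=
  repr (u : {eq_quot term_equiv}).

Lemma treprK : cancel trepr tcls.
Proof. by move=> u; rewrite /tcls /trepr reprK. Qed.

Lemma tcls_eqP t u : tcls t = tcls u <->
  forall (L : lieRingType) (f : X -> L), teval f t = teval f u.
Proof.
split; first by move=> /eqP; rewrite /tcls eqmodE => /asboolP.
by move=> tu; apply/eqP; rewrite /tcls eqmodE; apply/asboolP.
Qed.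

Lemma teval_repr t (L : lieRingType) (f : X -> L) :
  teval f (trepr (tcls t)) = teval f t.
Proof. by move: L f; apply/tcls_eqP; rewrite treprK. Qed.

Definition fzero : flie := tcls TZero.
Definition fopp (u : flie) : flie := tcls (TOpp (trepr u)).
Definition fadd (u v : flie) : flie := tcls (TAdd (trepr u) (trepr v)).
Definition fbr (u v : flie) : flie := tcls (TBr (trepr u) (trepr v)).

Fact faddA : associative fadd.
Proof.
by move=> u v w; apply/tcls_eqP => L f /=; rewrite !teval_repr /= addrA.
Qed.
Fact faddC : commutative fadd.
Proof. by move=> u v; apply/tcls_eqP => L f /=; rewrite addrC. Qed.
Fact fadd0 : left_id fzero fadd.
Proof.
move=> u; rewrite -[RHS]treprK; apply/tcls_eqP => L f /=.
by rewrite teval_repr add0r.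
Qed.
Fact faddN : left_inverse fzero fopp fadd.
Proof.
by move=> u; apply/tcls_eqP => L f /=; rewrite teval_repr addNr.
Qed.

HB.instance Definition _ := GRing.isZmodule.Build flie faddA faddC fadd0 faddN.

Fact fbrDl u v w : fbr (u + v) w = fbr u w + fbr v w.
Proof. by apply/tcls_eqP => L f /=; rewrite !teval_repr /= liebDl. Qed.
Fact fbrDr u v w : fbr u (v + w) = fbr u v + fbr u w.
Proof. by apply/tcls_eqP => L f /=; rewrite !teval_repr /= liebDr. Qed.
Fact fbrxx u : fbr u u = 0.
Proof. by apply/tcls_eqP => L f /=; rewrite liebxx. Qed.
Fact fbr_jacobi u v w :
  fbr (fbr u v) w + fbr (fbr v w) u + fbr (fbr w u) v = 0.
Proof.
by apply/tcls_eqP => L f /=;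
  rewrite !teval_repr /= !teval_repr /= !teval_repr lieb_jacobi.
Qed.

HB.instance Definition _ := Zmodule_isLieRing.Build flie
  fbrDl fbrDr fbrxx fbr_jacobi.

Definition fgen (x : X) : flie := tcls (TVar x).

Lemma flie_ind (P : flie -> Prop) :
  (forall x, P (fgen x)) -> P 0 -> (forall u, P u -> P (- u)) ->
  (forall u v, P u -> P v -> P (u + v)) ->
  (forall u v, P u -> P v -> P (lieb u v)) -> forall u, P u.
Proof.
move=> Pg P0 PN PD PB u; rewrite -(treprK u).
elim: (trepr u) => {u} [x||t Pt|t Pt u Pu|t Pt u Pu]; [exact: Pg|exact: P0|..].
- have -> : tcls (TOpp t) = - tcls t by apply/tcls_eqP => L f /=;
  rewrite teval_repr.
  exact: PN.
- have -> : tcls (TAdd t u) = tcls t + tcls u.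
    by apply/tcls_eqP => L f /=; rewrite !teval_repr.
  exact: PD.
- have -> : tcls (TBr t u) = lieb (tcls t) (tcls u).
    by apply/tcls_eqP => L f /=; rewrite !teval_repr.
  exact: PB.
Qed.

Section Lift.
Variables (L : lieRingType) (f : X -> L).

Definition flift (u : flie) : L := teval f (trepr u).

Lemma flift_hom : lie_hom flift.
Proof. by split=> u v; rewrite /flift teval_repr. Qed.

Lemma flift_gen x : flift (fgen x) = f x.
Proof. by rewrite /flift teval_repr. Qed.

Lemma flift_eval W : flift (lie_eval fgen W) = lie_eval f W.
Proof.
rewrite (lie_hom_eval flift_hom).
by elim: W => [x|U IHU V IHV] /=; rewrite ?flift_gen ?IHU ?IHV.
Qed.

End Lift.

Lemma flie_hom_ext (L : lieRingType) (phi psi : flie -> L) :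
  lie_hom phi -> lie_hom psi -> (forall x, phi (fgen x) = psi (fgen x)) ->
  phi =1 psi.
Proof.
move=> hp hq e; elim/flie_ind => [//||u IH|u v IHu IHv|u v IHu IHv].
- by rewrite !lie_hom0.
- by rewrite (lie_homN hp) (lie_homN hq) IH.
- by rewrite (lie_homD hp) (lie_homD hq) IHu IHv.
- by rewrite (lie_hom_br hp) (lie_hom_br hq) IHu IHv.
Qed.

End FreeLie.

Section LieSpan.
Variables (L : lieRingType) (I : Type) (a : I -> L) (P : I -> Prop).
Variable w : I -> nat.

(** Weights bound the length of brackets, for the termination of
    [iota_inj_weight]; the study of K-monomials sets them to zero. *)
Inductive lie_span : nat -> L -> Prop :=
| SpanGen N i of P i & (w i <= N)%N : lie_span N (a i)
| SpanZero N : lie_span N 0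
| SpanOpp N x of lie_span N x : lie_span N (- x)
| SpanAdd N x y of lie_span N x & lie_span N y : lie_span N (x + y)
| SpanBr N1 N2 N x y of lie_span N1 x & lie_span N2 y & (N1 + N2 <= N)%N :
    lie_span N (lieb x y).

Lemma lie_span_le N N' x : lie_span N x -> (N <= N')%N -> lie_span N' x.
Proof.
move=> sx; elim: sx N' => {N x}
  [N i Pi wi|N|N x _ IH|N x y _ IHx _ IHy|N1 N2 N x y sx _ sy _ N12] N' NN'.
- by apply: SpanGen => //; apply: leq_trans NN'.
- exact: SpanZero.
- by apply: SpanOpp; exact: IH.
- by apply: SpanAdd; [exact: IHx|exact: IHy].
- by apply: (SpanBr sx sy); apply: leq_trans NN'.
Qed.

End LieSpan.

Lemma lie_span_sub (L : lieRingType) (I : Type) (a : I -> L) (P P' : I -> Prop)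
  (w : I -> nat) N x : (forall i, P i -> (w i <= N)%N -> P' i) ->
  lie_span a P w N x -> lie_span a P' w N x.
Proof.
move=> PP' sx; elim: sx PP' => {N x}
  [N i Pi wi|N|N x _ IH|N x y _ IHx _ IHy|N1 N2 N x y _ IHx _ IHy N12] PP'.
- by apply: SpanGen => //; apply: PP'.
- exact: SpanZero.
- by apply: SpanOpp; exact: IH.
- by apply: SpanAdd; [exact: IHx|exact: IHy].
- apply: (SpanBr _ _ N12); [apply: IHx|apply: IHy] => i Pi wi;
  apply: PP' => //; lia.
Qed.

(** Letters can be lifted along phi one by one, and phi commutes with
    brackets. *)
Lemma lie_span_lift (L M : lieRingType) (I J : Type) (phi : L -> M)
  (b : J -> L) (Q : J -> Prop) (v : J -> nat)
  (a : I -> M) (P : I -> Prop) (w : I -> nat) N x :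
  lie_hom phi ->
  (forall i, P i -> exists j, [/\ Q j, phi (b j) = a i & v j = w i]) ->
  lie_span a P w N x -> exists2 y, lie_span b Q v N y & phi y = x.
Proof.
move=> hphi cov; elim=> {N x}
  [N i Pi wi|N|N x _ [y sy <-]|N x y _ [x' sx <-] _ [y' sy <-]
  |N1 N2 N x y _ [x' sx <-] _ [y' sy <-] N12].
- by have [j [Qj <- vj]] := cov i Pi; exists (b j) => //; apply: SpanGen;
  rewrite ?vj.
- by exists 0; [exact: SpanZero|exact: lie_hom0].
- by exists (- y); [exact: SpanOpp|exact: lie_homN].
- by exists (x' + y'); [exact: SpanAdd|exact: lie_homD].
- by exists (lieb x' y'); [exact: SpanBr N12|exact: lie_hom_br].
Qed.

Section SpanElim.
Variables (L : lieRingType) (I J : Type).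
Variables (a : I -> L) (P : I -> Prop) (w : I -> nat).
Variables (c : J -> L) (Q : J -> Prop) (v : J -> nat).
Hypothesis step : forall j i, Q j -> P i ->
  exists j', [/\ Q j', lieb (c j) (a i) = c j' & (v j' <= v j + w i)%N].

(** Bracketing with a letter is a derivation, so it maps the Lie subring of the
    c-letters to itself as soon as it maps c-letters to c-letters. *)
Lemma span_act N1 N2 y x :
  lie_span c Q v N1 y -> lie_span a P w N2 x ->
    lie_span c Q v (N1 + N2) (lieb y x).
Proof.
move=> sy sx; elim: sx N1 y sy => {N2 x}
  [N2 i Pi wi|N2|N2 x _ IH|N2 x x' _ IHx _ IHx'|M1 M2 N2 x x' _ IHx _ IHx' M12]
    N1 y sy.
- elim: sy => {N1 y}
    [N j Qj vj|N|N y _ IH|N y y' _ IHy _ IHy'|M1 M2 N y y' sy IHy sy' IHy' M12].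
  + have [j' [Qj' -> vj']] := step Qj Pi; apply: SpanGen => //.
    by apply: leq_trans vj' _; exact: leq_add.
  + by rewrite lieb0l; exact: SpanZero.
  + by rewrite liebNl; exact: SpanOpp.
  + by rewrite liebDl; exact: SpanAdd.
  + rewrite lieb_derl; apply: SpanAdd.
      by apply: (SpanBr IHy sy'); lia.
    by apply: (SpanBr sy IHy'); lia.
- by rewrite lieb0r; exact: SpanZero.
- by rewrite liebNr; apply: SpanOpp; exact: IH.
- by rewrite liebDr; apply: SpanAdd; [exact: IHx|exact: IHx'].
- rewrite lieb_derr; apply: SpanAdd; last apply: SpanOpp.
    by apply: (lie_span_le (IHx' _ _ (IHx _ _ sy))); lia.
  by apply: (lie_span_le (IHx _ _ (IHx' _ _ sy))); lia.
Qed.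

(** The spanning half of Lazard elimination. By [span_act], the subring of the
    c-letters is stable under brackets with the a-letters, so its sum with the
    subring of the a-letters is closed under brackets. *)
Lemma elim_span (D : Type) (d : D -> L) (PD : D -> Prop) (wD : D -> nat) N u :
  (forall k, PD k -> lie_span a P w (wD k) (d k) \/ lie_span c Q v (wD k) (d
    k)) ->
  lie_span d PD wD N u ->
  exists x y, [/\ lie_span a P w N x, lie_span c Q v N y & u = x + y].
Proof.
move=> dec; elim=> {N u}
  [N k Pk wk|N|N u _ [x [y [sx sy ->]]]|N u u' _ [x [y [sx sy ->]]] _ [x' [y'
    [sx' sy' ->]]]
  |N1 N2 N u u' _ [x [y [sx sy ->]]] _ [x' [y' [sx' sy' ->]]] N12].
- have [sk|sk] := dec k Pk.
    by exists (d k), 0; rewrite addr0; split=> //;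
      [exact: lie_span_le wk|exact: SpanZero].
  by exists 0, (d k); rewrite add0r; split=> //;
    [exact: SpanZero|exact: lie_span_le wk].
- by exists 0, 0; rewrite addr0; split=> //; exact: SpanZero.
- by exists (- x), (- y); rewrite opprD; split=> //; exact: SpanOpp.
- by exists (x + x'), (y + y'); rewrite addrACA; split=> //; exact: SpanAdd.
- exists (lieb x x'), (lieb x y' + (lieb y x' + lieb y y')).
  split; [exact: SpanBr N12| |by rewrite liebDl !liebDr !addrA].
  apply: SpanAdd; last apply: SpanAdd.
  + rewrite liebC; apply: SpanOpp; apply: (lie_span_le (span_act sy' sx)); lia.
  + by apply: (lie_span_le (span_act sy sx')); lia.
  + exact: SpanBr N12.
Qed.

End SpanElim.

(** * The ring of noncommutative power series over the integers *)

Definition series (X : Type) := seq X -> int.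

Section SeriesRing.
Variable X : Type.
Local Notation series := (series X).
Implicit Types (f g h : series) (x : X) (w v : seq X) (k : nat).

HB.instance Definition _ := gen_eqMixin series.
HB.instance Definition _ := gen_choiceMixin series.

Definition szero : series := fun=> 0.
Definition sopp f : series := fun w => - f w.
Definition sadd f g : series := fun w => f w + g w.

Fact saddA : associative sadd.
Proof. by move=> f g h; apply: funext => w; rewrite /sadd addrA. Qed.
Fact saddC : commutative sadd.
Proof. by move=> f g; apply: funext => w; rewrite /sadd addrC. Qed.
Fact sadd0 : left_id szero sadd.
Proof. by move=> f; apply: funext => w; rewrite /sadd add0r. Qed.
Fact saddN : left_inverse szero sopp sadd.
Proof. by move=> f; apply: funext => w; rewrite /sadd addNr. Qed.

HB.instance Definition _ := GRing.isZmodule.Build series saddA saddC sadd0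
  saddN.

Lemma seriesD f g w : (f + g) w = f w + g w. Proof. by []. Qed.
Lemma seriesN f w : (- f) w = - f w. Proof. by []. Qed.
Lemma seriesB f g w : (f - g) w = f w - g w. Proof. by []. Qed.
Lemma series0 w : (0 : series) w = 0. Proof. by []. Qed.

Lemma series_sum (I : Type) (r : seq I) (p : pred I) (F : I -> series) w :
  (\sum_(i <- r | p i) F i) w = \sum_(i <- r | p i) F i w.
Proof. by apply: (big_ind2 (fun f c => f w = c)) => // f c g d <- <-. Qed.

Lemma seriesMz f (k : int) w : (f *~ k) w = f w *~ k.
Proof. exact: (morphDMz (h := fun g : series => g w)). Qed.

(** The left quotient by x. A power series f is its constant term plus the sum
    of the products of the letters x by [sder x f]; the product is defined by
    recursion along this decomposition, and most identities follow it. *)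
Definition sder x f : series := fun w => f (x :: w).

Lemma sderD x f g : sder x (f + g) = sder x f + sder x g. Proof. by []. Qed.
Lemma sder0 x : sder x 0 = 0. Proof. by []. Qed.

Fixpoint smul f g w : int :=
  if w is x :: w' then f [::] * g w + smul (sder x f) g w' else f [::] * g [::].

Definition sone : series := fun w => (nilp w)%:Z.

Fact smulDl : left_distributive smul +%R.
Proof.
move=> f g h; apply: funext => w; rewrite seriesD.
elim: w f g => [|x w IH] f g /=; first by rewrite mulrDl.
by rewrite sderD IH seriesD mulrDl addrACA.
Qed.

Fact smulDr : right_distributive smul +%R.
Proof.
move=> f g h; apply: funext => w; rewrite seriesD.
elim: w f => [|x w IH] f /=; first by rewrite mulrDr.
by rewrite IH !seriesD mulrDr addrACA.
Qed.

Let smul0l g w : smul 0 g w = 0.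
Proof. by elim: w => [|x w IH] /=; rewrite ?sder0 ?IH mul0r. Qed.

Let smulcl (c : int) f g w : smul (fun v => c * f v) g w = c * smul f g w.
Proof.
elim: w f => [|x w IH] f /=; first by rewrite mulrA.
by rewrite (IH (sder x f)) mulrDr mulrA.
Qed.

Fact smulA : associative smul.
Proof.
move=> f g h; apply: funext => w.
elim: w f => [|x w IH] f /=; first by rewrite mulrA.
have -> : sder x (smul f g) =
    ((fun v => f [::] * sder x g v) : series) + smul (sder x f) g.
  by [].
rewrite smulDl seriesD smulcl mulrDr mulrA -addrA; congr (_ + (_ + _)).
exact: IH.
Qed.

Fact smul1 : left_id sone smul.
Proof.
move=> f; apply: funext => -[|x w] /=; rewrite mul1r //.
by have -> : sder x sone = 0 by []; rewrite smul0l addr0.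
Qed.

Fact smulr1 : right_id sone smul.
Proof.
move=> f; apply: funext => w.
elim: w f => [|x w IH] f /=; first by rewrite mulr1.
by rewrite mulr0 add0r IH.
Qed.

Fact sone_neq0 : sone != 0.
Proof. by apply/eqP => /(congr1 (fun f => f [::])). Qed.

HB.instance Definition _ := GRing.Zmodule_isNzRing.Build series
  smulA smul1 smulr1 smulDl smulDr sone_neq0.

Lemma series1 w : (1 : series) w = (nilp w)%:Z. Proof. by []. Qed.

Lemma smul_nil f g : (f * g) [::] = f [::] * g [::]. Proof. by []. Qed.
Lemma smul_cons f g x w :
  (f * g) (x :: w) = f [::] * g (x :: w) + (sder x f * g) w.
Proof. by []. Qed.

Definition sbr f g : series := f * g - g * f.
Fact sbrDl f g h : sbr (f + g) h = sbr f h + sbr g h.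
Proof. by rewrite /sbr mulrDl mulrDr opprD addrACA. Qed.
Fact sbrDr f g h : sbr f (g + h) = sbr f g + sbr f h.
Proof. by rewrite /sbr mulrDl mulrDr opprD addrACA. Qed.
Fact sbrxx f : sbr f f = 0. Proof. exact: subrr. Qed.
Fact sbr_jacobi f g h :
  sbr (sbr f g) h + sbr (sbr g h) f + sbr (sbr h f) g = 0.
Proof.
rewrite /sbr !mulrBl !mulrBr !mulrA !opprB.
move: (f * g * h) (g * f * h) (h * g * f) (h * f * g) (g * h * f) (f * h * g).
by move=> a b c d e i; apply: funext => w; rewrite !(seriesD, seriesN) series0;
  lia.
Qed.

HB.instance Definition _ := Zmodule_isLieRing.Build series
  sbrDl sbrDr sbrxx sbr_jacobi.

Lemma series_lieb f g : lieb f g = f * g - g * f. Proof. by []. Qed.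

End SeriesRing.

(** * Words, polynomials and the Magnus map *)

Section Words.
Variable X : eqType.
Implicit Types (f : series X) (u v w : seq X) (x y : X).

Definition sword u : series X := fun w => (w == u)%:Z.
Definition sletter x : series X := sword [:: x].

Lemma sletter_mul x f w :
  (sletter x * f) w = if w is y :: w' then (y == x)%:Z * f w' else 0.
Proof.
case: w => [|y w]; first by rewrite smul_nil mul0r.
rewrite smul_cons mul0r add0r.
have -> : sder y (sletter x) = 1 *~ (y == x)%:Z.
  apply: funext => v; rewrite seriesMz series1 /sder /sletter /sword /=
    eqseq_cons.
  by case: eqP => //= _; rewrite /nilp size_eq0; case: eqP.
by case: eqP => _; rewrite ?mul1r ?mulr0z ?mul0r.
Qed.

Lemma sword_cons x u : sword (x :: u) = sletter x * sword u.
Proof.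
apply: funext => -[|y w]; rewrite sletter_mul // /sword eqseq_cons.
by case: (y == x) => //=; rewrite ?mul1r ?mul0r.
Qed.

Lemma sword_nil : sword [::] = 1.
Proof. by apply: funext => -[|y w]. Qed.

Lemma sword_cat u v : sword (u ++ v) = sword u * sword v.
Proof.
by elim: u => [|x u IH] /=; rewrite ?sword_nil ?mul1r // !sword_cons IH mulrA.
Qed.

(** Noncommutative polynomials, as lists of coefficients and words. Unlike
    power series, they act on every abelian group on which the letters act. *)
Definition wpoly := seq (int * seq X).

Definition pcoef (c : wpoly) : series X := \sum_(t <- c) sword t.2 *~ t.1.

Section Action.
Variables (M : zmodType) (rho : X -> M -> M).
Hypothesis rhoD : forall x, {morph rho x : g h / g + h}.

Definition pact (c : wpoly) (g : M) : M := \sum_(t <- c) foldr rho g t.2 *~ t.1.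

Let frD w : {morph (fun g => foldr rho g w) : g h / g + h}.
Proof. by elim: w => [|x w IH] g h //=; rewrite IH rhoD. Qed.

(** Words are linearly independent in the ring of power series. So an operator
    given by a polynomial in the letters depends only on the power series of
    this polynomial. *)
Lemma pact_eq0 c g : pcoef c = 0 -> pact c g = 0.
Proof.
move=> c0; pose r := undup (map snd c).
have E t : t \in c -> foldr rho g t.2 *~ t.1 =
    \sum_(w <- r) foldr rho g w *~ (t.1 * (w == t.2)%:Z).
  move=> tc; rewrite (bigD1_seq t.2) ?undup_uniq ?mem_undup ?map_f //=.
  rewrite eqxx mulr1 big1 ?addr0 // => w /negPf ->.
  by rewrite mulr0 mulr0z.
rewrite /pact big_seq (eq_bigr _ E) -big_seq exchange_big /=.
apply: big1 => w _.
have -> : \sum_(t <- c) foldr rho g w *~ (t.1 * (w == t.2)%:Z) =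
    foldr rho g w *~ pcoef c w.
  rewrite /pcoef series_sum -mulrz_sumr.
  by congr (_ *~ _); apply: eq_bigr => t _; rewrite seriesMz -mulrzr intz mulrC.
by rewrite c0 mulr0z.
Qed.

Definition pmul (c d : wpoly) : wpoly := [seq (t.1 * s.1, t.2 ++ s.2) | t <- c,
  s <- d].
Definition popp (c : wpoly) : wpoly := [seq (- t.1, t.2) | t <- c].

Lemma pact_cat c d g : pact (c ++ d) g = pact c g + pact d g.
Proof. exact: big_cat. Qed.

Lemma pact_opp c g : pact (popp c) g = - pact c g.
Proof.
by rewrite /pact big_map -sumrN; apply: eq_bigr => t _; rewrite mulrNz.
Qed.

Lemma pact_mul c d g : pact (pmul c d) g = pact c (pact d g).
Proof.
rewrite /pact big_allpairs_dep; apply: eq_bigr => t _ /=.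
rewrite (morphD_sum (frD t.2)) mulrz_suml.
apply: eq_bigr => u _.
by rewrite foldr_cat (morphDMz (frD t.2)) mulrzA_C.
Qed.

End Action.

Lemma pcoef_cat c d : pcoef (c ++ d) = pcoef c + pcoef d.
Proof. exact: big_cat. Qed.

Lemma pcoef_opp c : pcoef (popp c) = - pcoef c.
Proof.
by rewrite /pcoef big_map -sumrN; apply: eq_bigr => t _; rewrite mulrNz.
Qed.

Lemma pcoef_mul c d : pcoef (pmul c d) = pcoef c * pcoef d.
Proof.
rewrite /pcoef big_allpairs_dep big_distrl; apply: eq_bigr => t _ /=.
rewrite big_distrr; apply: eq_bigr => u _ /=.
by rewrite sword_cat mulrzAl mulrzAr mulrzA_C.
Qed.

Definition iota_lie : flie X -> series X := flift sletter.

Lemma iota_hom : lie_hom iota_lie. Proof. exact: flift_hom. Qed.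
Lemma iota_gen x : iota_lie (fgen x) = sletter x. Proof. exact: flift_gen. Qed.

End Words.
Arguments pact {X M}.

(** * Lazard elimination, acting on power series *)

Section Elimination.
Variables (X : eqType) (B : pred X).
Local Notation Y := (X * seq X)%type.
Implicit Types (x : X) (y l : Y) (g : series Y).

(** The new letter [(z, [:: b_t; ...; b_1])] stands for the left-normed bracket
    of z with b_1, ..., b_t, in this order. *)
Definition elim_gen y : flie X :=
  foldr (fun b u => lieb u (fgen b)) (fgen y.1) y.2.

Definition elim_map : flie Y -> flie X := flift elim_gen.

Lemma elim_map_hom : lie_hom elim_map. Proof. exact: flift_hom. Qed.

Definition elim_letter y : Prop := ~~ B y.1 /\ all B y.2.

(** The derivation of the power series in the new letters that maps the letter
    (z, s) to (z, b :: s): the coefficient of a word collects those of the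
    words from which it arises by lengthening one letter. *)
Fixpoint sderiv_at b g (w : seq Y) : int :=
  if w is l :: w' then
    sderiv_at b (sder l g) w' +
    (if l.2 is b' :: s then (b' == b)%:Z * g ((l.1, s) :: w') else 0)
  else 0.
Definition sderiv b g : series Y := sderiv_at b g.

Lemma sderiv_cons b g l w : sderiv b g (l :: w) = sderiv b (sder l g) w +
  (if l.2 is b' :: s then (b' == b)%:Z * g ((l.1, s) :: w) else 0).
Proof. by []. Qed.

Lemma sderivD b : {morph sderiv b : g h / g + h}.
Proof.
move=> g h; apply: funext => w; rewrite seriesD.
elim: w g h => [|l w IH] g h; first by rewrite addr0.
rewrite !sderiv_cons sderD IH -!addrA; congr (_ + _); rewrite addrCA;
  congr (_ + _).
by case: l.2 => [|b' s]; rewrite ?addr0 // seriesD mulrDr.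
Qed.

Lemma sderiv1 b : sderiv b 1 = 0.
Proof.
apply: funext => -[|l w] //; rewrite sderiv_cons.
have -> : sder l (1 : series Y) = 0 by [].
rewrite (morphD0 (@sderivD b)) add0r series0.
by case: l.2 => // b' s; rewrite series1 mulr0.
Qed.

Lemma sderiv_letter b l g :
  sderiv b (sletter l * g) =
  sletter (l.1, b :: l.2) * g + sletter l * sderiv b g.
Proof.
apply: funext => -[|k w];
  rewrite seriesD !sletter_mul ?addr0 // sderiv_cons addrC.
have -> : sder k (sletter l * g) = g *~ (k == l)%:Z.
  apply: funext => w'; rewrite seriesMz /sder sletter_mul.
  by case: (k == l); rewrite ?mul1r ?mulr0z ?mul0r.
rewrite (morphDMz (@sderivD b)) seriesMz -[(_ *~ _)]mulrzr intz mulrC addrC.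
rewrite [LHS]addrC; congr (_ + _).
case: k => z [|b' s] /=.
  by rewrite xpair_eqE andbF mul0r.
case: l => l1 l2; rewrite sletter_mul !xpair_eqE eqseq_cons /=.
case: (b' == b); case: (z == l1); case: (s == l2);
  by rewrite ?(mul1r, mul0r, mulr1, mulr0).
Qed.

(** If the eliminated letter b acts by minus the derivation above, and z by the
    multiplication by its new letter, then the commutator of the operators of z
    and b is the multiplication by the new letter for the bracket of z and
    b. *)
Definition elim_act x g : series Y :=
  if B x then - sderiv x g else sletter (x, [::]) * g.

Lemma elim_actD x : {morph elim_act x : g h / g + h}.
Proof.
move=> g h; rewrite /elim_act; case: (B x); last exact: mulrDr.
by rewrite sderivD opprD.
Qed.

(** Since bracketed letters act as multiplications by new letters, the element
    [elim_map v] acts as the multiplication by the power series of v. The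
    polynomial c records that this action is determined by the power series of
    [elim_map v] in the old letters, via [pact_eq0]. *)
Lemma elim_act_span w N v : lie_span (@fgen Y) elim_letter w N v ->
  exists c, pcoef c = iota_lie (elim_map v) /\
    forall g, pact elim_act c g = iota_lie v * g.
Proof.
elim=> {N v} [N [z s] [/= Bz Bs] _|N|N v _ [c [cE cA]]
  |N v v' _ [c [cE cA]] _ [c' [cE' cA']]
  |N1 N2 N v v' _ [c [cE cA]] _ [c' [cE' cA']] _].
- rewrite /elim_map flift_gen iota_gen.
  elim: s Bs => [_|b s IH /= /andP[Bb /IH [c [cE cA]]]].
    exists [:: (1, [:: z])]; rewrite /elim_gen /= iota_gen.
    split=> [|g]; first by rewrite /pcoef big_seq1.
    by rewrite /pact big_seq1 /= /elim_act (negPf Bz).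
  pose d : wpoly X := [:: (1, [:: b])].
  have dA g : pact elim_act d g = - sderiv b g.
    by rewrite /pact big_seq1 /= /elim_act Bb.
  exists (pmul c d ++ popp (pmul d c)); split=> [|g].
    rewrite pcoef_cat pcoef_opp !pcoef_mul cE /elim_gen /=.
    rewrite (lie_hom_br (@iota_hom X)) series_lieb iota_gen.
    by rewrite {1 2}/pcoef !big_seq1.
  rewrite pact_cat pact_opp !(pact_mul elim_actD) !dA !cA.
  rewrite (sderiv_letter b (z, s)) opprK mulrN addrA /=.
  by rewrite addrC addrA subrr add0r.
- exists [::]; rewrite /pcoef /pact !big_nil.
  rewrite (lie_hom0 elim_map_hom) (lie_hom0 (@iota_hom X)); split=> // g.
  by rewrite big_nil (lie_hom0 (@iota_hom Y)) mul0r.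
- exists (popp c); split=> [|g].
    by rewrite pcoef_opp cE (lie_homN elim_map_hom) (lie_homN (@iota_hom X)).
  by rewrite pact_opp cA (lie_homN (@iota_hom Y)) mulNr.
- exists (c ++ c'); split=> [|g].
    by rewrite pcoef_cat cE cE' (lie_homD elim_map_hom) (lie_homD (@iota_hom
      X)).
  by rewrite pact_cat cA cA' (lie_homD (@iota_hom Y)) mulrDl.
- exists (pmul c c' ++ popp (pmul c' c)); split=> [|g].
    rewrite pcoef_cat pcoef_opp !pcoef_mul cE cE' (lie_hom_br elim_map_hom).
    by rewrite (lie_hom_br (@iota_hom X)).
  rewrite pact_cat pact_opp !(pact_mul elim_actD) !cA !cA'.
  by rewrite (lie_hom_br (@iota_hom Y)) series_lieb mulrBl !mulrA.
Qed.

End Elimination.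

(** * The theorem of Magnus and Witt *)

Lemma lie_span_empty (L : lieRingType) (I : Type) (a : I -> L) (P : I -> Prop)
  (w : I -> nat) N x : (forall i, P i -> False) -> lie_span a P w N x -> x = 0.
Proof.
move=> P0; elim=> {N x}
  [N i /P0|//|N x _ ->|N x y _ -> _ ->|N1 N2 N x y _ -> _ _ _] //.
- by rewrite oppr0.
- by rewrite addr0.
- by rewrite lieb0l.
Qed.

Lemma lie_span1 (L : lieRingType) (a : L) (w : unit -> nat) N u :
  lie_span (fun=> a) (fun=> True) w N u -> exists k : int, u = a *~ k.
Proof.
elim=> {N u} [N _ _ _|N|N x _ [k ->]|N x y _ [k ->] _ [l ->]
  |N1 N2 N x y _ [k ->] _ [l ->] _].
- by exists 1.
- by exists 0.
- by exists (- k); rewrite mulrNz.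
- by exists (k + l); rewrite mulrzDr.
- exists 0; rewrite mulr0z.
  rewrite (morphDMz (h := fun z => lieb z (a *~ l))); last by move=> ? ?;
    rewrite liebDl.
  rewrite (morphDMz (h := lieb a)); last by move=> ? ?; rewrite liebDr.
  by rewrite liebxx !mul0rz.
Qed.

Section MagnusStep.
Variables (X : eqType) (x : X) (P : X -> Prop) (w : X -> nat).
Local Notation Y := (X * seq X)%type.

Definition ad_letter (y : Y) : Prop :=
  [/\ P y.1, y.1 != x & exists k, y.2 = nseq k x].
Definition ad_weight (y : Y) : nat := (w y.1 + w x * size y.2)%N.

(** Eliminating x writes u as [k x + elim_map v]. The letter x acts as a
    derivation, which kills the series 1, so letting u act on 1 shows that the
    power series of v is zero. The hypothesis on the new alphabet gives v = 0,
    and the coefficient of x in u gives k = 0. *)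
Lemma iota_inj_step N u : P x -> lie_span (@fgen X) P w N u -> iota_lie u = 0 ->
  (forall v, lie_span (@fgen Y) ad_letter ad_weight N v ->
    iota_lie v = 0 -> v = 0) -> u = 0.
Proof.
move=> Px su u0 IH.
have step (y : Y) (i : unit) : ad_letter y -> True -> exists y',
  [/\ ad_letter y',
    lieb (elim_gen y) (fgen x) = elim_gen y' &
    (ad_weight y' <= ad_weight y + w x)%N].
  case: y => z s [/= Pz zx [k ->]] _; exists (z, nseq k.+1 x).
  by split=> //; [split=> //; exists k.+1|rewrite /ad_weight /= size_nseq; lia].
have [i|x' [u' [sx' su' uE]]] := elim_span step _ su.
  move=> Pi; have [->|ix] := eqVneq i x; [left|right].
    exact: (@SpanGen _ _ _ _ (fun=> w x) _ tt).
  apply: (@SpanGen _ _ _ _ _ _ (i, [::])).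
    by split=> //; exists 0%N.
  by rewrite /ad_weight muln0 addn0.
have [k x'E] := lie_span1 sx'; rewrite {x' sx'}x'E in uE.
have [|v sv vE] := lie_span_lift (b := @fgen Y) (Q := ad_letter)
  (v := ad_weight) (@elim_map_hom X) _ su'.
  by move=> y Qy; exists y; split=> //; exact: flift_gen.
have sv' : lie_span (@fgen Y) (elim_letter (pred1 x)) ad_weight N v.
  apply: lie_span_sub sv => y [_ yx [m yE]] _; split=> //.
  by rewrite yE; apply/allP => z; rewrite mem_nseq => /andP[].
have [c [cE cA]] := elim_act_span sv'.
have v0 : iota_lie v = 0.
  have c0 : pcoef ((k, [:: x]) :: c) = 0.
    rewrite -u0 uE (lie_homD (@iota_hom X)) (lie_homMz (@iota_hom X)) iota_gen.
    by rewrite -vE -cE /pcoef big_cons.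
  have := pact_eq0 (elim_act (pred1 x)) 1 c0.
  rewrite /pact big_cons -/(pact _ c 1) cA mulr1 /= /elim_act /= eqxx sderiv1.
  by rewrite oppr0 mul0rz add0r.
have k0 : k = 0.
  have := u0; rewrite uE -vE (IH v sv v0) (lie_hom0 (@elim_map_hom X)) addr0.
  rewrite (lie_homMz (@iota_hom X)) iota_gen => /(congr1 (fun f => f [:: x])).
  by rewrite seriesMz /sletter /sword eqxx intz.
by rewrite uE k0 -vE (IH v sv v0) (lie_hom0 (@elim_map_hom X)) addr0 mulr0z.
Qed.

End MagnusStep.

(** All remaining letters weigh more than N - j. The outer induction lowers j
    to 0, when no letter is light enough to occur. The inner one eliminates,
    one by one, the letters l of least possible weight: each new letter is
    either one of the others or heavier than the eliminated one. There are
    finitely many new letters of weight at most N, since weights are positive,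
    so the induction can go on. *)
Lemma iota_inj_weight j : forall (X : eqType) (P : X -> Prop) (w : X -> nat) N
  (s : seq X) u,
  (forall i, P i -> (w i <= N)%N -> [/\ i \in s,
    (N < w i + j)%N & (0 < w i)%N]) ->
  lie_span (@fgen X) P w N u -> iota_lie u = 0 -> u = 0.
Proof.
elim: j => [|j IHj] X P w N s u hP su u0.
  have := lie_span_sub (P' := fun=> False) _ su.
  move=> /(_ _)/lie_span_empty -> // i Pi wi.
  by have [_] := hP i Pi wi; rewrite addn0 ltnNge wi.
suff main (l : seq X) : (forall i, P i -> (w i <= N)%N ->
    (w i + j)%N = N -> i \in l) -> u = 0.
  by apply: (main s) => i Pi wi _; have [] := hP i Pi wi.
move: {2}(size l) (leqnn (size l)) => r lr hl.
elim: r X P w s u hP su u0 l lr hl => [|r IHr] X P w s u hP su u0.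
  case=> // _ hl; apply: (IHj X P w N s) => // i Pi wi.
  have [is_ ij wi0] := hP i Pi wi; split=> //.
  by rewrite ltn_neqAle; apply/andP; split;
    [apply/eqP => /esym /(hl i Pi wi)|lia].
case=> [_ hl|x l /= lr hl]; first exact: (IHr X P w s u hP su u0 [::]).
case: (pselect (P x /\ (w x + j)%N = N)) => [[Px wx]|nx]; last first.
  apply: (IHr X P w s u hP su u0 l) => // i Pi wi wE.
  have := hl i Pi wi wE; rewrite inE => /orP[/eqP ix|//].
  by case: nx; rewrite -ix.
have wxN : (w x <= N)%N by lia.
have [_ _ wx0] := hP x Px wxN.
apply: (iota_inj_step Px su u0) => v sv v0.
apply: (IHr _ (ad_letter x P) (ad_weight x w)
  [seq (z, nseq k x) | z <- s, k <- iota 0 (N + 1)] v _ sv v0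
  [seq (z, [::]) | z <- l]); rewrite ?size_map //.
- move=> [z t] [/= Pz zx [k ->]]; rewrite /ad_weight /= size_nseq => wz.
  have [|zs zN z0] := hP z Pz; first lia.
  split; [|lia|lia]; apply/allpairsPdep; exists z, k; split=> //=.
  rewrite mem_iota /= add0n addn1 ltnS; apply: leq_trans _ wz.
  by apply: leq_trans (leq_addl _ _); rewrite leq_pmull.
- move=> [z t] [/= Pz zx [k ->]]; rewrite /ad_weight /= size_nseq => wz wE.
  have [|zs zN z0] := hP z Pz; first lia.
  have k0 : k = 0%N by case: k wz wE => // k; rewrite mulnS; lia.
  rewrite k0 muln0 addn0 in wE wz *; apply: map_f.
  by have := hl z Pz wz wE; rewrite inE (negPf zx).
Qed.

(** The theorem of Magnus and Witt. Finitely many letters occur in u, and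
    giving them the weight 1 bounds the weight of u. *)
Lemma iota_inj (X : eqType) (u : flie X) : iota_lie u = 0 -> u = 0.
Proof.
have mono (s s' : seq X) N N' v : {subset s <= s'} -> (N <= N')%N ->
    lie_span (@fgen X) (fun i => i \in s) (fun=> 1%N) N v ->
    lie_span (@fgen X) (fun i => i \in s') (fun=> 1%N) N' v.
  move=> ss NN sv; apply: (lie_span_le _ NN).
  by apply: lie_span_sub sv => i /ss.
have subl (s s' : seq X) : {subset s <= s ++ s'} by move=> i;
  rewrite mem_cat => ->.
have subr (s s' : seq X) : {subset s' <= s ++ s'}.
  by move=> i; rewrite mem_cat orbC => ->.
have [s [N su]] : exists (s : seq X) N,
    lie_span (@fgen X) (fun i => i \in s) (fun=> 1%N) N u.
  elim/flie_ind: u => [x||u [s [N su]]|u v [s [N su]] [t [M tv]]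
    |u v [s [N su]] [t [M tv]]].
  - by exists [:: x], 1%N; apply: SpanGen; rewrite ?inE.
  - by exists [::], 0%N; exact: SpanZero.
  - by exists s, N; exact: SpanOpp.
  - exists (s ++ t), (N + M)%N; apply: SpanAdd.
      by apply: mono su => //; rewrite leq_addr.
    by apply: mono tv => //; rewrite leq_addl.
  - by exists (s ++ t), (N + M)%N; apply: (@SpanBr _ _ _ _ _ N M) => //;
      [apply: mono su|apply: mono tv].
move=> u0; have hs i : i \in s -> (1 <= N)%N ->
    [/\ i \in s, (N < 1 + N)%N & (0 < 1)%N] by move=> is_ _; split=> //; lia.
exact: (iota_inj_weight hs su u0).
Qed.

(** The freeness half of Lazard elimination: the action on power series in the
    new letters recovers the power series of v, and hence v by [iota_inj]. *)
Lemma elim_map_inj (X : eqType) (B : pred X) w N (v : flie (X * seq X)%type) :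
  lie_span (@fgen _) (elim_letter B) w N v -> elim_map v = 0 -> v = 0.
Proof.
move=> sv v0; have [c [cE cA]] := elim_act_span sv.
apply: iota_inj; rewrite -[LHS]mulr1 -cA; apply: pact_eq0.
by rewrite cE v0 (lie_hom0 (@iota_hom X)).
Qed.

(** * Elimination of letters in sets of Lie monomials *)

Lemma lie_span_map (L M : lieRingType) (I J : Type) (phi : L -> M)
  (b : J -> L) (Q : J -> Prop) (v : J -> nat)
  (a : I -> M) (P : I -> Prop) (w : I -> nat) N x :
  lie_hom phi -> (forall j, Q j -> lie_span a P w (v j) (phi (b j))) ->
  lie_span b Q v N x -> lie_span a P w N (phi x).
Proof.
move=> hphi h; elim=> {N x}
  [N j Qj vj|N|N x _ IH|N x y _ IHx _ IHy|N1 N2 N x y _ IHx _ IHy N12].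
- exact: lie_span_le (h j Qj) vj.
- by rewrite (lie_hom0 hphi); exact: SpanZero.
- by rewrite (lie_homN hphi); exact: SpanOpp.
- by rewrite (lie_homD hphi); exact: SpanAdd.
- by rewrite (lie_hom_br hphi); exact: SpanBr N12.
Qed.

Lemma lie_span_hom_ext (L M : lieRingType) (I : Type) (phi psi : L -> M)
  (a : I -> L) (P : I -> Prop) (w : I -> nat) N x :
  lie_hom phi -> lie_hom psi -> (forall i, P i -> phi (a i) = psi (a i)) ->
  lie_span a P w N x -> phi x = psi x.
Proof.
move=> hp hq e; elim=> {N x}
  [N j Qj vj|N|N x _ IH|N x y _ IHx _ IHy|N1 N2 N x y _ IHx _ IHy N12].
- exact: e.
- by rewrite !lie_hom0.
- by rewrite (lie_homN hp) (lie_homN hq) IH.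
- by rewrite (lie_homD hp) (lie_homD hq) IHx IHy.
- by rewrite (lie_hom_br hp) (lie_hom_br hq) IHx IHy.
Qed.

HB.instance Definition _ (X : Type) := gen_eqMixin (lie_monomial X).

Local Notation w0 := (fun=> 0%N).

Section MonomialElim.
Variable X : eqType.
Local Notation MX := (lie_monomial X).
Local Notation Y := (MX * seq MX)%type.
Implicit Types (S : set MX) (W V : MX) (k : X).

Definition feval W : flie X := lie_eval (@fgen X) W.
Definition mono_lift : flie MX -> flie X := flift feval.
Lemma mono_lift_hom : lie_hom mono_lift. Proof. exact: flift_hom. Qed.
(** Formal monomials serve as letters, so that the subsets S of one type can
    replace one another in the successive eliminations. *)
Definition free_monomials S : Prop :=
  forall v, lie_span (@fgen MX) S w0 0 v -> mono_lift v = 0 -> v = 0.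

Definition left_norm (y : Y) : MX := foldr (fun V W => Bracket W V) y.1 y.2.

Definition step_letter k S (y : Y) : Prop :=
  [/\ S y.1, occurs k y.1 & forall V, V \in y.2 -> S V /\ ~~ occurs k V].

Lemma K_stepP k S W : K_step k S W ->
  exists2 y, step_letter k S y & left_norm y = W.
Proof.
elim=> {W} [W SW kW|W V _ [[z s] [/= Sz kz ss] <-] SV kV].
  by exists (W, [::]).
exists (z, V :: s) => //; split=> // U; rewrite inE => /orP[/eqP ->|/ss] //.
Qed.

Lemma feval_left_norm y : mono_lift (elim_gen y) = feval (left_norm y).
Proof.
case: y => z s; rewrite /elim_gen /left_norm /=.
elim: s => [|V s IH] /=; first exact: flift_gen.
by rewrite (lie_hom_br mono_lift_hom) IH /mono_lift flift_gen.
Qed.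

(** A step for k eliminates the monomials of S without the letter k, and the
    monomials that it produces are the left-normed brackets of
    [elim_map_inj]. *)
Lemma K_step_free k S : free_monomials S -> free_monomials (K_step k S).
Proof.
move=> freeS v sv v0.
pose B : pred MX := fun V => ~~ occurs k V.
pose phi : flie Y -> flie MX := flift (fun y => fgen (left_norm y)).
have hphi : lie_hom phi by exact: flift_hom.
have [|v' sv' vE] := lie_span_lift (b := @fgen Y) (Q := step_letter k S)
  (v := w0) hphi _ sv.
  by move=> W /K_stepP[y ly <-]; exists y; split=> //; exact: flift_gen.
have e_span : lie_span (@fgen MX) S w0 0 (elim_map v').
  apply: (lie_span_map (@elim_map_hom MX) _ sv') => -[z s] [/= Sz _ ss].
  rewrite /elim_map flift_gen /elim_gen /=.
  elim: s ss => [_|V s IH ss] /=; first exact: SpanGen.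
  apply: (@SpanBr _ _ _ _ _ 0 0) => //.
    by apply: IH => U Us; apply: ss; rewrite inE Us orbT.
  by apply: SpanGen => //; have [] := ss V (mem_head _ _).
have e0 : mono_lift (elim_map v') = 0.
  rewrite -v0 -vE.
  apply: (flie_hom_ext (lie_hom_comp mono_lift_hom (@elim_map_hom MX))
    (lie_hom_comp mono_lift_hom hphi)).
  move=> y /=; rewrite /elim_map flift_gen feval_left_norm /phi flift_gen.
  by rewrite /mono_lift flift_gen.
rewrite -vE (_ : v' = 0) ?lie_hom0 //.
apply: (@elim_map_inj _ B w0 0) (freeS _ e_span e0).
apply: lie_span_sub sv' => -[z s] [/= _ kz ss] _; split;
  first by rewrite /B negbK.
by apply/allP => V /ss[].
Qed.

Definition kill k : flie X -> flie X :=
  flift (fun x => if x == k then 0 else fgen x).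

Lemma kill_hom k : lie_hom (kill k). Proof. exact: flift_hom. Qed.

Lemma kill_feval k W : kill k (feval W) = if occurs k W then 0 else feval W.
Proof.
elim: W => [x|U IHU V IHV] /=; first by rewrite /kill flift_gen eq_sym.
rewrite /feval /= (lie_hom_br (kill_hom k)) -!/(feval _) IHU IHV.
by case: (occurs k U); rewrite ?lieb0l //=; case: (occurs k V); rewrite ?lieb0r.
Qed.

(** By [elim_span], u is the sum of a combination x of monomials without k and
    a combination y of monomials of the next set, all of which contain k.
    Setting k to zero fixes x and kills y, so x is zero. *)
Lemma K_step_span k S u : lie_span feval S w0 0 u -> kill k u = 0 ->
  lie_span feval (K_step k S) w0 0 u.
Proof.
move=> su u0.
have [W V KW [SV kV]||x [y [sx sy uE]]] :=
  @elim_span _ _ _ feval (fun V => S V /\ ~~ occurs k V) w0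
    feval (K_step k S) w0 _ _ feval S w0 0%N u _ su.
- by exists (Bracket W V); split=> //; exact: KBracket.
- move=> W SW; case: (boolP (occurs k W)) => kW; [right|left];
  apply: SpanGen => //.
  exact: KStart.
have y0 : kill k y = 0.
  have hz : lie_hom (fun _ : flie X => 0 : flie X).
    by split=> a b; rewrite ?addr0 ?lieb0l.
  rewrite (lie_span_hom_ext (kill_hom k) hz _ sy) // => W KW;
    rewrite kill_feval.
  suff -> : occurs k W by [].
  by elim: KW => [//|{}W V _ /= -> //].
have xx : kill k x = x.
  have hid : lie_hom (id : flie X -> flie X) by [].
  rewrite (lie_span_hom_ext (kill_hom k) hid _ sx) // => W [_ /negPf kW].
  by rewrite kill_feval kW.
have x0 : x = 0 by rewrite -u0 uE (lie_homD (kill_hom k)) xx y0 addr0.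
by rewrite uE x0 add0r.
Qed.

Definition letter_set : set MX := [set W | exists x, W = Letter x].

Lemma letter_free : free_monomials letter_set.
Proof.
move=> v sv v0; pose psi : flie X ->
  flie MX := flift (fun x => fgen (Letter x)).
have hp : lie_hom psi by exact: flift_hom.
have hid : lie_hom (id : flie MX -> flie MX) by [].
rewrite -(lie_span_hom_ext (lie_hom_comp hp mono_lift_hom) hid _ sv) /= ?v0
  ?lie_hom0 //.
by move=> _ [x ->] /=; rewrite /mono_lift flift_gen /feval /= /psi flift_gen.
Qed.

Lemma letter_span u : lie_span feval letter_set w0 0 u.
Proof.
elim/flie_ind: u => [x||u IH|u v IHu IHv|u v IHu IHv].
- by apply: (@SpanGen _ _ feval _ w0 0%N (Letter x)) => //; exists x.
- exact: SpanZero.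
- exact: SpanOpp.
- exact: SpanAdd.
- exact: (SpanBr IHu IHv (leqnn 0)).
Qed.

Section Iterated.
Variable r : seq X.
Local Notation Kr := (foldr (@K_step X) letter_set r).

Lemma K_free : free_monomials Kr.
Proof. by elim: r => [|k s IH] /=; [exact: letter_free|exact: K_step_free]. Qed.

Lemma K_span u : (forall k,
  k \in r -> kill k u = 0) -> lie_span feval Kr w0 0 u.
Proof.
elim: r => [|k s IH] /= ks; first exact: letter_span.
apply: K_step_span; last by apply: ks; rewrite mem_head.
by apply: IH => j js; apply: ks; rewrite inE js orbT.
Qed.

Lemma K_occurs W k : Kr W -> k \in r -> occurs k W.
Proof.
elim: r W => [//|j s IH] W /= KW; rewrite inE.
elim: KW => [{}W SW jW|{}W V _ IHW _ _] /=.
  by case/orP => [/eqP -> //|ks]; exact: IH.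
by move=> /IHW ->.
Qed.

End Iterated.

Lemma free_monomials_inj S : free_monomials S ->
  injective (flift (fun W : S => feval (\val W)) : flie S -> flie X).
Proof.
move=> freeS; apply: lie_hom_inj => [|v v0]; first exact: flift_hom.
pose phi : flie S -> flie MX := flift (fun W : S => fgen (\val W)).
(* A retraction of phi: letters outside S go to zero. *)
pose psi : flie MX -> flie S :=
  flift (fun W => if pselect (W \in S) is left WS then fgen (exist _ W WS) else
    0).
have hphi : lie_hom phi by exact: flift_hom.
have hpsi : lie_hom psi by exact: flift_hom.
have hid : lie_hom (id : flie S -> flie S) by [].
have phi0 : phi v = 0.
  apply: freeS.
    elim/flie_ind: v {v0} => [W||u IH|u v IHu IHv|u v IHu IHv].
    - rewrite /phi flift_gen; apply: SpanGen => //; exact: set_mem (valP W).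
    - by rewrite lie_hom0 //; exact: SpanZero.
    - by rewrite (lie_homN hphi); exact: SpanOpp.
    - by rewrite (lie_homD hphi); exact: SpanAdd.
    - by rewrite (lie_hom_br hphi); exact: (SpanBr IHu IHv (leqnn 0)).
  rewrite -v0; apply: (flie_hom_ext (lie_hom_comp mono_lift_hom hphi)
    (flift_hom _)) => W /=.
  by rewrite /phi /mono_lift !flift_gen.
have -> : v = (psi \o phi) v.
  apply/esym; apply: (flie_hom_ext (lie_hom_comp hpsi hphi) hid) => W /=.
  rewrite /phi flift_gen /psi flift_gen.
  case: pselect => [WS|]; last by case; exact: (valP W).
  by congr fgen; exact: val_inj.
by rewrite /= phi0 lie_hom0.
Qed.

End MonomialElim.

(** * Orders and substitutions of power series *)

Section SeriesOrder.
Variable X : Type.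
Implicit Types (f g h : series X) (x y : X) (w v : seq X) (k : nat).

Definition sord k f : Prop := forall w, (size w < k)%N -> f w = 0.

Lemma smul_local f g h w :
  (forall v, (size v <= size w)%N -> g v = h v) -> (f * g) w = (f * h) w.
Proof.
elim: w f => [|x w IH] f gh; first by rewrite !smul_nil gh.
by rewrite !smul_cons gh // IH // => v vw; apply: gh; exact: leqW.
Qed.

Lemma smul_local0 f g h w : f [::] = 0 ->
  (forall v, (size v < size w)%N -> g v = h v) -> (f * g) w = (f * h) w.
Proof.
case: w => [|x w] f0 gh; first by rewrite !smul_nil f0 !mul0r.
by rewrite !smul_cons f0 !mul0r !add0r; exact: smul_local.
Qed.

Lemma smul_lead f g w : sord (size w) g -> (f * g) w = f [::] * g w.
Proof.
case: w => [|x w] gw; first exact: smul_nil.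
by rewrite smul_cons (@smul_local (sder x f) g 0 w gw) mulr0 addr0.
Qed.

Lemma sord_mul k l f g : sord k f -> sord l g -> sord (k + l) (f * g).
Proof.
elim: k f => [|k IH] f fk gl w.
  move=> wl; rewrite smul_lead ?gl ?mulr0 // => v vw; apply: gl; lia.
case: w => [|x w] wk; first by rewrite smul_nil fk // mul0r.
rewrite smul_cons fk // mul0r add0r; apply: IH => // v vk.
exact: fk.
Qed.

Lemma sordD k f g : sord k f -> sord k g -> sord k (f + g).
Proof. by move=> fk gk w wk; rewrite seriesD fk ?gk. Qed.

Lemma sordN k f : sord k f -> sord k (- f).
Proof. by move=> fk w wk; rewrite seriesN fk ?oppr0. Qed.

Lemma sordB k f g : sord k f -> sord k g -> sord k (f - g).
Proof. by move=> fk gk; apply: sordD => //; exact: sordN. Qed.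

Lemma sord_le k l f : sord l f -> (k <= l)%N -> sord k f.
Proof. by move=> fl kl w wk; apply: fl; lia. Qed.

Lemma sord_sder k x f : sord k.+1 f -> sord k (sder x f).
Proof. by move=> fk w wk; apply: fk. Qed.

End SeriesOrder.

Lemma sder_letter (X : eqType) (x y : X) : sder y (sletter x) = 1 *~ (y ==
  x)%:Z.
Proof.
apply: funext => v; rewrite seriesMz series1 /sder /sletter /sword eqseq_cons.
by case: (y == x); case: v.
Qed.

Section Subst.
Variable X : finType.
Implicit Types (f g h : series X) (x y : X) (w v : seq X) (k : nat).
Implicit Types (s t : X -> series X).

(** The functional equation of the continuous ring endomorphism that maps each
    letter x to [s x]. When the series [s x] have no constant term, it
    determines the coefficients of Phi f on words of a given length from those
    of the series [Phi (sder x f)] on shorter words. *)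
Definition subst_rule s (Phi : series X -> series X) : Prop :=
  forall f, Phi f = 1 *~ f [::] + \sum_x s x * Phi (sder x f).

Lemma subst_rule_ext s Phi Psi : (forall x, s x [::] = 0) ->
  subst_rule s Phi -> subst_rule s Psi -> Phi =1 Psi.
Proof.
move=> s0 P Q f; apply: funext => w; move: (leqnn (size w));
  move: {2}(size w) => n.
elim: n f w => [|n IH] f w wn; rewrite P Q !seriesD; congr (_ + _);
  rewrite !series_sum; apply: eq_bigr => x _; apply: smul_local0 => // v vw.
  by move: vw; rewrite ltnNge (leq_trans wn).
by apply: IH; rewrite -ltnS (leq_trans vw).
Qed.

(** The k-th approximation is exact on words of length at most k. *)
Fixpoint subst_n s k f : series X :=
  if k is k'.+1 then 1 *~ f [::] + \sum_x s x * subst_n s k' (sder x f)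
  else 1 *~ f [::].

Definition subst s f : series X := fun w => subst_n s (size w) f w.

Section Fixed.
Variable s : X -> series X.
Hypothesis s0 : forall x, s x [::] = 0.

Lemma subst_n_stable k l f w : (size w <= k)%N -> (size w <= l)%N ->
  subst_n s k f w = subst_n s l f w.
Proof.
have h0 j g : subst_n s j g [::] = g [::].
  case: j => [|j] /=; first by rewrite seriesMz intz.
  rewrite seriesD seriesMz intz series_sum big1 ?addr0 // => x _.
  by rewrite smul_nil s0 mul0r.
elim: k l f w => [|k IH] [|l] f w //; rewrite ?leqn0 ?size_eq0;
  try (by move=> /eqP -> _; rewrite !h0); try (by move=> _ /eqP ->;
    rewrite !h0).
move=> wk wl /=; rewrite !seriesD; congr (_ + _); rewrite !series_sum.
apply: eq_bigr => x _; apply: smul_local0 => // v vw; apply: IH; lia.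
Qed.

Lemma substE : subst_rule s (subst s).
Proof.
move=> f; apply: funext => w;
  rewrite /subst (@subst_n_stable _ (size w).+1) //=.
rewrite !seriesD; congr (_ + _); rewrite !series_sum.
apply: eq_bigr => x _; apply: smul_local0 => // v vw.
by apply: subst_n_stable; lia.
Qed.

Lemma subst_nil f : subst s f [::] = f [::].
Proof. by rewrite /subst /= seriesMz intz. Qed.

Lemma substD : {morph subst s : f g / f + g}.
Proof.
move=> f g; apply: funext => w; rewrite seriesD.
move: (leqnn (size w)); move: {2}(size w) => n.
elim: n f g w => [|n IH] f g w wn.
  by case: w wn => // _; rewrite !subst_nil.
rewrite !substE // !seriesD !(seriesMz, seriesD) mulrzDr -!addrA; congr (_ + _).
rewrite addrCA; congr (_ + _); rewrite !series_sum -big_split;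
  apply: eq_bigr => x _ /=.
rewrite -seriesD -mulrDr; apply: smul_local0 => // v vw.
by rewrite sderD seriesD IH //; lia.
Qed.

Lemma subst1 : subst s 1 = 1.
Proof.
rewrite substE big1 ?addr0 // => x _.
by have -> : sder x (1 : series X) = 0 by []; rewrite (morphD0 substD) mulr0.
Qed.

Lemma subst_letter x : subst s (sletter x) = s x.
Proof.
rewrite substE /sletter /sword mulr0z add0r -/(sletter x).
rewrite (bigD1 x) //= big1 ?addr0 => [|y /negPf yx]; rewrite sder_letter.
  by rewrite eqxx mulr1z subst1 mulr1.
by rewrite yx mulr0z (morphD0 substD) mulr0.
Qed.

Lemma substM : {morph subst s : f g / f * g}.
Proof.
move=> f g; apply: funext => w.
move: (leqnn (size w)); move: {2}(size w) => n.
elim: n f g w => [|n IH] f g w wn.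
  by case: w wn => // _; rewrite smul_nil !subst_nil smul_nil.
have E : subst s (f * g) =
    1 *~ (f [::] * g [::]) + \sum_x s x * (subst s (sder x g) *~ f [::])
    + \sum_x s x * subst s (sder x f * g).
  rewrite substE -addrA; congr (_ + _); rewrite -big_split;
    apply: eq_bigr => x _ /=.
  rewrite -mulrDr -(morphDMz substD) -substD; congr (_ * subst s _).
  by apply: funext => v; rewrite seriesD seriesMz -mulrzr intz mulrC.
have E' : subst s f * subst s g =
    1 *~ (f [::] * g [::]) + \sum_x s x * (subst s (sder x g) *~ f [::])
    + \sum_x s x * (subst s (sder x f) * subst s g).
  rewrite [subst s f]substE mulrDl mulr_suml; congr (_ + _); last first.
    by apply: eq_bigr => x _; rewrite mulrA.
  rewrite mulrzl [subst s g]substE mulrzDl mulrC mulrzA; congr (_ + _).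
  by rewrite mulrz_suml; apply: eq_bigr => x _; rewrite mulrzAr.
rewrite E E' [LHS]seriesD [RHS]seriesD; congr (_ + _); rewrite !series_sum.
by apply: eq_bigr => x _; apply: smul_local0 => // v vw; rewrite IH //; lia.
Qed.

Section Leading.
Variable p : X -> X.
Hypothesis sp : forall x y, s x [:: y] = (x == p y)%:Z.

(** If [s x] is a single letter up to higher terms, the lowest terms of f only
    undergo the corresponding renaming of letters. *)
Lemma subst_lead k f w : sord k f -> (size w <= k)%N ->
  subst s f w = f (map p w).
Proof.
elim: k f w => [|k IH] f w fk wk.
  by case: w wk => // _; exact: subst_nil.
case: w wk => [|y w] wk; first exact: subst_nil.
rewrite substE seriesD seriesMz fk // mul0rz add0r series_sum.
have tail x : (sder y (s x) * subst s (sder x f)) w =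
    (x == p y)%:Z * f (x :: map p w).
  rewrite smul_lead => [|v vw];
    first by rewrite /sder sp -/(sder x f) (IH (sder x f)) //; exact: sord_sder.
  rewrite (IH (sder x f)) //; [|exact: sord_sder|exact: leq_trans (ltnW vw) wk].
  by rewrite /sder fk //= size_map; exact: leq_trans vw _.
rewrite (bigD1 (p y)) //= big1 ?addr0 => [|x /negPf xy].
  by rewrite smul_cons s0 mul0r add0r tail eqxx mul1r.
by rewrite smul_cons s0 mul0r add0r tail xy mul0r.
Qed.

End Leading.

End Fixed.
End Subst.

(** * Artin automorphisms of power series *)

Section Artin.
Variable X : finType.
Local Notation series := (series X).
Implicit Types (f g h : series) (a b c x y : X) (w v : seq X) (k : nat).
Implicit Types (Phi Psi : series -> series).

Definition sunit x : series := 1 + sletter x.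

Fixpoint sinv x w : int :=
  if w is y :: w' then - ((y == x)%:Z * sinv x w') else 1.
Local Notation sinvs x := (sinv x : series).

Lemma sder_inv x y : sder y (sinv x) = (- sinvs x) *~ (y == x)%:Z.
Proof.
apply: funext => w; rewrite seriesMz seriesN /sder /=.
by case: (y == x); rewrite ?mul1r ?mul0r ?mulr1z ?mulr0z ?oppr0.
Qed.

Lemma sunitK x : sunit x * sinv x = 1.
Proof.
apply: funext => w; rewrite /sunit mulrDl mul1r seriesD sletter_mul series1.
by case: w => [|y w] /=; rewrite ?addr0 // addNr.
Qed.

Lemma sinvK x : sinvs x * sunit x = 1.
Proof.
apply: funext; elim=> [|y w IH]; first by rewrite smul_nil mul1r.
rewrite smul_cons mul1r sder_inv mulrzAl seriesMz mulNr seriesN IH.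
rewrite /sunit seriesD !series1 /sletter /sword eqseq_cons add0r.
by case: (y == x); rewrite ?mulr0z // mulr1z; case: w {IH}.
Qed.

Lemma inv_uniq (f g h : series) : f * g = 1 -> g * h = 1 -> f = h.
Proof. by move=> fg gh; rewrite -[f]mulr1 -gh mulrA fg mul1r. Qed.

(** The continuous ring endomorphisms that preserve constant terms. They are
    determined by the images of the invertible series 1 + x, on which the
    relations between Artin automorphisms are equalities of products. *)
Definition substitution Phi : Prop :=
  [/\ {morph Phi : f g / f + g}, {morph Phi : f g / f * g}, Phi 1 = 1,
      forall x, Phi (sletter x) [::] = 0 & subst_rule (fun x => Phi (sletter
        x)) Phi].

Lemma subst_substitution s : (forall x, s x [::] = 0) -> substitution (subst s).
Proof.
move=> s0; split=> [||||f]; [exact: substD|exact: substM|exact: subst1| |].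
  by move=> x; rewrite subst_nil.
rewrite {1}substE //; congr (_ + _).
by apply: eq_bigr => x _; rewrite subst_letter.
Qed.

Lemma substitution_id : substitution id.
Proof.
split=> // f; apply: funext => w; rewrite seriesD series_sum seriesMz series1.
case: w => [|y w].
  by rewrite big1 ?addr0 ?intz // => x _; rewrite sletter_mul.
rewrite mul0rz add0r (bigD1 y) //= big1 => [|x /negPf xy].
  by rewrite sletter_mul eqxx mul1r addr0.
by rewrite sletter_mul eq_sym xy mul0r.
Qed.

Lemma substitution_nil Phi f : substitution Phi -> Phi f [::] = f [::].
Proof.
case=> _ _ _ P0 ->; rewrite seriesD seriesMz intz series_sum big1 ?addr0 // =>
  x _.
by rewrite smul_nil P0 mul0r.
Qed.

Lemma substitution_comp Phi Psi :
  substitution Phi -> substitution Psi -> substitution (Phi \o Psi).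
Proof.
move=> sP sQ; have [PD PM P1 P0 PE] := sP; have [QD QM Q1 Q0 QE] := sQ.
split=> [f g|f g||x|f] /=; rewrite ?QD ?PD ?QM ?PM ?Q1 //.
  by rewrite substitution_nil.
rewrite {1}QE PD (morphDMz PD) P1 (morphD_sum PD); congr (_ + _).
by apply: eq_bigr => x _; rewrite PM.
Qed.

Lemma substitution_ext Phi Psi : substitution Phi -> substitution Psi ->
  (forall x, Phi (sunit x) = Psi (sunit x)) -> Phi =1 Psi.
Proof.
move=> [PD PM P1 P0 PE] [QD QM Q1 Q0 QE] e.
have e' x : Phi (sletter x) = Psi (sletter x).
  by have := e x; rewrite PD QD P1 Q1 => /addrI.
apply: (subst_rule_ext P0 PE) => f; rewrite {1}QE; congr (_ + _).
by apply: eq_bigr => x _; rewrite e'.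
Qed.

Lemma substitution_inv Phi x g h : substitution Phi ->
  Phi (sunit x) = g -> g * h = 1 -> Phi (sinv x) = h.
Proof.
move=> [_ PM P1 _ _] Pg; apply: inv_uniq.
by rewrite -Pg -PM sinvK P1.
Qed.

Section Alpha.
Variables a b : X.
Hypothesis ab : a != b.

(** Artin's automorphism for the exchange of two strands a and b: it maps 1 + a
    to 1 + b, and 1 + b to the conjugate of 1 + a by 1 + b. It preserves the
    product of 1 + a and 1 + b, a loop around both strands. *)
Definition alpha_fun x : series :=
  if x == a then sletter b
  else if x == b then sinvs b * sletter a * sunit b else sletter x.
Definition beta_fun x : series :=
  if x == b then sletter a
  else if x == a then sunit a * sletter b * sinvs a else sletter x.

Lemma alpha_fun0 x : alpha_fun x [::] = 0.
Proof. by rewrite /alpha_fun; do 2?case: eqP => // _;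
  rewrite !smul_nil mulr0 mul0r. Qed.
Lemma beta_fun0 x : beta_fun x [::] = 0.
Proof. by rewrite /beta_fun; do 2?case: eqP => // _;
  rewrite !smul_nil mulr0 mul0r. Qed.

Definition alpha := subst alpha_fun.
Definition beta := subst beta_fun.

Lemma alphaP : substitution alpha. Proof. exact/subst_substitution/alpha_fun0.
  Qed.
Lemma betaP : substitution beta. Proof. exact/subst_substitution/beta_fun0. Qed.

Lemma alpha_unit x : alpha (sunit x) = 1 + alpha_fun x.
Proof.
have [PD _ P1 _ _] := alphaP.
by rewrite /sunit PD P1 /alpha subst_letter //; exact: alpha_fun0.
Qed.
Lemma beta_unit x : beta (sunit x) = 1 + beta_fun x.
Proof.
have [PD _ P1 _ _] := betaP.
by rewrite /sunit PD P1 /beta subst_letter //; exact: beta_fun0.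
Qed.

Lemma alpha_a : alpha (sunit a) = sunit b.
Proof. by rewrite alpha_unit /alpha_fun eqxx. Qed.
Lemma alpha_b : alpha (sunit b) = sinvs b * sunit a * sunit b.
Proof.
rewrite alpha_unit /alpha_fun eq_sym (negPf ab) eqxx.
by rewrite [sunit a]/sunit [sinvs b * (1 + _)]mulrDr mulr1 [RHS]mulrDl sinvK.
Qed.
Lemma alpha_x x : x != a -> x != b -> alpha (sunit x) = sunit x.
Proof. by move=> /negPf xa /negPf xb; rewrite alpha_unit /alpha_fun xa xb. Qed.
Lemma beta_b : beta (sunit b) = sunit a.
Proof. by rewrite beta_unit /beta_fun eqxx. Qed.
Lemma beta_a : beta (sunit a) = sunit a * sunit b * sinvs a.
Proof.
rewrite beta_unit /beta_fun (negPf ab) eqxx.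
by rewrite [sunit b]/sunit [sunit a * (1 + _)]mulrDr mulr1 [RHS]mulrDl sunitK.
Qed.
Lemma beta_x x : x != a -> x != b -> beta (sunit x) = sunit x.
Proof. by move=> /negPf xa /negPf xb; rewrite beta_unit /beta_fun xa xb. Qed.

Lemma alpha_inv_a : alpha (sinv a) = sinv b.
Proof. exact: substitution_inv alphaP alpha_a (sunitK b). Qed.
Lemma alpha_inv_b : alpha (sinv b) = sinvs b * sinvs a * sunit b.
Proof.
apply: substitution_inv alphaP alpha_b _.
rewrite !mulrA -(mulrA _ (sunit b)) sunitK mulr1 -(mulrA _ (sunit a)) sunitK
  mulr1.
exact: sinvK.
Qed.
Lemma alpha_inv_x x : x != a -> x != b -> alpha (sinv x) = sinv x.
Proof. by move=> xa xb;
  exact: substitution_inv alphaP (alpha_x xa xb) (sunitK x). Qed.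
Lemma beta_inv_b : beta (sinv b) = sinv a.
Proof. exact: substitution_inv betaP beta_b (sunitK a). Qed.

Lemma alphaK : cancel alpha beta.
Proof.
apply: (substitution_ext (substitution_comp betaP alphaP) substitution_id) => x
  /=.
have [_ BM _ _ _] := betaP.
have [->|xa] := eqVneq x a; first by rewrite alpha_a beta_b.
have [->|xb] := eqVneq x b; last by rewrite alpha_x // beta_x.
rewrite alpha_b !BM beta_a beta_b beta_inv_b !mulrA sinvK mul1r.
by rewrite -mulrA sinvK mulr1.
Qed.

Lemma betaK : cancel beta alpha.
Proof.
apply: (substitution_ext (substitution_comp alphaP betaP) substitution_id) => x
  /=.
have [_ AM _ _ _] := alphaP.
have [->|xb] := eqVneq x b; first by rewrite beta_b alpha_a.
have [->|xa] := eqVneq x a; last by rewrite beta_x // alpha_x.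
rewrite beta_a !AM alpha_a alpha_b alpha_inv_a !mulrA sunitK mul1r.
by rewrite -mulrA sunitK mulr1.
Qed.

Definition swap x : X := if x == a then b else if x == b then a else x.

(** Conjugation by 1 + b changes only higher terms, so that to leading order
    Artin's automorphism just exchanges the two letters. *)
Lemma alpha_lead k f w : sord k f -> (size w <= k)%N ->
  alpha f w = f (map swap w).
Proof.
apply: subst_lead => [|x y]; first exact: alpha_fun0.
rewrite /alpha_fun /swap.
have [->|xa] := eqVneq x a.
  rewrite /sletter /sword eqseq_cons andbT.
  have [->|ya] := eqVneq y a; first by rewrite (negPf ab).
  have [_|yb] := eqVneq y b; first by rewrite eqxx.
  by rewrite eq_sym (negPf ya).
have [->|xb] := eqVneq x b.
  rewrite smul_cons !smul_nil /sder smul_cons !smul_nil /= mulr0 mul0r add0r.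
  rewrite /sder /sunit seriesD !series1 /sletter /sword eqseq_cons andbT /=
    mul1r.
  have [->|ya] := eqVneq y a; first by rewrite eqxx mulr1 mulr0 !addr0.
  rewrite !mulr0 !addr0 mul0r.
  have [_|yb] := eqVneq y b; first by rewrite eq_sym (negPf ab).
  by rewrite eq_sym (negPf yb).
rewrite /sletter /sword eqseq_cons andbT eq_sym.
have [->|ya] := eqVneq y a; first by rewrite (negPf xa) (negPf xb).
by have [->|yb] := eqVneq y b; first by rewrite (negPf xa) (negPf xb).
Qed.

Lemma beta_lead k f w : sord k f -> (size w <= k)%N ->
  beta f w = f (map swap w).
Proof.
apply: subst_lead => [|x y]; first exact: beta_fun0.
rewrite /beta_fun /swap.
have [->|xb] := eqVneq x b.
  rewrite /sletter /sword eqseq_cons andbT.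
  have [_|ya] := eqVneq y a; first by rewrite eqxx.
  have [_|yb] := eqVneq y b; first by rewrite eq_sym (negPf ab).
  by rewrite eq_sym (negPf yb).
have [->|xa] := eqVneq x a.
  rewrite smul_cons !smul_nil /sder smul_cons !smul_nil /= mulr0 mul0r add0r.
  rewrite /sder /sunit seriesD !series1 /sletter /sword eqseq_cons andbT /=
    addr0 mul1r mulr1.
  have [->|ya] := eqVneq y a; first by rewrite (negPf ab) ?mulr0 ?mul0r ?addr0.
  have [_|yb] := eqVneq y b; first by rewrite eqxx ?mulr0 ?mul0r ?addr0.
  by rewrite ?mulr0 ?mul0r ?addr0 eq_sym (negPf ya).
rewrite /sletter /sword eqseq_cons andbT eq_sym.
have [->|ya] := eqVneq y a; first by rewrite (negPf xa) (negPf xb).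
by have [->|yb] := eqVneq y b; first by rewrite (negPf xa) (negPf xb).
Qed.

Lemma alpha_mul_x x f : x != a -> x != b ->
  alpha (sunit x * f) = sunit x * alpha f.
Proof. by have [_ AM _ _ _] := alphaP; move=> xa xb; rewrite AM alpha_x. Qed.

Lemma alpha_mul_a f : alpha (sunit a * f) = sunit b * alpha f.
Proof. by have [_ AM _ _ _] := alphaP; rewrite AM alpha_a. Qed.

Lemma alpha_mul_ab f :
  alpha (sunit a * (sunit b * f)) = sunit a * (sunit b * alpha f).
Proof.
by have [_ AM _ _ _] := alphaP; rewrite !AM alpha_a alpha_b !mulrA sunitK mul1r.
Qed.

End Alpha.

Lemma alpha_far a b c d f : [/\ a != b, a != c, a != d,
  b != c & b != d] -> c != d ->
  alpha a b (alpha c d f) = alpha c d (alpha a b f).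
Proof.
case=> ab ac ad bc bd cd.
have [PM QM] : {morph alpha a b : f g / f * g} /\ {morph alpha c d : f g / f *
  g}.
  by split; [case: (alphaP a b)|case: (alphaP c d)].
apply: (substitution_ext (substitution_comp (alphaP a b) (alphaP c d))
                         (substitution_comp (alphaP c d) (alphaP a b))) => x /=.
have [ca da cb db] : [/\ c != a, d != a, c != b & d != b].
  by split; rewrite eq_sym.
have [->|xa] := eqVneq x a.
  by rewrite (alpha_x ac ad) !alpha_a (alpha_x bc bd).
have [->|xb] := eqVneq x b.
  rewrite (alpha_x bc bd) !alpha_b // !QM alpha_inv_x // !alpha_x //.
have [->|xc] := eqVneq x c.
  by rewrite (alpha_x ca cb) !alpha_a alpha_x.
have [->|xd] := eqVneq x d.
  by rewrite (alpha_x da db) !alpha_b // !PM alpha_inv_x // !alpha_x.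
by rewrite !alpha_x.
Qed.

Lemma alpha_braid a b c f : a != b -> a != c -> b != c ->
  alpha a b (alpha b c (alpha a b f)) = alpha b c (alpha a b (alpha b c f)).
Proof.
move=> ab ac bc; have [ba ca cb] : [/\ b != a, c != a & c != b] by split;
  rewrite eq_sym.
have [PM QM] : {morph alpha a b : f g / f * g} /\ {morph alpha b c : f g / f *
  g}.
  by split; [case: (alphaP a b)|case: (alphaP b c)].
have sP := alphaP a b; have sQ := alphaP b c.
apply: (substitution_ext (substitution_comp sP (substitution_comp sQ sP))
                         (substitution_comp sQ (substitution_comp sP sQ))) => x
                           /=.
have [->|xa] := eqVneq x a.
  by rewrite alpha_a alpha_a (alpha_x ca cb) (alpha_x ab ac) alpha_a alpha_a.
have [->|xb] := eqVneq x b.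
  rewrite (alpha_b ab) !QM (alpha_x ab ac) alpha_inv_a // alpha_a !PM.
  rewrite alpha_inv_x // !(alpha_x ca cb) !alpha_a.
  by rewrite (alpha_b bc).
have [->|xc] := eqVneq x c.
  rewrite (alpha_x ca cb) (alpha_b bc) !PM (alpha_b ab) (alpha_x ca cb).
  rewrite alpha_inv_x // !QM !alpha_a (alpha_b bc) alpha_inv_b // alpha_inv_a
    //.
  rewrite (alpha_x ab ac) !mulrA -(mulrA _ (sunit c) (sinv c)) sunitK mulr1.
  by rewrite -(mulrA _ (sunit c) (sinv c)) sunitK mulr1.
by rewrite !alpha_x.
Qed.

End Artin.

(** * Crossings of braids with a marked strand, acting on power series *)

Section Operators.
Variable m : nat.
Local Notation series := (series 'I_m).
Implicit Types (f g : series) (i j k p : nat) (x y : 'I_m).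

(** Braid generators are indexed by natural numbers and letters by ordinals;
    operators with an index out of range are the identity. *)
Definition with1 (F : 'I_m -> series -> series) i f : series :=
  if insub i is Some x then F x f else f.
Definition with2 (F : 'I_m -> 'I_m -> series -> series) i f : series :=
  with1 (fun x => with1 (F x) i.+1) i f.

Definition uop := with1 (fun x f => sunit x * f).
Definition vop := with1 (fun x f => (sinv x : series) * f).
Definition aop := with2 (fun x y => alpha x y).
Definition bop := with2 (fun x y => beta x y).

Lemma with1E F i f (im : (i < m)%N) : with1 F i f = F (Ordinal im) f.
Proof. by rewrite /with1 insubT. Qed.

Lemma with2E F i f (im : (i < m)%N) (im' : (i.+1 < m)%N) :
  with2 F i f = F (Ordinal im) (Ordinal im') f.
Proof. by rewrite /with2 (with1E _ _ im) (with1E _ _ im'). Qed.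

Lemma with1_out F i f : (m <= i)%N -> with1 F i f = f.
Proof. by move=> im; rewrite /with1 insubF // ltnNge im. Qed.

Lemma with2_out F i f : (m <= i.+1)%N -> with2 F i f = f.
Proof.
move=> im; rewrite /with2; case: (ltnP i m) => im'; last by rewrite with1_out.
by rewrite (with1E _ _ im') with1_out.
Qed.

Let succ_neq i (h : (i < m)%N) (h' : (i.+1 < m)%N) : Ordinal h != Ordinal h'.
Proof. by rewrite -val_eqE /= ltn_eqF. Qed.

Lemma uopK i : cancel (uop i) (vop i).
Proof.
move=> f; case: (ltnP i m) => im; rewrite /vop /uop; last by rewrite !with1_out.
by rewrite !(with1E _ _ im) mulrA sinvK mul1r.
Qed.

Lemma vopK i : cancel (vop i) (uop i).
Proof.
move=> f; case: (ltnP i m) => im; rewrite /vop /uop; last by rewrite !with1_out.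
by rewrite !(with1E _ _ im) mulrA sunitK mul1r.
Qed.

Lemma aopK i : cancel (aop i) (bop i).
Proof.
move=> f; case: (ltnP i.+1 m) => im; rewrite /aop /bop;
  last by rewrite !with2_out.
by rewrite !(with2E _ _ (ltnW im) im) alphaK.
Qed.

Lemma bopK i : cancel (bop i) (aop i).
Proof.
move=> f; case: (ltnP i.+1 m) => im; rewrite /aop /bop;
  last by rewrite !with2_out.
by rewrite !(with2E _ _ (ltnW im) im) betaK.
Qed.

Lemma aop_far i j f : (i.+1 < j)%N -> aop i (aop j f) = aop j (aop i f).
Proof.
move=> ij; rewrite /aop; case: (ltnP i.+1 m) => im;
  last by rewrite !(with2_out _ _ im).
case: (ltnP j.+1 m) => jm; last by rewrite !(with2_out _ _ jm).
rewrite !(with2E _ _ (ltnW im) im) !(with2E _ _ (ltnW jm) jm).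
by apply: alpha_far; [split|]; rewrite -val_eqE /=; lia.
Qed.

Lemma aop_braid i f : (i.+2 < m)%N ->
  aop i (aop i.+1 (aop i f)) = aop i.+1 (aop i (aop i.+1 f)).
Proof.
move=> im2; have im1 := ltnW im2; have im0 := ltnW im1.
rewrite /aop !(with2E _ _ im0 im1) !(with2E _ _ im1 im2).
by apply: alpha_braid; rewrite -val_eqE /=; lia.
Qed.

Lemma aop_uop_far i j f : j != i -> j != i.+1 ->
  aop i (uop j f) = uop j (aop i f).
Proof.
move=> ji jSi; rewrite /aop /uop.
case: (ltnP i.+1 m) => im; last by rewrite !(with2_out _ _ im).
case: (ltnP j m) => jm; last by rewrite !(with1_out _ _ jm).
rewrite !(with2E _ _ (ltnW im) im) !(with1E _ _ jm).
exact: alpha_mul_x.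
Qed.

Lemma aop_uop i f : (i.+1 < m)%N -> aop i (uop i f) = uop i.+1 (aop i f).
Proof.
move=> im; rewrite /aop /uop !(with2E _ _ (ltnW im) im) (with1E _ _ im).
by rewrite (with1E _ _ (ltnW im)) alpha_mul_a.
Qed.

Lemma aop_uop2 i f : (i.+1 < m)%N ->
  aop i (uop i (uop i.+1 f)) = uop i (uop i.+1 (aop i f)).
Proof.
move=> im; rewrite /aop /uop !(with2E _ _ (ltnW im) im) !(with1E _ _ im).
by rewrite !(with1E _ _ (ltnW im)) alpha_mul_ab.
Qed.

(** The crossing (i, b) when the marked strand is in position p. A crossing of
    two other strands acts by Artin's automorphism for their numbers among the
    unmarked strands. A positive crossing multiplies by 1 + x if it moves the
    marked strand to the right across the strand x, and is the identity if it
    moves it to the left; negative crossings are inverse to these. *)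
Definition step i (b : bool) p f : series :=
  if p == i then (if b then f else uop i f)
  else if p == i.+1 then (if b then vop i f else f)
  else if b then bop (unbump p i) f else aop (unbump p i) f.

Arguments step : simpl never.

Let st_lt p i f : (p < i)%N -> step i false p f = aop i.-1 f.
Proof. by move=> pi; rewrite /step /unbump pi subn1 ltn_eqF // ltn_eqF //;
  lia. Qed.
Let st_gt p i f : (i.+1 < p)%N -> step i false p f = aop i f.
Proof.
move=> pi; rewrite /step /unbump gtn_eqF ?(ltnW pi) // gtn_eqF //=.
by rewrite ltnNge (ltnW (ltnW pi)) subn0.
Qed.
Let st_lo i f : step i false i f = uop i f. Proof. by rewrite /step eqxx. Qed.
Let st_hi i f : step i false i.+1 f = f. Proof.
  by rewrite /step gtn_eqF // eqxx. Qed.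
Let cr_lt i p : (p < i)%N -> crossing i p = p.
Proof. by move=> pi; rewrite /crossing !ltn_eqF //; lia. Qed.
Let cr_gt i p : (i.+1 < p)%N -> crossing i p = p.
Proof. by move=> pi; rewrite /crossing !gtn_eqF //; lia. Qed.
Let cr_lo i : crossing i i = i.+1. Proof. by rewrite /crossing eqxx. Qed.
Let cr_hi i : crossing i i.+1 = i. Proof.
  by rewrite /crossing eqxx gtn_eqF. Qed.

Lemma step_cancel i b p f : step i b p (step i (~~ b) (crossing i p) f) = f.
Proof.
rewrite /step /crossing; have [_|pi] := eqVneq p i.
  by rewrite gtn_eqF // eqxx; case: b => //=; exact: vopK.
have [_|pSi] := eqVneq p i.+1.
  by rewrite eqxx; case: b => //=; exact: uopK.
rewrite (negPf pi) (negPf pSi); case: b => /=; [exact: aopK|exact: bopK].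
Qed.

Arguments crossing : simpl never.
Fixpoint rep (w : word 'I_m) p f : series :=
  if w is (i, b) :: w' then step i b p (rep w' (crossing i p) f) else f.

Lemma rep_cat u v p f : rep (u ++ v) p f = rep u p (rep v (track (n := m.+1) u
  p) f).
Proof. by elim: u p => [|[i b] u IH] p //=; rewrite IH. Qed.

Local Ltac cross := repeat first
  [ rewrite cr_lo | rewrite cr_hi | rewrite st_lo | rewrite st_hi
  | match goal with
    | |- context [crossing ?i ?p] =>
      first [ rewrite (@cr_lt i p); [|by lia] | rewrite (@cr_gt i p);
        [|by lia] ]
    | |- context [step ?i false ?p ?f] =>
      first [ rewrite (@st_lt p i f); [|by lia] | rewrite (@st_gt p i f);
        [|by lia] ]
    end ].

(** Each relation is checked for each position p of the marked strand. When the
    marked strand takes part in a Yang-Baxter relation, this is trivial or one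
    of the two rules of Artin's automorphism: it maps one loop to the other
    ([aop_uop]), and preserves the product of the two loops ([aop_uop2]). *)
Lemma rep_eqv (u v : word 'I_m) : word_eqv (@braid_relation m.+1) u v ->
  forall p f, (p < m.+1)%N -> rep u p f = rep v p f.
Proof.
elim=> {u v} [_ _ [i j ij|i j ji]|i b|u u' v v' uu' IHu vv' IHv|//|u v _ IH|
              u v w _ IHu _ IHv] p f pn.
- rewrite /=; have := ltn_ord j.
  move: {i j}(nat_of_ord i) (nat_of_ord j) ij => i j ij jm.
  case: (ltngtP p i) => [pi|ip|->]; last by cross; apply/esym/aop_uop_far; lia.
    by cross; apply: aop_far; lia.
  case: (ltngtP p i.+1) => [|{}ip|->]; [by lia| |by cross].
  case: (ltngtP p j) => [pj|jp|->]; last by cross; apply: aop_uop_far; lia.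
    by cross; apply: aop_far; lia.
  case: (ltngtP p j.+1) => [|{}jp|->]; [by lia| |by cross].
  by cross; apply: aop_far; lia.
- rewrite /=.
  have := ltn_ord j; rewrite ji; move: {i j ji}(nat_of_ord i) => i /= jn.
  case: (ltngtP p i) => [pi|ip|->]; last by cross; apply/esym/aop_uop2.
    by cross; case: i pi jn => // i _ jn; apply: aop_braid; lia.
  case: (ltngtP p i.+1) => [|{}ip|->]; [by lia| |by cross; apply: aop_uop].
  case: (ltngtP p i.+2) => [|{}ip|->]; [by lia| |by cross].
  by cross; apply: aop_braid; lia.
- by rewrite /= step_cancel.
- rewrite !rep_cat IHu // IHv; last exact: (track_lt (n := m.+1)).
  by have [-> _] := remove_word_eqv uu' pn.
- by rewrite IH.
- by rewrite IHu // IHv.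
Qed.

End Operators.

(** * The representation of the pure braid group and its lower central series *)

Lemma crossing_bump p i j : p <> i -> p <> i.+1 ->
  crossing i (bump p j) = bump (crossing i p) (crossing (unbump p i) j).
Proof.
move=> pi pSi; rewrite /crossing; case: (p =P i) => // _;
  case: (p =P i.+1) => // _.
rewrite /unbump; case: (ltnP p i) => pi'; rewrite ?subn1 ?subn0 /bump.
  by case: (leqP p j) => pj; rewrite ?add1n ?add0n;
    repeat case: eqP => ?; case: leqP => ?; lia.
by case: (leqP p j) => pj; rewrite ?add1n ?add0n;
  repeat case: eqP => ?; case: leqP => ?; lia.
Qed.

Section Representation.
Variable m : nat.
Local Notation series := (series 'I_m).
Local Notation B := (braid m.+1).
Implicit Types (f : series) (i j k p : nat) (g h : B).

Lemma aopD i : {morph @aop m i : f f' / f + f'}.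
Proof.
move=> f f'; case: (ltnP i.+1 m) => im; rewrite /aop;
  last by rewrite !with2_out.
by rewrite !(with2E _ _ (ltnW im) im);
  case: (alphaP (Ordinal (ltnW im)) (Ordinal im)).
Qed.
Lemma bopD i : {morph @bop m i : f f' / f + f'}.
Proof.
move=> f f'; case: (ltnP i.+1 m) => im; rewrite /bop;
  last by rewrite !with2_out.
by rewrite !(with2E _ _ (ltnW im) im);
  case: (betaP (Ordinal (ltnW im)) (Ordinal im)).
Qed.
Lemma uopD i : {morph @uop m i : f f' / f + f'}.
Proof.
move=> f f'; case: (ltnP i m) => im; rewrite /uop; last by rewrite !with1_out.
by rewrite !(with1E _ _ im) mulrDr.
Qed.
Lemma vopD i : {morph @vop m i : f f' / f + f'}.
Proof.
move=> f f'; case: (ltnP i m) => im; rewrite /vop; last by rewrite !with1_out.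
by rewrite !(with1E _ _ im) mulrDr.
Qed.

Lemma repD (w : word 'I_m) p : {morph rep w p : f f' / f + f'}.
Proof.
elim: w p => [|[i b] w IH] p f f' //=; rewrite IH /step.
by case: ifP => _; [case: b|case: ifP => _; case: b];
  rewrite ?uopD ?vopD ?aopD ?bopD.
Qed.

(** To leading order, a crossing permutes the unmarked strands: the permutation
    pi is that of the crossing itself, after renumbering without the marked
    strand. *)
Lemma step_lead (i : 'I_m) b p : (p < m.+1)%N -> exists pi : 'I_m -> 'I_m,
  (forall j : 'I_m, crossing i (bump p j) = bump (crossing i p) (pi j)) /\
  (forall k f v, sord k f -> (size v <= k)%N -> step i b p f v = f (map pi v)).
Proof.
move=> pm; have im := ltn_ord i.
case: (boolP ((p == i) || (p == i.+1))) => pi.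
  exists id; split=> [j|k f v fk vk].
    rewrite /crossing /bump; case/orP: pi => /eqP ->;
      repeat (case: eqP => ? ; try lia).
  rewrite map_id.
  have lead (c : series) : c [::] = 1 -> (c * f) v = f v.
    by move=> c1; rewrite smul_lead ?c1 ?mul1r // => u uv; apply: fk; lia.
  rewrite /step; case: ifP => [_|/negbT pi']; last rewrite (negPf pi') /= in pi.
    by case: b => //; rewrite /uop (with1E _ _ im) lead //.
  by rewrite pi; case: b => //; rewrite /vop (with1E _ _ im) lead.
have [pi1 pi2] : p <> i /\ p <> i.+1 by move: pi;
  rewrite negb_or => /andP[/eqP ? /eqP ?].
have um : ((unbump p i).+1 < m)%N by rewrite /unbump; case: ltngtP => ?; lia.
set x := Ordinal (ltnW um); set y := Ordinal um.
have xy : x != y by rewrite -val_eqE /= ltn_eqF.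
exists (swap x y); split=> [j|k f v fk vk].
  rewrite /swap -!val_eqE /=.
  have E : val (if val j == unbump p i then y else if val j == (unbump p i).+1
    then x else j)
    = crossing (unbump p i) j.
    by rewrite /crossing; do 2?case: ifP.
  by rewrite crossing_bump // -E.
rewrite /step; case: eqP => // _; case: eqP => // _.
case: b; rewrite /aop /bop (with2E _ _ (ltnW um) um).
  exact: (beta_lead xy fk vk).
exact: (alpha_lead xy fk vk).
Qed.

Lemma rep_lead (w : word 'I_m) p : (p < m.+1)%N -> exists pi : 'I_m -> 'I_m,
  (forall j : 'I_m, track (n := m.+1) w (bump p j) = bump (track (n := m.+1) w
    p) (pi j)) /\
  (forall k f v, sord k f -> (size v <= k)%N -> rep w p f v = f (map pi v)).
Proof.
elim: w p => [|[i b] w IH] p pm /=.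
  by exists id; split=> // k f v _ _; rewrite map_id.
have [pi1 [h1 l1]] := step_lead i b pm.
have pm' : (crossing i p < m.+1)%N by exact: (crossing_lt (n := m.+1)).
have [pi2 [h2 l2]] := IH _ pm'.
exists (pi2 \o pi1); split=> [j|k f v fk vk]; first by rewrite h1 h2.
rewrite (l1 k) // => [|u uk]; last by rewrite (l2 k) ?fk ?size_map // ltnW.
by rewrite (l2 k) ?size_map // -map_comp.
Qed.

Definition repg p g f : series := rep (word_repr g) p f.
Definition Rep g f : series := repg m g f.

Lemma repg_class (w : word 'I_m) p f : (p < m.+1)%N ->
  repg p (word_class _ w) f = rep w p f.
Proof. by move=> pm; apply: rep_eqv => //; exact: word_repr_eqv. Qed.

Lemma repgM p g h f : (p < m.+1)%N ->
  repg p (g * h)%g f = repg p g (repg (endpoint g p) h f).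
Proof.
move=> pm; rewrite -{1}(word_reprK g) -{1}(word_reprK h) -word_class_cat.
by rewrite repg_class // rep_cat.
Qed.

Lemma repg1 p f : (p < m.+1)%N -> repg p 1%g f = f.
Proof. by move=> pm; rewrite -[1%g]/(word_class _ [::]) repg_class. Qed.

Lemma RepD g : {morph Rep g : f f' / f + f'}. Proof. exact: repD. Qed.

Lemma RepM g h f : pure g -> Rep (g * h)%g f = Rep g (Rep h f).
Proof. by move=> pg; rewrite /Rep repgM // pg. Qed.

Lemma Rep1 f : Rep 1%g f = f. Proof. exact: repg1. Qed.

Lemma RepK g : pure g -> cancel (Rep g) (Rep g^-1%g).
Proof.
move=> pg f; rewrite -RepM ?mulVg ?Rep1 //.
by have [_ _ PV] := pure_subgroup m.+1; exact: PV.
Qed.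

Lemma RepVK g : pure g -> cancel (Rep g^-1%g) (Rep g).
Proof. by move=> pg f; rewrite -RepM // mulgV Rep1. Qed.

(** A pure braid permutes nothing, so it fixes the lowest terms. *)
Lemma Rep_lead g k f v : pure g -> sord k f -> (size v <= k)%N ->
  Rep g f v = f v.
Proof.
move=> pg fk vk; have [pi [hpi lpi]] := rep_lead (word_repr g) (ltnSn m).
rewrite /Rep /repg (lpi k) //; congr (f _); rewrite -[RHS]map_id.
apply: eq_map => j; apply: val_inj => /=.
have bm (i : 'I_m) : bump m i = i by rewrite /bump leqNgt ltn_ord.
have := hpi j; rewrite -/(endpoint g m) pg // !bm => <-.
by rewrite -/(endpoint g j) pg // ltnW // ltnS.
Qed.

Lemma Rep_sord g k f : pure g -> sord k f -> sord k (Rep g f).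
Proof. by move=> pg fk v vk; rewrite (Rep_lead (k := k)) ?fk // ltnW. Qed.

Lemma Rep_dev g k f : pure g -> sord k f -> sord k.+1 (Rep g f - f).
Proof.
by move=> pg fk v vk; rewrite seriesB (Rep_lead (k := k)) // subrr.
Qed.

Lemma Rep_comm g h f : pure g -> pure h ->
  Rep [~ g, h]%g f - f = Rep (h * g)^-1%g (Rep g (Rep h f) - Rep h (Rep g f)).
Proof.
move=> pg ph; have [_ PM PV] := pure_subgroup m.+1.
have phg : pure (h * g)%g by exact: PM.
have -> : [~ g, h]%g = ((h * g)^-1 * (g * h))%g.
  by rewrite /commg /conjg invgM !mulgA.
rewrite RepM ?(morphDB (@RepD _)); last exact: PV.
rewrite -(RepM g f ph) (RepK phg) RepM //.
Qed.

(** The commutator of two operators is that of their differences with the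
    identity. *)
Lemma Rep_swap g h f : Rep g (Rep h f) - Rep h (Rep g f) =
  (Rep g (Rep h f - f) - (Rep h f - f)) - (Rep h (Rep g f - f) - (Rep g f - f)).
Proof.
rewrite !(morphDB (@RepD _)); move: (Rep g (Rep h f)) (Rep h (Rep g f)) => a b.
move: (Rep g f) (Rep h f) => c d.
by apply: funext => w; rewrite !seriesB; lia.
Qed.

Local Notation P := (@pure m.+1).

Lemma lcs_pure k g : lcs P k g -> pure g.
Proof. by move=> kg; exact: (lcs_sub0 (pure_subgroup m.+1) kg). Qed.

(** Elements of the (k+1)-st term of the lower central series act trivially up
    to terms of degree higher by k + 1: a pure braid raises degrees by one by
    [Rep_lead], and by [Rep_comm] and [Rep_swap] the shifts add up in group
    commutators. *)
Lemma lcs_Rep k g : lcs P k g ->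
  forall r f, sord r f -> sord (r + k.+1) (Rep g f - f).
Proof.
have [P1 PM PV] := pure_subgroup m.+1.
elim: k g => [|k IH] g kg r f fr.
  by rewrite addn1; apply: Rep_dev.
pose D : set B := [set g | pure g /\
  forall r f, sord r f -> sord (r + k.+2) (Rep g f - f)].
suff : D g by case=> _; apply.
apply: (kg : generated _ _); split; last first.
  move=> _ [x [y [kx py ->]]]; have px := lcs_pure kx.
  split=> [|s h hs]; first exact: subgroup_comm (pure_subgroup m.+1) px py.
  rewrite Rep_comm //; apply: Rep_sord; first by apply: PV; exact: PM.
  rewrite Rep_swap !addnS -addnS; apply: sordB.
    by rewrite -addSn; apply: IH => //; exact: Rep_dev.
  by apply: Rep_dev => //; exact: IH.
split=> [|x y [px Dx] [py Dy]|x [px Dx]].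
- by split=> // s h hs w _; rewrite Rep1 subrr.
- split=> [|s h hs]; first exact: PM.
  rewrite RepM // -(subrKA (Rep y h)); apply: sordD; last exact: Dy.
  by apply: Dx; exact: Rep_sord.
- split=> [|s h hs]; first exact: PV.
  rewrite -{2}(RepVK px h) -opprB; apply: sordN; apply: Dx.
  by apply: Rep_sord => //; exact: PV.
Qed.

End Representation.

(** * Leading terms of iterated commutators *)

Section MonoInd.
Variable X : Type.
Inductive mono_span : flie X -> Prop :=
| MonoGen W : mono_span (lie_eval (@fgen X) W)
| MonoZero : mono_span 0
| MonoOpp u of mono_span u : mono_span (- u)
| MonoAdd u v of mono_span u & mono_span v : mono_span (u + v).

(** Reading off leading terms is only known to be additive at first. This
    induction computes it without a case for brackets. *)
Lemma flie_mono_span u : mono_span u.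
Proof.
elim/flie_ind: u => [x||u IH|u v IHu IHv|u v IHu IHv].
- exact: (MonoGen (Letter x)).
- exact: MonoZero.
- exact: MonoOpp.
- exact: MonoAdd.
- elim: IHu => {u} [U||u _ IH|u u' _ IH _ IH'].
  + elim: IHv => {v} [V||v _ IH|v v' _ IH _ IH'].
    * exact: (MonoGen (Bracket U V)).
    * by rewrite lieb0r; exact: MonoZero.
    * by rewrite liebNr; exact: MonoOpp.
    * by rewrite liebDr; exact: MonoAdd.
  + by rewrite lieb0l; exact: MonoZero.
  + by rewrite liebNl; exact: MonoOpp.
  + by rewrite liebDl; exact: MonoAdd.
Qed.
End MonoInd.

(** One less than the number of letters, since the terms of the lower central
    series are numbered from 0. *)
Fixpoint mdeg (X : Type) (W : lie_monomial X) : nat :=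
  if W is Bracket U V then (mdeg U + mdeg V).+1 else 0%N.

Lemma iota_homog (X : eqType) (W : lie_monomial X) w : size w <> (mdeg W).+1 ->
  iota_lie (feval W) w = 0.
Proof.
elim: W w => [x|U IHU V IHV] w /= hw.
  by rewrite iota_gen /sletter /sword; case: eqP hw => // -> [].
rewrite /feval /= (lie_hom_br (@iota_hom X)) series_lieb seriesB -!/(feval _).
have prod (f g : series X) a b v : (forall u, size u <> a -> f u = 0) ->
    (forall u, size u <> b -> g u = 0) -> size v <> (a + b)%N -> (f * g) v = 0.
  move=> hf hg; elim: v f a hf => [|y v IH] f a hf hv.
    rewrite smul_nil; case: a hf hv => [|a] hf hv; last by rewrite hf ?mul0r.
    by rewrite hg ?mulr0.
  rewrite smul_cons; case: a hf hv => [|a] hf hv.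
    rewrite (hg (y :: v)) ?mulr0 ?add0r //.
    have -> : sder y f = 0 by apply: funext => u; rewrite /sder hf.
    by rewrite mul0r.
  rewrite (hf [::]) // mul0r add0r; apply: (IH _ a).
    by move=> u ua; apply: hf => -[].
  by move=> va; apply: hv; rewrite /= va.
rewrite (prod _ _ _ _ _ IHU IHV) ?(prod _ _ _ _ _ IHV IHU) ?subrr //;
  by move=> E; apply: hw; rewrite E; lia.
Qed.

Lemma mem_generated (G : groupType) (S : set G) x : S x -> generated S x.
Proof. exact: sub_gen_smallest. Qed.

Section Magnus.
Variable m : nat.
Local Notation series := (series 'I_m).
Local Notation B := (braid m.+1).
Local Notation P := (@pure m.+1).
Local Notation F := (lcs_nseries (pure_subgroup m.+1)).
Implicit Types (f : series) (i j k p : nat) (g h : B) (W : lie_monomial 'I_m).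

Lemma repg_sigma i p f : (i < m)%N -> (p < m.+1)%N ->
  repg p (sigma m.+1 i : B) f = step i false p f.
Proof. by move=> im pm; rewrite /sigma insubT repg_class. Qed.

Lemma endpoint_sigma i p : (i < m)%N -> (p < m.+1)%N ->
  endpoint (sigma m.+1 i : B) p = crossing i p.
Proof. by move=> im pm; rewrite /sigma insubT endpoint_class. Qed.

Definition tail_braid j r : B :=
  (\prod_(k <- rev (iota j.+1 r)) sigma m.+1 k)%g.

Lemma tail_braidS j r : tail_braid j r.+1 = (sigma m.+1 (j.+1 + r) * tail_braid
  j r)%g.
Proof. by rewrite /tail_braid -[r.+1]addn1 iotaD rev_cat big_cat big_seq1. Qed.

(** The marked strand only moves to the left by positive crossings, which do
    nothing. *)
Lemma tail_braid_rep j r f : (j.+1 + r <= m)%N ->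
  endpoint (tail_braid j r) (j.+1 + r) = j.+1 /\ repg (j.+1 + r) (tail_braid j
    r) f = f.
Proof.
elim: r => [|r IH] jr.
  by rewrite addn0 /tail_braid /= big_nil repg1 ?endpoint1; try lia.
have [|IHe IHr] := IH; first lia.
have cr : crossing (j.+1 + r) (j.+1 + r.+1) = (j.+1 + r)%N.
  by rewrite /crossing addnS eqxx gtn_eqF.
have es : endpoint (sigma m.+1 (j.+1 + r) : B) (j.+1 + r.+1) = (j.+1 + r)%N.
  by rewrite endpoint_sigma ?cr //; lia.
rewrite tail_braidS endpointM ?repgM ?es; try lia.
rewrite IHe IHr repg_sigma; try lia; split=> //.
by rewrite /step addnS eqxx gtn_eqF.
Qed.

(** The marked last strand moves to position j + 1, makes a full turn around
    the strand j, and goes back the same way. Only the turn acts. *)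
Lemma Rep_pure_gen j (jm : (j < m)%N) f :
  Rep (pure_gen m.+1 j m) f = sunit (Ordinal jm) * f.
Proof.
rewrite /pure_gen /Rep -/(tail_braid j (m - j.+1)); set c := tail_braid _ _.
have jE : (j.+1 + (m - j.+1) = m)%N by lia.
have [|ec _] := @tail_braid_rep j (m - j.+1) f; first lia.
have rc f' : repg m c f' = f'.
  by have [|_] := @tail_braid_rep j (m - j.+1) f'; rewrite jE.
rewrite jE -/c in ec.
have es p : (p < m.+1)%N -> endpoint (sigma m.+1 j : B) p = crossing j p.
  exact: endpoint_sigma.
have rcV f' : repg j.+1 c^-1%g f' = f'.
  by rewrite -[LHS]rc -ec -repgM // mulgV repg1.
have lj : (j.+1 < m.+1)%N by [].
have e1 : crossing j j.+1 = j by rewrite /crossing eqxx gtn_eqF.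
have e2 : crossing j j = j.+1 by rewrite /crossing eqxx.
rewrite -mulgA repgM // rc ec expgS expg1 -mulgA repgM // es // e1.
rewrite repgM ?es // ?e2; last by rewrite ltnW.
rewrite rcV !repg_sigma //.
- by rewrite /step eqxx gtn_eqF // eqxx /uop (with1E _ _ jm).
- by rewrite ltnW.
- by rewrite ltnW.
Qed.

Definition mult_set : set B := [set g | pure g /\ forall f,
  Rep g f = Rep g 1 * f].

Lemma mult_set_subgroup : subgroup mult_set.
Proof.
have [P1 PM PV] := pure_subgroup m.+1.
split=> [|x y [px Mx] [py My]|x [px Mx]].
- by split=> [|f]; [exact: P1|rewrite !Rep1 mul1r].
- split=> [|f]; first exact: PM.
  by rewrite !RepM // (Mx (Rep y f)) (Mx (Rep y 1)) (My f) mulrA.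
- split=> [|f]; first exact: PV.
  apply: (can_inj (RepK px)); rewrite (RepVK px) Mx mulrA -Mx.
  by rewrite (RepVK px) mul1r.
Qed.

Definition kernel_gens : set B :=
  [set g | exists2 j, (j < m)%N & g = pure_gen m.+1 j m].
(** By [remove_kernel_last] and [lcs_kernel], these are the pure braids that
    become trivial when the last strand is removed. *)
Definition kernel_group : set B := generated kernel_gens.

Lemma kernel_mult : kernel_group `<=` mult_set.
Proof.
apply: smallest_sub; first exact: mult_set_subgroup.
move=> _ [j jm ->]; split=> [|f]; first exact: pure_gen_pure.
by rewrite !Rep_pure_gen // mulr1.
Qed.

Fixpoint group_eval W : B :=
  match W with
  | Letter k => pure_gen m.+1 k m
  | Bracket U V => [~ group_eval U, group_eval V]%g
  end.

Lemma group_eval_lcs W : lcs P (mdeg W) (group_eval W).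
Proof.
elim: W => [k|U IHU V IHV] /=; first exact: pure_gen_pure.
exact: (lcs_comm (pure_subgroup m.+1)).
Qed.

Lemma group_eval_kernel W : kernel_group (group_eval W).
Proof.
elim: W => [k|U IHU V IHV] /=.
  by apply: mem_generated; exists (nat_of_ord k).
exact: subgroup_comm (@generated_subgroup _ kernel_gens) IHU IHV.
Qed.

Lemma eval_monomialE W : eval_monomial (n := m.+1) W = hom F (mdeg W)
  (group_eval W).
Proof.
elim: W => [k|U IHU V IHV] //=.
have -> : eval_monomial (n := m.+1) (Bracket U V) =
  lieb (eval_monomial (n := m.+1) U) (eval_monomial (n := m.+1) V) by [].
by rewrite IHU IHV (lieb_hom (F := F)) //; exact: group_eval_lcs.
Qed.

Lemma comm_diff (x y a b : series) : x * y - y * x - (a * b - b * a) =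
  ((x - a) * y + a * (y - b)) - ((y - b) * x + b * (x - a)).
Proof.
rewrite !mulrBl !mulrBr.
move: (x * y) (y * x) (a * b) (b * a) (a * y) (b * x) => s1 s2 s3 s4 s5 s6.
by apply: funext => w; rewrite !(seriesD, seriesN); lia.
Qed.

(** If g and h act on 1 as 1 + x and 1 + y, then their commutator acts on 1 as
    1 + (x y - y x), up to terms of higher degree: the leading term of a group
    commutator is the Lie bracket of the leading terms. *)
Lemma group_eval_lead W :
  sord (mdeg W).+2 (Rep (group_eval W) 1 - 1 - iota_lie (feval W)).
Proof.
elim: W => [k|U IHU V IHV] /=.
  have -> : Rep (pure_gen m.+1 k m) 1 = sunit k.
    rewrite (Rep_pure_gen (ltn_ord k)) mulr1; congr sunit; exact: val_inj.
  by move=> w _; rewrite iota_gen /sunit addrAC addrK subrr.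
set g := group_eval U in IHU *; set h := group_eval V in IHV *.
have [[pg Mg] [ph Mh]] := conj (kernel_mult (group_eval_kernel U)) (kernel_mult
  (group_eval_kernel V)).
rewrite -/g in pg Mg; rewrite -/h in ph Mh.
set x := Rep g 1 - 1 in IHU; set y := Rep h 1 - 1 in IHV.
have gE : Rep g 1 = 1 + x by rewrite /x addrC subrK.
have hE : Rep h 1 = 1 + y by rewrite /y addrC subrK.
have DE : Rep g (Rep h 1) - Rep h (Rep g 1) = x * y - y * x.
  rewrite Mg [Rep h (Rep g 1)]Mh gE hE !mulrDl !mulrDr !mul1r !mulr1.
  by move: (x * y) (y * x) => a b; apply: funext => w;
     rewrite !(seriesD, seriesN); lia.
have xo : sord (mdeg U).+1 x.
  by have := lcs_Rep (group_eval_lcs U) (r := 0) (f := 1); rewrite add0n; apply.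
have yo : sord (mdeg V).+1 y.
  by have := lcs_Rep (group_eval_lcs V) (r := 0) (f := 1); rewrite add0n; apply.
have XE : sord (mdeg U + mdeg V).+3
    (x * y - y * x - iota_lie (feval (Bracket U V))).
  rewrite /feval /= (lie_hom_br (@iota_hom _)) -!/(feval _) series_lieb.
  have [iu iv] : sord (mdeg U).+1 (iota_lie (feval U)) /\ sord (mdeg V).+1
    (iota_lie (feval V)).
    by split=> w wk; apply: iota_homog => E; rewrite E ltnn in wk.
  set a := iota_lie _ in IHU iu *; set b := iota_lie _ in IHV iv *.
  have -> : x * y - y * x - (a * b - b * a) =
      ((x - a) * y + a * (y - b)) - ((y - b) * x + b * (x - a)).
    exact: comm_diff.
  apply: sordB; apply: sordD.
  - by apply: (sord_le (sord_mul IHU yo)); lia.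
  - by apply: (sord_le (sord_mul iu IHV)); lia.
  - by apply: (sord_le (sord_mul IHV xo)); lia.
  - by apply: (sord_le (sord_mul iv IHU)); lia.
have [_ PM PV] := pure_subgroup m.+1.
rewrite Rep_comm // DE.
set D := x * y - y * x in XE *.
have Do : sord (mdeg U + mdeg V).+2 D.
  by apply: sordB; [apply: (sord_le (sord_mul xo yo))|apply: (sord_le (sord_mul
    yo xo))]; lia.
set k := (h * g)^-1%g; have pk : pure k by apply: PV; exact: PM.
have -> : Rep k D - iota_lie (feval (Bracket U V)) =
  (Rep k D - D) + (D - iota_lie (feval (Bracket U V))) by rewrite addrA subrK.
by apply: sordD => //; exact: Rep_dev.
Qed.

End Magnus.

(** * The Lie ring generated by the classes of the last strand is free *)

Section Detect.
Variable m : nat.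
Local Notation series := (series 'I_m).
Local Notation B := (braid m.+1).
Local Notation P := (@pure m.+1).
Local Notation F := (lcs_nseries (pure_subgroup m.+1)).
Implicit Types (f : series) (g h x y : B) (W : lie_monomial 'I_m) (k : nat).

Lemma Rep1_mod k x y w : lcs P k x -> lcs P k.+1 (x^-1 * y)%g ->
  (size w <= k.+1)%N -> Rep x 1 w = Rep y 1 w.
Proof.
move=> kx xy wk; have px := lcs_pure kx.
rewrite -[y](mulVKg x) RepM // -(subrK 1 (Rep (x^-1 * y)%g 1)) RepD seriesD.
have d : sord k.+2 (Rep (x^-1 * y)%g 1 - 1).
  by have := lcs_Rep xy (r := 0) (f := 1); rewrite add0n; apply.
by rewrite (Rep_sord px d) ?add0r.
Qed.

Lemma Rep1_mul k x y w : lcs P k x -> lcs P k y -> size w = k.+1 ->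
  Rep (x * y)%g 1 w = Rep x 1 w + Rep y 1 w.
Proof.
move=> kx ky wk; have px := lcs_pure kx.
rewrite RepM // -[in LHS](subrK 1 (Rep y 1)) RepD seriesD addrC; congr (_ + _).
have d : sord k.+1 (Rep y 1 - 1).
  by have := lcs_Rep ky (r := 0) (f := 1); rewrite add0n; apply.
rewrite (Rep_lead px d) ?wk // seriesB series1.
by case: w wk => // a w _; rewrite subr0.
Qed.

(** The part of degree q + 1 of the series is that of the action on 1 of a
    representative of the component of degree q + 1. By [lcs_Rep], another
    representative gives the same. *)
Definition Theta (c : lie_pure m.+1) : series := fun w =>
  if w is [::] then 0 else Rep (lift (c (size w).-1)) 1 w.

Lemma ThetaD : {morph Theta : c d / c + d}.
Proof.
move=> c d; apply: funext => w; rewrite seriesD.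
case: w => [|a w]; rewrite /Theta ?addr0 //=.
have [kc kd] := conj (liftP (c (size w))) (liftP (d (size w))).
rewrite -(Rep1_mul kc kd) //; apply/esym.
have [_ FM _] := ns_subgroup F (size w).
apply: (@Rep1_mod (size w)) => //; first exact: FM.
have := cls_lift (FM _ _ kc kd); rewrite clsM //.
by rewrite !Defs.liftK.
Qed.

Lemma Theta_hom q x w : lcs P q x ->
  Theta (hom F q x) w = if size w == q.+1 then Rep x 1 w else 0.
Proof.
move=> qx; case: w => [|a w] //=; rewrite /Theta /= eqSS.
case: eqP => [wq|_].
  rewrite wq; apply/esym/(Rep1_mod qx); last by rewrite /= wq.
  exact: (@cls_lift _ F q _ qx).
have z : lcs P (size w).+1 (lift (cls F (size w) 1%g))
  by exact: (@Defs.lift0 _ F (size w)).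
have s1 : sord 0 (1 : series) by [].
have := lcs_Rep z s1 (w := a :: w); rewrite add0n seriesB series1 subr0; apply.
exact: ltnSn.
Qed.

Definition Phi : flie 'I_m ->
  lie_pure m.+1 := flift (fun k : 'I_m => lie_gen m.+1 k m).

Lemma Phi_hom : lie_hom Phi. Proof. exact: flift_hom. Qed.

Lemma Phi_feval W : Phi (feval W) = eval_monomial (n := m.+1) W.
Proof. exact: flift_eval. Qed.

Lemma Theta_Phi u : Theta (Phi u) = iota_lie u.
Proof.
elim: (flie_mono_span u) => {u} [W||u _ IH|u v _ IHu _ IHv].
- rewrite -/(feval W) Phi_feval eval_monomialE; apply: funext => w.
  rewrite Theta_hom; last exact: group_eval_lcs.
  case: eqP => [wk|wk]; last by rewrite iota_homog.
  have := @group_eval_lead m W w; rewrite !seriesB wk => /(_ (ltnSn _)) /eqP.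
  by rewrite subr_eq0 => /eqP <-; case: w wk => // a w _; rewrite series1 subr0.
- rewrite (lie_hom0 Phi_hom) (lie_hom0 (@iota_hom _)).
  by rewrite (morphD0 ThetaD).
- by rewrite (lie_homN Phi_hom) (lie_homN (@iota_hom _)) (morphDN ThetaD) IH.
- by rewrite (lie_homD Phi_hom) (lie_homD (@iota_hom _)) ThetaD IHu IHv.
Qed.

(** The composite with [Theta] is the embedding of the free Lie ring in power
    series. *)
Lemma Phi_inj : injective Phi.
Proof.
apply: (lie_hom_inj Phi_hom) => u u0; apply: iota_inj.
by rewrite -Theta_Phi u0 (morphD0 ThetaD).
Qed.

End Detect.

Local Close Scope ring_scope.
Local Open Scope group_scope.

(** * Lower central series of almost direct products *)

Section AlmostDirect.
Variables (G : groupType) (F S : set G).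
Hypotheses (sgF : subgroup F) (sgS : subgroup S).
Hypothesis FS : forall f s, F f -> S s -> lcs F 1 [~ f, s].
Implicit Types (f s x y u v : G) (i j k : nat).

Let F1 k : lcs F k 1. Proof. by have [] := lcs_subgroup sgF k. Qed.
Let FM k x y : lcs F k x -> lcs F k y -> lcs F k (x * y).
Proof. by have [_ h _] := lcs_subgroup sgF k; exact: h. Qed.
Let FV k x : lcs F k x -> lcs F k x^-1.
Proof. by have [_ _ h] := lcs_subgroup sgF k; exact: h. Qed.
Let SM k x y : lcs S k x -> lcs S k y -> lcs S k (x * y).
Proof. by have [_ h _] := lcs_subgroup sgS k; exact: h. Qed.
Let SV k x : lcs S k x -> lcs S k x^-1.
Proof. by have [_ _ h] := lcs_subgroup sgS k; exact: h. Qed.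
Let SV0 x : S x -> S x^-1. Proof. exact: (@SV 0). Qed.

Let FSJ f s : F f -> S s -> F (f ^ s).
Proof.
move=> Ff Ss; have -> : f ^ s = f * [~ f,
  s] by rewrite /commg mulgA mulgV mul1g.
by apply: (@FM 0) => //; apply: (lcs_sub0 sgF (k := 1)); exact: FS.
Qed.

Lemma lcs_act k f s : lcs F k f -> S s -> lcs F k (f ^ s).
Proof.
move=> kf; elim: k f kf s => [|k IH] f kf s Ss; first exact: FSJ.
suff : [set g | forall t, S t -> lcs F k.+1 (g ^ t)] f by apply.
apply: (kf : generated _ _); split; last first.
  move=> _ [x [y [kx Fy ->]]] t St; rewrite conjRg.
  by apply: lcs_comm1 => //; [exact: IH|exact: FSJ].
split=> [t _|x y hx hy t St|x hx t St].
- by rewrite conj1g.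
- by rewrite conjMg; apply: FM; [exact: hx|exact: hy].
- by rewrite conjVg; apply: FV; exact: hx.
Qed.

(** By induction on k. The conjugate of c = [x, y] by t is the commutator of x
    u and y v, where u = [x, t] and v = [y, t] lie one step deeper than x and
    y; expanding it gives c, up to commutators that lie deep enough. *)
Lemma lcs_act_comm k f s : lcs F k f -> S s -> lcs F k.+1 [~ f, s].
Proof.
move=> kf; elim: k f kf s => [|k IH] f kf s Ss; first exact: FS.
suff : [set g | lcs F k.+1 g /\ forall t, S t -> lcs F k.+2 [~ g, t]] f.
  by case=> _; apply.
have conjF x y : lcs F k.+2 x -> F y -> lcs F k.+2 (x ^ y).
  by move=> kx Fy; exact: (lcs_conj sgF kx Fy).
apply: (kf : generated _ _); split; last first.
  move=> _ [x [y [kx Fy ->]]]; split=> [|t St]; first exact: lcs_comm1.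
  have Fx := lcs_sub0 sgF kx.
  have kc : lcs F k.+1 [~ x, y] by exact: lcs_comm1.
  have ku := IH x kx t St; have kv := FS Fy St.
  set c := [~ x, y] in kc *; set u := [~ x, t] in ku *;
    set v := [~ y, t] in kv *.
  have [Fu Fv] := conj (lcs_sub0 sgF ku) (lcs_sub0 sgF kv).
  have Fc := lcs_sub0 sgF kc.
  have -> : [~ c, t] = (([~ x, v]) ^ u) ^ c * [~ c, v * u] * [~ u, y * v].
    have xt : x ^ t = x * u by rewrite /u /commg mulgA mulgV mul1g.
    have yt : y ^ t = y * v by rewrite /v /commg mulgA mulgV mul1g.
    rewrite {1}/commg {2}/c conjRg xt yt commMgJ (commgMJ x y v) -/c conjMg
      -conjgM.
    rewrite (commgEl c).
    clear kc Fc; move: c ([~ x, v] ^ u) (c ^ (v * u)) [~ u, y * v] => d p q r.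
    by rewrite conjgE !mulgA mulgK.
  apply: FM; first apply: FM.
  - apply: (conjF) => //; apply: (conjF) => //.
    by have := lcs_comm sgF kx kv; rewrite addn1.
  - by apply: lcs_comm1 => //; exact: (@FM 0).
  - by apply: lcs_comm1 => //; exact: (@FM 0).
split=> [|x y [kx hx] [ky hy]|x [kx hx]].
- by split=> // t _; rewrite comm1g.
- split=> [|t St]; first exact: FM.
  rewrite commMgJ; apply: FM; last exact: hy.
  by apply: conjF; [exact: hx|exact: lcs_sub0 ky].
- split=> [|t St]; first exact: FV.
  have : [~ x^-1, t] ^ x * [~ x, t] = 1 by rewrite -commMgJ mulVg comm1g.
  move=> /eqP; rewrite mulg_eq1 => /eqP E.
  rewrite -(conjgK x [~ x^-1, t]) E; apply: conjF.
    by apply: FV; exact: hx.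
  by apply: (@FV 0); exact: lcs_sub0 kx.
Qed.

(** The Hall-Witt identity reduces the commutator of f with [x, y] to iterated
    commutators of f with x and y separately. *)
Lemma lcs_cross i j f s : lcs F i f -> lcs S j s -> lcs F (i + j).+1 [~ f, s].
Proof.
move=> fi sj; elim: j i f s fi sj => [|j IH] i f s fi sj.
  by rewrite addn0; exact: lcs_act_comm.
suff : [set t | S t /\ forall i f, lcs F i f -> lcs F (i + j.+1).+1 [~ f, t]] s.
  by case=> _; apply.
apply: (sj : generated _ _); split; last first.
  move=> _ [x [y [jx Sy ->]]]; have Sx := lcs_sub0 sgS jx.
  split=> [|k z kz]; first exact: subgroup_comm.
  have [Fz Sy' Sx'] := And3 (lcs_sub0 sgF kz) (SV0 Sy) (SV0 Sx).
  have := Hall_Witt x y^-1 z; rewrite invgK => hw.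
  have N2 : lcs F (k + j.+1).+1 ([~ y^-1, z^-1, x] ^ z).
    apply: (lcs_conj sgF) => //; rewrite addnS -addSn; apply: IH => //.
    by rewrite -invgR; apply: FV; apply: lcs_act_comm => //; exact: FV.
  have N3 : lcs F (k + j.+1).+1 ([~ z, x^-1, y^-1] ^ x).
    apply: lcs_act => //; rewrite addnS; apply: lcs_act_comm => //.
    by apply: IH => //; exact: SV.
  have N4 : lcs F (k + j.+1).+1 ([~ x, y, z] ^ y^-1).
    have -> : [~ x, y, z] ^ y^-1 =
        ([~ y^-1, z^-1, x] ^ z * [~ z, x^-1, y^-1] ^ x)^-1.
      by apply: invg_inj; rewrite invgK; apply: mulg1_eq; rewrite mulgA.
    by apply: FV; exact: FM.
  by have := lcs_act N4 Sy; rewrite conjgKV -invgR => /FV; rewrite invgK.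
have [S1 SM0 _] := sgS.
split=> [|x y [Sx hx] [Sy hy]|x [Sx hx]].
- by split=> // k z _; rewrite commg1.
- split=> [|k z kz]; first exact: SM0.
  by rewrite commgMJ; apply: FM; [exact: hy|apply: lcs_act => //; exact: hx].
- split=> [|k z kz]; first exact: SV0.
  have : [~ z, x^-1] * [~ z, x] ^ x^-1 = 1 by rewrite -commgMJ mulgV commg1.
  move=> /eqP; rewrite mulg_eq1 => /eqP ->; apply: FV.
  by apply: lcs_act; [exact: hx|exact: SV0].
Qed.

(** The theorem of Falk and Randell. In the expansion of the commutator of f s
    and f' s', all factors lie in the lower central series of F by the previous
    lemmas, except [s, s']. *)
Lemma lcs_almost_direct (P : set G) :
  (forall g, P g -> exists f s, [/\ F f, S s & g = f * s]) ->
  forall k g, lcs P k g -> exists f s, [/\ lcs F k f, lcs S k s & g = f * s].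
Proof.
move=> decP; elim=> [|k IH] g kg; first exact: decP.
pose N : set G := [set g | exists f s, [/\ lcs F k.+1 f,
  lcs S k.+1 s & g = f * s]].
have SJ x y : lcs F k.+1 x -> lcs S k.+1 y -> lcs F k.+1 (x ^ y).
  by move=> kx ky; apply: lcs_act => //; exact: lcs_sub0 ky.
suff : N g by [].
apply: (kg : generated _ _); split; last first.
  move=> _ [x [y [/IH[f [s [kf ks ->]]] /decP[f' [s' [Ff Ss ->]]] ->]]].
  have Ss0 := lcs_sub0 sgS ks; have Ff0 := lcs_sub0 sgF kf.
  have kx : lcs F k.+1 ([~ f, f' * s'] ^ s).
    apply: lcs_act => //; rewrite commgMJ; apply: FM; first exact: lcs_act_comm.
    by apply: lcs_act => //; exact: lcs_comm1.
  have ky : lcs F k.+1 ([~ s, f'] ^ s').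
    apply: lcs_act => //; rewrite -invgR; apply: FV.
    by have := lcs_cross (i := 0) Ff ks.
  have kc : lcs S k.+1 [~ s, s'] by exact: lcs_comm1.
  exists ([~ f, f' * s'] ^ s * ([~ s, f'] ^ s') ^ [~ s, s']^-1), [~ s, s'].
  split=> //; first by apply: FM => //; apply: SJ => //; exact: SV.
  rewrite commMgJ (commgMJ s); clear kx ky kc.
  move: ([~ f, f' * s'] ^ s) ([~ s, f'] ^ s') [~ s, s'] => p q r.
  by rewrite /conjg invgK !mulgA mulgVK.
split=> [|x y [f [s [kf ks ->]]] [f' [s' [kf' ks' ->]]]|x [f [s [kf ks ->]]]].
- by exists 1, 1; rewrite mul1g; split=> //; have [] := lcs_subgroup sgS k.+1.
- exists (f * f' ^ s^-1), (s * s'); split; [|exact: SM|].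
    by apply: FM => //; apply: SJ => //; exact: SV.
  by rewrite /conjg invgK !mulgA !mulgVK.
- exists (f^-1 ^ s), s^-1; split; [|exact: SV|].
    by apply: SJ => //; exact: FV.
  by rewrite invgM /conjg -!mulgA mulgV mulg1.
Qed.

End AlmostDirect.

(** * Moving the last strand: coset representatives *)

(** Because of this consequence of the braid relation, conjugation by sigma_i
    carries a_i to a_(i+1), see [pure_gen_up]. *)
Lemma braid_conj (G : groupType) (s t : G) : s * t * s = t * s * t ->
  s * (t * s * s * t^-1) * s^-1 = t * t.
Proof.
move=> sts; have e : s * t^-1 * s^-1 = t^-1 * s^-1 * t.
  by apply: (mulgI (s * t)); rewrite !mulgA sts !mulgK mulgV mul1g.
rewrite !mulgA sts.
have -> : t * s * t * s * t^-1 * s^-1 = t * s * t * (s * t^-1 * s^-1)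
  by rewrite !mulgA.
by rewrite e !mulgA !mulgK.
Qed.

Lemma conj_intertwine (G : groupType) (s t D X Y : G) :
  s * D = D * t -> t * X = Y * t -> s * (D * X * D^-1) = D * Y * D^-1 * s.
Proof.
move=> sD tX; have E : t * D^-1 = D^-1 * s.
  by apply: (mulIg D); rewrite mulgVK -mulgA sD mulKg.
by rewrite -(mulgA (D * Y)) -E !mulgA sD -!(mulgA D) tX.
Qed.

(** The relations between x = a_i, y = a_(i+1) and s = sigma_i, solved for the
    four conjugates. *)
Lemma conj_pair (G : groupType) (s x y : G) :
  s * x = y * s -> s * (x * y) = x * y * s ->
  [/\ y ^ s = x, x ^ s^-1 = y, x ^ s = y ^ x^-1 & y ^ s^-1 = x ^ y].
Proof.
move=> up pr; have ys : y ^ s = x by rewrite /conjg ?mulgA -mulgA -up mulKg.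
have xsV : x ^ s^-1 = y by rewrite -ys conjgK.
have xys : (x * y) ^ s = x * y by rewrite /conjg -?mulgA mulgA -pr mulKg.
split=> //.
  by apply: (mulIg (y ^ s)); rewrite -conjMg xys ys /conjg invgK !mulgA mulgVK.
have := xys; move/(congr1 (conjg^~ s^-1)); rewrite conjgK conjMg xsV => E.
by rewrite [RHS]/conjg E mulKg.
Qed.

Lemma conjg_comm (G : groupType) (x y : G) : y * x = x * y -> x ^ y = x.
Proof. by move=> yx; rewrite /conjg ?mulgA -mulgA -yx mulKg. Qed.

Section BraidKernel.
Variable m : nat.
Local Notation B := (braid m.+1).
Local Notation s i := (sigma m.+1 i : B).
Local Notation a j := (pure_gen m.+1 j m : B).
Local Notation F := (@kernel_group m).
Implicit Types (i j k p : nat) (g h : B).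

(** Moves the last strand to position p. These braids represent the cosets of
    the subgroup that preserves the last position. *)
Definition cycle_braid p : B := \prod_(k <- rev (iota p (m - p))) s k.
Local Notation c := cycle_braid.

Lemma cycle_braid_last : c m = 1.
Proof. by rewrite /cycle_braid subnn big_nil. Qed.

Lemma cycle_braidS p : p < m -> c p = c p.+1 * s p.
Proof.
move=> pm; rewrite /cycle_braid (_ : (m - p = (m - p.+1).+1)%N); last lia.
by rewrite /= rev_cons -cats1 big_cat big_seq1.
Qed.

Lemma pure_genE j : a j = c j.+1 * (s j * s j) * (c j.+1)^-1.
Proof. by rewrite /pure_gen expgS expg1. Qed.

Lemma sigma_comm i j : i.+1 < j \/ j.+1 < i -> s i * s j = s j * s i.
Proof. by case=> ij; [exact: sigma_far|exact/esym/sigma_far]. Qed.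

Lemma cycle_comm i p : i.+1 < p -> s i * c p = c p * s i.
Proof.
move=> ip; case: (leqP p m) => pm; last first.
  by rewrite /cycle_braid (_ : (m - p = 0)%N) ?big_nil ?mulg1 ?mul1g //; lia.
move: ip; rewrite -(subKn pm); move: (m - p)%N (leq_subr p m) => r.
elim: r => [|r IH] rm ip; first by rewrite subn0 cycle_braid_last mulg1 mul1g.
rewrite cycle_braidS; last lia.
have -> : (m - r.+1).+1 = (m - r)%N by lia.
by rewrite mulgA IH -?mulgA; try lia; rewrite sigma_comm //; left.
Qed.

Lemma cycle_shift i p : p < i -> i < m -> c p * s i = s i.-1 * c p.
Proof.
move=> + im; move: {2}(i - p)%N (leqnn (i - p)%N) => r.
elim: r p => [|r IH] p ir pi; first lia.
have [-> | pi'] : i = p.+1 \/ p.+1 < i by lia.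
- rewrite cycle_braidS ?(cycle_braidS (p := p.+1)); try lia.
  have st : s p * s p.+1 * s p = s p.+1 * s p * s p.+1 by apply: sigma_braid;
    lia.
  by rewrite -!mulgA (mulgA (s p.+1)) -st !mulgA cycle_comm.
- rewrite cycle_braidS; last lia.
  rewrite -mulgA sigma_comm; last by left.
  by rewrite !mulgA IH //; lia.
Qed.

Lemma sigmaYB i : i.+1 < m -> s i * s i.+1 * s i = s i.+1 * s i * s i.+1.
Proof. by move=> im; apply: sigma_braid. Qed.

Lemma pure_gen_far i j : i.+1 < m -> j < m -> j != i -> j != i.+1 ->
  s i * a j = a j * s i.
Proof.
move=> im jm ji jSi; rewrite pure_genE; case: (ltnP i j) => ij.
  have css : s i * s j = s j * s i by apply: sigma_comm; lia.
  apply: conj_intertwine; first by apply: cycle_comm; lia.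
  by rewrite mulgA css -mulgA css mulgA.
have css : s i.+1 * s j = s j * s i.+1 by apply: sigma_comm; lia.
apply: (conj_intertwine (t := s i.+1));
  last by rewrite mulgA css -mulgA css mulgA.
by rewrite cycle_shift //; lia.
Qed.

Lemma pure_gen_up i : i.+1 < m -> s i * a i = a i.+1 * s i.
Proof.
move=> im; rewrite !pure_genE (cycle_braidS im).
have -> : c i.+2 * s i.+1 * (s i * s i) * (c i.+2 * s i.+1)^-1 =
   c i.+2 * (s i.+1 * s i * s i * (s i.+1)^-1) * (c i.+2)^-1
     by rewrite invgM !mulgA.
apply: conj_intertwine; first by apply: cycle_comm; lia.
by rewrite -(braid_conj (sigmaYB im)) mulgVK.
Qed.

(** The product of a_i and a_(i+1) is the loop of the last strand around the
    strands i and i + 1, which does not see the exchange of these two. *)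
Lemma pure_gen_pair i : i.+1 < m -> s i * (a i * a i.+1) = a i * a i.+1 * s i.
Proof.
move=> im; rewrite !pure_genE (cycle_braidS im).
have st := sigmaYB im.
have -> : c i.+2 * s i.+1 * (s i * s i) * (c i.+2 * s i.+1)^-1 *
   (c i.+2 * (s i.+1 * s i.+1) * (c i.+2)^-1) =
   c i.+2 * (s i.+1 * s i * s i * s i.+1) * (c i.+2)^-1.
  by rewrite invgM !mulgA mulgVK mulgVK.
apply: conj_intertwine; first by apply: cycle_comm; lia.
by rewrite !mulgA st -(mulgA (s i.+1 * s i)) -!mulgA; do 2 congr (_ * _);
  rewrite !mulgA st.
Qed.

Definition sgen i (b : bool) : B := if b then (s i)^-1 else s i.

Lemma sgenE i b (im : i < m) : sgen i b = word_class _ [:: (Ordinal im : 'I_m,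
  b)].
Proof.
rewrite /sgen /sigma;
  have -> : insub i = Some (Ordinal im : 'I_m) by rewrite insubT.
by case: b => //; rewrite -word_class_inv.
Qed.

Lemma word_class_cons (l : 'I_m * bool) w :
  word_class (@braid_relation m.+1) (l :: w) = sgen l.1 l.2 * word_class _ w.
Proof.
case: l => i b; rewrite (sgenE _ (ltn_ord i)) /= -word_class_cat /=.
by congr word_class; congr ((_, _) :: _); exact: val_inj.
Qed.

Lemma endpoint_sgen i b p : i < m -> p < m.+1 ->
  endpoint (sgen i b) p = crossing i p.
Proof. by move=> im pm; rewrite (sgenE _ im) endpoint_class. Qed.

Lemma remove_sgen i b p : i < m -> p < m.+1 -> remove_strand (sgen i b) p =
  if (p == i) || (p == i.+1) then 1
  else if b then (sigma m (unbump p i))^-1 else sigma m (unbump p i).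
Proof. by move=> im pm; rewrite (sgenE _ im) remove_strand_class //= mulg1. Qed.

(** The section of the removal of the last strand, which adds a strand without
    crossings. *)
Fixpoint smap_word (w : word 'I_m.-1) : B :=
  if w is (i, b) :: w' then sgen i b * smap_word w' else 1.

Lemma smap_word_cat u v : smap_word (u ++ v) = smap_word u * smap_word v.
Proof. by elim: u => [|[i b] u IH] /=; rewrite ?mul1g // IH mulgA. Qed.

Lemma smap_word_eqv u v : word_eqv (@braid_relation m) u v ->
  smap_word u = smap_word v.
Proof.
elim=> {u v} [_ _ [i j ij|i j ji]|i b|u u' v v' _ IHu _ IHv|//|u v _ -> //|
              u v w _ -> _ -> //].
- rewrite /= !mulg1; exact: (sigma_far m.+1 ij).
- rewrite /= !mulg1 !mulgA ji; apply: sigmaYB.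
  by have := ltn_ord j; rewrite ji; lia.
- by case: b; rewrite /= mulg1 ?mulVg ?mulgV.
- by rewrite !smap_word_cat IHu IHv.
Qed.

Definition smap (b : braid m) : B := smap_word (word_repr b).

Lemma smap_class w : smap (word_class _ w) = smap_word w.
Proof. exact/smap_word_eqv/word_repr_eqv. Qed.

Lemma smapM b b' : smap (b * b') = smap b * smap b'.
Proof.
by rewrite -{1}(word_reprK b) -{1}(word_reprK b') -word_class_cat smap_class
  smap_word_cat.
Qed.

Lemma smap1 : smap 1 = 1.
Proof. by rewrite -[1 in LHS]/(word_class _ [::]) smap_class. Qed.

Lemma smapV b : smap b^-1 = (smap b)^-1.
Proof. by apply: (mulgI (smap b)); rewrite -smapM !mulgV smap1. Qed.

Let ord_lt (i : 'I_m.-1) : i.+1 < m. Proof. by have := ltn_ord i; lia. Qed.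

Lemma endpoint_smap b p : p < m -> endpoint (smap b) p = endpoint b p.
Proof.
rewrite /smap /endpoint -/(endpoint _ _);
  elim: (word_repr b) p => [|[i e] w IH] p pm.
  by rewrite /= endpoint1 // ltnW.
rewrite /= endpointM ?endpoint_sgen ?IH //; try (by rewrite ltnW).
exact: crossing_lt.
Qed.

Lemma remove_smap b : remove_strand (smap b) m = b.
Proof.
rewrite -[RHS]word_reprK /smap; elim: (word_repr b) => [|[i e] w IH] /=.
  by rewrite remove_strand1.
have im := ord_lt i.
have cr : crossing i m = m by rewrite /crossing !gtn_eqF //; lia.
rewrite remove_strandM // endpoint_sgen ?cr ?IH; try lia.
rewrite remove_sgen ?gtn_eqF //=; try lia.
have -> : unbump m i = i by rewrite /unbump ltnNge ltnW ?subn0 //; lia.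
rewrite -cat1s word_class_cat; congr (_ * _).
have -> : sigma m i = word_class (@braid_relation m) [:: (i, false)].
  by rewrite /sigma (valK i).
by case: e => //; rewrite -word_class_inv.
Qed.

Lemma kernel_subgroup : subgroup F. Proof. exact: generated_subgroup. Qed.

Lemma kernel_gen j : j < m -> F (a j).
Proof. by move=> jm; apply: mem_generated; exists j. Qed.

Lemma kernel_ind (Q : set B) : subgroup Q -> (forall j, j < m -> Q (a j)) ->
  F `<=` Q.
Proof. by move=> sgQ Qa; apply: smallest_sub => // _ [j jm ->]; exact: Qa. Qed.

(** The braids on the first m strands permute the generators of F, up to
    conjugation in F. In particular those that are pure act trivially on the
    abelianization of F. *)
Lemma conj_sgen i b j : i.+1 < m -> j < m ->
  exists2 f, F f & a j ^ sgen i b = a (crossing i j) ^ f.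
Proof.
move=> im jm; have [F1 FM FV] := kernel_subgroup.
have [g1 g2 g3 g4] := conj_pair (pure_gen_up im) (pure_gen_pair im).
have [Fi FSi] := conj (kernel_gen (ltnW im)) (kernel_gen im).
rewrite /crossing; case: eqP => [->|/eqP ji]; last case: eqP => [->|/eqP jSi].
- case: b; first by exists 1; rewrite ?conjg1.
  by exists (a i)^-1; first exact: FV.
- case: b; last by exists 1; rewrite ?conjg1.
  by exists (a i.+1).
- exists 1 => //; rewrite conjg1.
  have cm := pure_gen_far im jm ji jSi.
  suff : a j ^ s i = a j by case: b => // E; rewrite -{1}E conjgK.
  exact: conjg_comm.
Qed.

Lemma kernelJ_sgen i b g : i.+1 < m -> F g -> F (g ^ sgen i b).
Proof.
move=> im; have [F1 FM FV] := kernel_subgroup.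
apply: (kernel_ind (Q := [set g | F (g ^ sgen i b)])).
  split=> [|x y Fx Fy|x Fx]; rewrite /= ?conj1g ?conjMg ?conjVg //.
    exact: FM.
  exact: FV.
move=> j jm; have [f Ff E] := conj_sgen b im jm.
rewrite /= E; apply: (subgroup_conj kernel_subgroup _ Ff); apply: kernel_gen.
by rewrite /crossing; case: eqP => // _; case: eqP => // ?; lia.
Qed.

Lemma kernelJ_smap b g : F g -> F (g ^ smap b).
Proof.
rewrite /smap; elim: (word_repr b) g => [|[i e] w IH] g Fg /=;
  first by rewrite conjg1.
by rewrite conjgM; apply: IH; exact: kernelJ_sgen.
Qed.

Lemma conj_smap b j : j < m ->
  exists2 f, F f & a j ^ smap b = a (endpoint b j) ^ f.
Proof.
have [F1 FM FV] := kernel_subgroup.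
rewrite /endpoint /smap; elim: (word_repr b) j => [|[i e] w IH] j jm /=.
  by exists 1; rewrite ?conjg1.
have [f Ff E] := conj_sgen e (ord_lt i) jm.
have [|f' Ff' E'] := IH (crossing i j); first exact: crossing_lt.
exists (f' * f ^ smap_word w).
  apply: (FM) => //; have := @kernelJ_smap (word_class _ w) f Ff.
  by rewrite smap_class.
by rewrite conjgM E conjJg E' -conjgM.
Qed.

(** Coset enumeration: the products of an element of F, a braid on the first m
    strands and a coset representative are stable under right multiplication by
    the generators. A generator that moves the strand in position p changes the
    representative, and may leave a factor a_j or its inverse; any other one
    can be shifted to the left of the representative. *)
Lemma word_decomposition (w : word 'I_m) : exists f b,
  F f /\ word_class (@braid_relation m.+1) w = f * smap b * c (track (n :=
    m.+1) w m).
Proof.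
have [F1 FM FV] := kernel_subgroup.
elim/last_ind: w => [|w [i e] [f [b [Ff E]]]].
  by exists 1, 1; rewrite smap1 /= cycle_braid_last !mulg1.
rewrite -cats1 track_cat /=; set p := track _ m in E *.
have pm : p < m.+1 by apply: (track_lt (n := m.+1)).
have -> : word_class (@braid_relation m.+1) (w ++ [:: (i, e)]) =
    word_class _ w * sgen i e.
  by rewrite word_class_cat word_class_cons mulg1.
rewrite E.
have im := ltn_ord i.
(* Conjugation by smap b moves the new factor f' of F to the left. *)
have wrap f' b' : F f' -> c p * sgen i e = f' * smap b' * c (crossing i p) ->
  exists f0 b0, F f0 /\ f * smap b * c p * sgen i e = f0 * smap b0 * c
    (crossing i p).
  move=> Ff' E'; exists (f * f' ^ (smap b)^-1), (b * b'); split.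
    by apply: (FM) => //; rewrite -smapV; exact: kernelJ_smap.
  by rewrite -mulgA E' smapM /conjg invgK !mulgA mulgVK.
have gen k : k.+1 < m -> smap (sigma m k) = s k.
  move=> km; rewrite /sigma; have km' : k < m.-1 by lia.
  by rewrite insubT smap_class /= mulg1.
have neg x y : c p * x = y * c p -> c p * x^-1 = y^-1 * c p.
  by move=> xy; apply: (mulgI y); apply: (mulIg x);
    rewrite mulVKg mulgA mulgVK xy.
case: (ltngtP p i) => [pi|ip|pi].
- have cr : crossing i p = p by rewrite /crossing !ltn_eqF //; lia.
  rewrite cr in wrap *.
  apply: (wrap 1 (if e then (sigma m i.-1)^-1 else sigma m i.-1)) => //.
  have sh := cycle_shift pi im.
  have gi : smap (sigma m i.-1) = s i.-1 by apply: gen; lia.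
  rewrite mul1g; case: e {E wrap}; rewrite ?smapV gi //=; exact: neg.
- case: (ltngtP p i.+1) => [|ip'|pi]; first lia.
    have cr : crossing i p = p by rewrite /crossing !gtn_eqF //; lia.
    rewrite cr in wrap *.
    apply: (wrap 1 (if e then (sigma m i)^-1 else sigma m i)) => //.
    have sh := esym (cycle_comm ip').
    have gi : smap (sigma m i) = s i by apply: gen; lia.
    rewrite mul1g; case: e {E wrap}; rewrite ?smapV gi //=; exact: neg.
  have -> : crossing i p = i by rewrite pi /crossing eqxx gtn_eqF.
  move: wrap; rewrite pi;
    have -> : crossing i i.+1 = i by rewrite /crossing eqxx gtn_eqF.
  have cS := cycle_braidS im; case: e => wrap.
    apply: (wrap (a i)^-1 1); first by apply: (FV); exact: kernel_gen.
    rewrite smap1 mulg1 pure_genE cS !invgM invgK /sgen !mulgA.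
    by rewrite mulgVK mulgVK.
  by apply: (wrap 1 1) => //; rewrite smap1 !mul1g.
- have cr : crossing i p = i.+1 by rewrite pi /crossing eqxx.
  move: wrap; rewrite cr pi => wrap.
  have cS := cycle_braidS im; case: e wrap => wrap.
    by apply: (wrap 1 1) => //; rewrite smap1 !mul1g cS mulgK.
  apply: (wrap (a i) 1); first exact: kernel_gen.
  by rewrite smap1 mulg1 pure_genE cS /sgen !mulgA mulgVK.
Qed.

End BraidKernel.

(** * The kernel of removing the last strand *)

Section RemoveKernel.
Variable m : nat.
Local Notation B := (braid m.+1).
Local Notation s i := (sigma m.+1 i : B).
Local Notation a j := (pure_gen m.+1 j m : B).
Local Notation F := (@kernel_group m).
Local Notation P := (@pure m.+1).
Local Notation c p := (@cycle_braid m p).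
Implicit Types (i j k p : nat) (g h : B).

Lemma kernel_pure : F `<=` P.
Proof.
by apply: kernel_ind => [|j jm]; [exact: pure_subgroup|exact: pure_gen_pure].
Qed.

Lemma sE i : s i = sgen m i false. Proof. by []. Qed.

Lemma remove_sq j p : j < m -> p < m.+1 ->
  endpoint (s j * s j) p = p /\ remove_strand (s j * s j) p =
  if (p == j) || (p == j.+1) then 1
  else sigma m (unbump p j) * sigma m (unbump p j).
Proof.
move=> jm pm; rewrite endpointM // remove_strandM // !sE !endpoint_sgen //;
  last first.
  by rewrite -(endpoint_sgen false jm pm); exact: endpoint_lt.
rewrite crossingK; split=> //.
rewrite !remove_sgen //; last by rewrite -(endpoint_sgen false jm pm);
  exact: endpoint_lt.
case: (boolP ((p == j) || (p == j.+1))) => pj.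
  have -> : (crossing j p == j) || (crossing j p == j.+1).
    by case/orP: pj => /eqP ->;
      rewrite /crossing ?(gtn_eqF (ltnSn j)) ?eqxx ?orbT.
  by rewrite mulg1.
have -> : crossing j p = p.
  by move: pj; rewrite /crossing negb_or => /andP[/negPf -> /negPf ->].
by rewrite (negPf pj).
Qed.

Lemma endpoint_cycle_last p : p <= m -> endpoint (c p) m = p.
Proof.
move=> pm; rewrite -{1 2}(subKn pm); move: (m - p) (leq_subr p m) => r.
elim: r => [|r IH] rm; first by rewrite subn0 cycle_braid_last endpoint1.
rewrite cycle_braidS; last lia.
have -> : (m - r.+1).+1 = m - r by lia.
rewrite endpointM // IH ?sE ?endpoint_sgen; try lia.
by rewrite /crossing; case: eqP => ?; [lia|case: eqP => ?; lia].
Qed.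

Lemma remove_cycle_last p : p <= m -> remove_strand (c p) m = 1.
Proof.
move=> pm; rewrite -(subKn pm); move: (m - p) (leq_subr p m) => r.
elim: r => [|r IH] rm; first by rewrite subn0 cycle_braid_last remove_strand1.
rewrite cycle_braidS; last lia.
have -> : (m - r.+1).+1 = m - r by lia.
rewrite remove_strandM // IH ?endpoint_cycle_last ?sE ?remove_sgen; try lia.
have -> : (m - r == (m - r.+1).+1) by apply/eqP; lia.
by rewrite orbT mulg1.
Qed.

Lemma remove_conj g h p : p < m.+1 ->
  endpoint h (endpoint g p) = endpoint g p ->
  remove_strand (g * h * g^-1) p =
  remove_strand g p * remove_strand h (endpoint g p) * (remove_strand g p)^-1.
Proof.
move=> pm hp; have ep := endpoint_lt g pm.
rewrite !remove_strandM // endpointM // hp; congr (_ * _).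
have := remove_strand1 pm;
  rewrite -[X in remove_strand X](mulgV g) remove_strandM //.
by move=> E; apply: (mulgI (remove_strand g p)); rewrite E mulgV.
Qed.

Lemma remove_gen_last j : j < m -> remove_strand (a j) m = 1.
Proof.
move=> jm; rewrite pure_genE; have [e r] := remove_sq jm (p := j.+1) jm.
rewrite remove_conj // endpoint_cycle_last // r eqxx orbT mulg1.
by rewrite remove_cycle_last // mulgV.
Qed.

Lemma remove_kernel_last g : F g -> remove_strand g m = 1.
Proof.
suff : F `<=` [set g | P g /\ remove_strand g m = 1] by move=> h /h[].
have [P1 PM PV] := pure_subgroup m.+1.
apply: kernel_ind => [|j jm]; last by split;
  [exact: pure_gen_pure|exact: remove_gen_last].
split=> [|x y [px rx] [py ry]|x [px rx]].
- by split; [exact: P1|exact: remove_strand1].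
- by split; [exact: PM|rewrite remove_strandM // px // rx ry mulg1].
- split; first exact: PV.
  have := remove_strand1 (ltnSn m); rewrite -[X in remove_strand X](mulgV x).
  by rewrite remove_strandM // px // rx mul1g.
Qed.

Definition pure_section : set B := [set g | exists2 b, pure b & g = smap b].

Lemma pure_section_subgroup : subgroup pure_section.
Proof.
have [P1 PM PV] := pure_subgroup m.
split=> [|x y [b pb ->] [b' pb' ->]|x [b pb ->]].
- by exists 1; rewrite ?smap1.
- by exists (b * b'); rewrite ?smapM //; exact: PM.
- by exists b^-1; rewrite ?smapV //; exact: PV.
Qed.

Lemma kernel_section f g : F f -> pure_section g -> lcs F 1 [~ f, g].
Proof.
move=> Ff [b pb ->]; have sgF := @kernel_subgroup m.
have [_ LM LV] := lcs_subgroup sgF 1.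
suff : F `<=` [set f | F f /\ lcs F 1 [~ f, smap b]] by move=> /(_ f Ff)[].
apply: kernel_ind; last first.
  move=> j jm; have Fj := kernel_gen jm; split=> //.
  have [f' Ff' E] := conj_smap b jm.
  by rewrite commgEl E pb // -commgEl; exact: lcs_comm1.
have [F1 FM FV] := sgF.
split=> [|x y [Fx Lx] [Fy Ly]|x [Fx Lx]].
- by split=> //; rewrite comm1g; have [] := lcs_subgroup sgF 1.
- split; first exact: FM.
  rewrite commMgJ; apply: (LM) => //; exact: (lcs_conj sgF (k := 1)).
- split; first exact: FV.
  have : [~ x^-1, smap b] ^ x * [~ x,
    smap b] = 1 by rewrite -commMgJ mulVg comm1g.
  move=> /eqP; rewrite mulg_eq1 => /eqP E.
  rewrite -(conjgK x [~ x^-1, _]) E; apply: (lcs_conj sgF (k := 1));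
    last exact: FV.
  exact: LV.
Qed.

Lemma pure_decomposition g : P g ->
  exists f h, [/\ F f, pure_section h & g = f * h].
Proof.
move=> pg; have [f [b [Ff E]]] := word_decomposition (word_repr g).
rewrite word_reprK -/(endpoint g m) pg // cycle_braid_last mulg1 in E.
exists f, (smap b); split=> //; exists b => // p pm.
have pf := kernel_pure Ff; have pm' := ltnW pm : p < m.+1.
by rewrite -endpoint_smap // -[RHS](pg p pm') E endpointM // pf.
Qed.

(** In the decomposition of g by [lcs_almost_direct], the factor on the first m
    strands is what remains of g after removing the last strand, so it is
    trivial. *)
Lemma lcs_kernel k g : lcs P k g -> remove_strand g m = 1 -> lcs F k g.
Proof.
move=> kg rg.
have [f [h [kf kh E]]] := lcs_almost_direct (@kernel_subgroup m)
  pure_section_subgroup kernel_section pure_decomposition kg.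
have Ff := lcs_sub0 (@kernel_subgroup m) kf.
have [b _ hE] := lcs_sub0 pure_section_subgroup kh.
move: rg; rewrite E remove_strandM // (kernel_pure Ff) // remove_kernel_last //
  mul1g.
by rewrite hE remove_smap => ->; rewrite smap1 mulg1.
Qed.

End RemoveKernel.

(** * Removing another strand from the generators of the kernel *)

Section RemoveOther.
Variable m : nat.
Local Notation B := (braid m.+2).
Local Notation s i := (sigma m.+2 i : B).
Local Notation a j := (pure_gen m.+2 j m.+1 : B).
Local Notation F := (@kernel_group m.+1).
Local Notation P := (@pure m.+2).
Implicit Types (i j k p : nat) (g h : B).

Lemma remove_cycle k p : k < m.+1 -> p <= m.+1 ->
  endpoint (cycle_braid m.+1 p) k = (if k < p then k else k.+1) /\
  remove_strand (cycle_braid m.+1 p) k = cycle_braid m (if k < p then p.-1 else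
    p).
Proof.
move=> km pm; rewrite -(subKn pm); move: (m.+1 - p) (leq_subr p m.+1) => r {pm}.
have km2 : k < m.+2 by exact: ltnW.
elim: r => [|r IH] rm.
  by rewrite subn0 km !cycle_braid_last endpoint1 // remove_strand1.
have [|e f] := IH; first lia.
have pE : (m.+1 - r.+1).+1 = m.+1 - r by lia.
move: pE; set q := m.+1 - r.+1; have qm : q < m.+1 by rewrite /q; lia.
move=> pE; rewrite -pE in e f; rewrite cycle_braidS //.
have ek : endpoint (cycle_braid m.+1 q.+1) k < m.+2 by exact: endpoint_lt.
rewrite endpointM // remove_strandM // !sE endpoint_sgen // remove_sgen // e f.
rewrite /crossing /unbump.
case: (ltngtP k q) => kq.
- rewrite ltnS (ltnW kq) ltn_eqF // ltn_eqF; last lia.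
  rewrite kq subn1 /=; split=> //; rewrite [in RHS]cycle_braidS; last lia.
  by rewrite prednK //; lia.
- have -> : (k < q.+1) = false by apply/negbTE; lia.
  rewrite gtn_eqF; last lia.
  rewrite gtn_eqF ?ltnS //.
  have -> : (k.+1 < q) = false by apply/negbTE; lia.
  by rewrite /= subn0; split=> //; rewrite [in RHS]cycle_braidS //; lia.
- by rewrite kq ltnSn eqxx /= mulg1.
Qed.

Lemma remove_gen k j : k < m.+1 -> j < m.+1 ->
  remove_strand (a j) k = if j == k then 1 else pure_gen m.+1 (unbump k j) m.
Proof.
move=> km jm; have km2 : k < m.+2 by exact: ltnW.
have [e f] := remove_cycle (p := j.+1) km jm.
have ek : endpoint (cycle_braid m.+1 j.+1) k < m.+2 by exact: endpoint_lt.
have [e2 f2] := remove_sq jm ek.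
rewrite pure_genE remove_conj // f f2 e.
case: (ltngtP k j) => kj.
- rewrite ltnS (ltnW kj) ltn_eqF // ltn_eqF /=; last lia.
  rewrite /unbump kj subn1.
  by rewrite pure_genE prednK //; lia.
- have -> : (k < j.+1) = false by apply/negbTE; lia.
  rewrite gtn_eqF; last lia.
  rewrite gtn_eqF ?ltnS //= /unbump.
  have -> : (k.+1 < j) = false by apply/negbTE; lia.
  have -> : (k < j) = false by apply/negbTE; lia.
  by rewrite !subn0 pure_genE.
- by rewrite kj ltnSn eqxx /= mulg1 mulgV.
Qed.

End RemoveOther.

Local Close Scope group_scope.
Local Open Scope ring_scope.

(** * Removing a strand sets a variable to zero *)

Section RemoveRep.
Variable m : nat.
Local Notation B := (braid m.+2).
Local Notation F := (@kernel_group m.+1).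
Local Notation P := (@pure m.+2).
Variable k : 'I_m.+1.

(** Setting the variable k to zero amounts to keeping the coefficients of the
    words in the other letters, which are the words in the image of
    [fintype.lift k]. *)
Definition spull (f : series 'I_m.+1) : series 'I_m :=
  fun w => f (map (fintype.lift k) w).

Lemma spullM (f g : series 'I_m.+1) : spull (f * g) = spull f * spull g.
Proof.
apply: funext => w; elim: w f => [|x w IH] f //; rewrite /spull /= !smul_cons.
by rewrite -[X in _ + X]/(spull (sder (fintype.lift k x) f * g) w) IH.
Qed.

Lemma spull1 : spull 1 = 1.
Proof. by apply: funext => -[]. Qed.

Lemma spull_unit j : spull (sunit j) =
  if unlift k j is Some x then sunit x else 1.
Proof.
apply: funext => w; rewrite /spull /sunit seriesD series1 /sletter /sword.
have nE : nilp [seq fintype.lift k i | i <- w] = nilp w by case: w.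
rewrite nE; case: unliftP => [x ->|->].
  rewrite seriesD series1; congr (_ + _); congr (_%:Z).
  by rewrite -[[:: fintype.lift k x]]/(map (fintype.lift k) [:: x]) (inj_eq
    (inj_map lift_inj)).
rewrite series1; case: w {nE} => [|x w]; rewrite ?addr0 //=.
by rewrite eqseq_cons eq_sym (negPf (neq_lift _ _)) addr0.
Qed.

Lemma remove_purM (g h : B) : pure g ->
  remove_strand (g * h)%g k = (remove_strand g k * remove_strand h k)%g.
Proof. by move=> pg; rewrite remove_strandM ?pg // ltnW // ltnS. Qed.

Lemma remove_purV (g : B) : pure g ->
  remove_strand g^-1%g k = (remove_strand g k)^-1%g.
Proof.
move=> pg; apply: (mulgI (remove_strand g k)).
by rewrite -remove_purM // !mulgV remove_strand1 // ltnW // ltnS.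
Qed.

(** Both sides are multiplicative in g, so it is enough to compare them on the
    generators of F, where [remove_gen] and [spull_unit] agree. *)
Lemma remove_rep (g : B) : F g -> kernel_group (remove_strand g k) /\
  Rep (remove_strand g k) 1 = spull (Rep g 1).
Proof.
suff : F `<=` [set g | F g /\ (kernel_group (remove_strand g k) /\
   Rep (remove_strand g k) 1 = spull (Rep g 1))] by move=> /(_ g) h /h[].
have [F1 FM FV] := @kernel_subgroup m.
have [F1' FM' FV'] := @kernel_subgroup m.+1.
have km2 : (k < m.+2)%N by rewrite ltnW // ltnS.
apply: kernel_ind; last first.
  move=> j jm; split; first exact: kernel_gen.
  rewrite remove_gen // (Rep_pure_gen jm) mulr1 spull_unit.
  case: eqP => [jk|jk].
    split=> //; case: unliftP => [x /(congr1 val) /= E|_]; last by rewrite Rep1.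
    by have /eqP := neq_lift k x; case; apply: val_inj; rewrite /= -E jk.
  case: unliftP => [x /(congr1 val) /= E|/(congr1 val) //].
  rewrite E bumpK; split; first exact: kernel_gen.
  by rewrite (Rep_pure_gen (ltn_ord x)) mulr1; congr sunit; exact: val_inj.
split=> [|x y [Fx [Dx Rx]] [Fy [Dy Ry]]|x [Fx [Dx Rx]]].
- by split=> //; rewrite remove_strand1 // !Rep1 spull1.
- have [pDx MDx] := kernel_mult Dx; have [px Mx] := kernel_mult Fx.
  split; first exact: FM'.
  rewrite remove_purM // !RepM // MDx Mx Rx Ry -spullM; split=> //.
  exact: FM.
- have px := kernel_pure Fx.
  split; first exact: FV'.
  rewrite remove_purV //; split; first exact: FV.
  have [pV MV] := kernel_mult (FV _ Dx);
    have [pV' MV'] := kernel_mult (FV' _ Fx).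
  apply: (@inv_uniq _ _ (Rep (remove_strand x k) 1)).
    by rewrite -MV (RepK (kernel_pure Dx)).
  have [_ Mx] := kernel_mult Fx.
  by rewrite Rx -spullM -Mx (RepVK px) spull1.
Qed.

End RemoveRep.

(** * Brunnian braids *)

Section KillSeries.
Variables (X : eqType) (k : X).

Definition skill (f : series X) : series X := fun w => if k \in w then 0 else f
  w.

Lemma skillM f g : skill (f * g) = skill f * skill g.
Proof.
apply: funext => w; elim: w f => [|x w IH] f //.
rewrite smul_cons -[sder x (skill f)]/(fun v => skill f (x :: v)) /skill inE.
have [kx|kx] := eqVneq k x.
  rewrite /= mulr0 add0r.
  have -> : (fun v => if k \in x :: v then 0 else f (x :: v)) = (0 : series X).
    by apply: funext => v; rewrite inE kx eqxx.
  by rewrite mul0r.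
have -> : (fun v => if k \in x :: v then 0 else f (x :: v)) = skill (sder x f).
  by apply: funext => v; rewrite inE (negPf kx).
rewrite -/(skill g) -IH /skill /=; case: (k \in w);
  first by rewrite mulr0 addr0.
by rewrite smul_cons.
Qed.

Lemma iota_kill u : iota_lie (kill k u) = skill (iota_lie u).
Proof.
have hk : lie_hom skill.
  split=> f g; last by rewrite !series_lieb -!skillM; apply: funext => w;
    rewrite seriesB /skill; case: ifP; rewrite ?subr0.
  by apply: funext => w; rewrite seriesD /skill; case: ifP; rewrite ?addr0.
apply: (flie_hom_ext (lie_hom_comp (@iota_hom X) (kill_hom k))
                     (lie_hom_comp hk (@iota_hom X))) => x /=.
rewrite iota_gen /kill flift_gen; apply: funext => w; rewrite /skill.
case: eqP => [->|xk].
  rewrite (lie_hom0 (@iota_hom X)) series0; case: ifP => // /negbT kw.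
  by rewrite /sletter /sword; case: eqP kw => // ->; rewrite inE eqxx.
rewrite iota_gen; case: ifP => // kw; rewrite /sletter /sword.
by case: eqP kw => // ->; rewrite inE => /eqP kx; case: xk.
Qed.

End KillSeries.

Section FreeByBijection.
Variables (X : Type) (L : lieRingType) (gen : X -> L).
Hypothesis inj : injective (flift gen).
Hypothesis surj : forall y, exists u, flift gen u = y.

Lemma free_lie_bij : free_lie gen.
Proof.
move=> M f; pose pre y := sval (cid (surj y)).
have preK y : flift gen (pre y) = y by exact: (svalP (cid (surj y))).
have Kpre u : pre (flift gen u) = u by apply: inj; rewrite preK.
have hg := flift_hom gen; have hf := flift_hom f.
exists (fun y => flift f (pre y)); split=> [|phi [hphi phiE]].
  split=> [|x]; last by rewrite -[gen x](flift_gen gen) Kpre flift_gen.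
  split=> x y /=.
    by rewrite -{1}(preK x) -{1}(preK y) -(lie_homD hg) Kpre (lie_homD hf).
  by rewrite -{1}(preK x) -{1}(preK y) -(lie_hom_br hg) Kpre (lie_hom_br hf).
apply: funext => y; rewrite -[in RHS](preK y).
apply: (flie_hom_ext hf (lie_hom_comp hphi hg)) => x.
by rewrite /= !flift_gen phiE.
Qed.

End FreeByBijection.

Section Main.
Variable m : nat.
Local Notation n := m.+1.
Local Notation P := (@pure n).
Local Notation F := (lcs_nseries (pure_subgroup n)).
Local Notation FB := (ns_restr F (brunnian_subgroup n)).
Implicit Types (W : lie_monomial 'I_m) (q : nat).

(** F is generated by braids whose classes are the letters, and brackets of
    classes are classes of commutators. *)
Lemma kernel_Phi q g : lcs (@kernel_group m) q g ->
  lcs P q g /\ exists u, @Phi m u = hom F q g.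
Proof.
have sgP := pure_subgroup n; have hP := @Phi_hom m.
have close k (S : set (braid n)) : S `<=` [set g | lcs P k g /\ exists u,
  @Phi m u = hom F k g] ->
    generated S `<=` [set g | lcs P k g /\ exists u, @Phi m u = hom F k g].
  move=> SQ; apply: smallest_sub => //; have [L1 LM LV] := lcs_subgroup sgP k.
  split=> [|x y [kx [u uE]] [ky [v vE]]|x [kx [u uE]]].
  - by split=> //; exists 0; rewrite (lie_hom0 hP) Defs.hom1.
  - split; first exact: LM.
    by exists (u + v); rewrite (lie_homD hP) uE vE (homM (F := F)).
  - split; first exact: LV.
    by exists (- u); rewrite (lie_homN hP) uE (homV (F := F)).
elim: q g => [|q IH] g.
  apply: (close 0%N) => _ [j jm ->]; split; first exact: pure_gen_pure.
  by exists (fgen (Ordinal jm)); rewrite /Phi flift_gen.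
apply: (close q.+1) => _ [x [y [/IH[qx [u uE]] Fy ->]]].
have [py [v vE]] : lcs P 0 y /\ exists v, @Phi m v = hom F 0 y.
  apply: (close 0%N) (Fy : generated _ _) => _ [j jm ->]; split;
    first exact: pure_gen_pure.
  by exists (fgen (Ordinal jm)); rewrite /Phi flift_gen.
split; first exact: lcs_comm1.
exists (lieb u v); rewrite (lie_hom_br hP) uE vE (lieb_hom (F := F)) //.
by rewrite addn0.
Qed.

End Main.

Lemma avoid_lift m (k : 'I_m.+1) (w : seq 'I_m.+1) : k \notin w ->
  exists w', w = map (fintype.lift k) w'.
Proof.
elim: w => [|x w IH]; first by exists [::].
rewrite inE negb_or => /andP[kx /IH[w' ->]].
by have [y ->] := unlift_some kx; exists (y :: w').
Qed.

(** By [remove_rep], the words without k have coefficient zero in the leading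
    term of g, which is the power series of u. So u vanishes after killing
    k. *)
Lemma brunnian_kill m q g (k : 'I_m) (u : flie 'I_m) :
  brunnian g -> lcs (@pure m.+1) q g ->
  Phi u = hom (lcs_nseries (pure_subgroup m.+1)) q g -> kill k u = 0.
Proof.
case: m k u g => [[]//|m] k u g [pg bg] qg uE.
have Fg : kernel_group g by apply: (lcs_kernel (k := 0)) pg _; exact: bg.
apply: iota_inj; rewrite iota_kill -Theta_Phi uE.
apply: funext => w; rewrite /skill series0;
  case: ifP => // /negbT/avoid_lift[w' wE].
rewrite (Theta_hom _ qg); case: eqP => // wq.
have [_ R] := remove_rep k Fg.
rewrite wE -[RHS]/((0 : series 'I_m) w') -[LHS]/(spull k (Rep g 1) w') -R bg;
  last first.
  by rewrite ltnW // ltnS.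
(* The word is not empty, since its length is q + 1. *)
by rewrite Rep1 series1; move: wq; rewrite wE size_map; case: w' {wE}.
Qed.

(** Removing the strand k kills the generator a_k, and then every commutator in
    which it occurs. *)
Lemma remove_group_eval m (W : lie_monomial 'I_m) (k : 'I_m) :
  occurs k W -> remove_strand (group_eval W) k = 1%g.
Proof.
case: m k W => [[]//|m] k W.
have pure_eval (V : lie_monomial 'I_m.+1) : pure (group_eval V).
  exact: lcs_pure (group_eval_lcs V).
have [_ PM PV] := pure_subgroup m.+2.
elim: W => [j /eqP <-|U IHU V IHV] /=; first by rewrite remove_gen // eqxx.
have [pU pV] := conj (pure_eval U) (pure_eval V).
rewrite /commg /conjg remove_purM; last exact: PV.
rewrite remove_purM; last exact: PV.
rewrite remove_purM // !remove_purV //.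
by case/orP => [/IHU|/IHV] ->; rewrite invg1 ?mul1g ?mulg1 mulVg.
Qed.

Section FreeGenerators.
Variable m : nat.
Local Notation n := m.+1.
Local Notation F := (lcs_nseries (pure_subgroup n)).
Local Notation FB := (ns_restr F (brunnian_subgroup n)).
Local Notation Kr := (foldr (@K_step 'I_m) (@letter_set 'I_m) (enum 'I_m)).

Lemma K1E : K n 1 = Kr.
Proof. by rewrite /K drop0. Qed.

Lemma brunnian_group_eval (W : lie_monomial 'I_m) : K n 1 W ->
  brunnian (group_eval W).
Proof.
rewrite K1E => KW; split; first exact: lcs_pure (group_eval_lcs W).
move=> p; rewrite ltnS leq_eqVlt => /orP[/eqP ->|pm].
  exact: remove_kernel_last (group_eval_kernel W).
by apply: (remove_group_eval (k := Ordinal pm)); apply: (K_occurs KW);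
  rewrite mem_enum.
Qed.

Definition brunnian_gen (W : K n 1) : lie_brunnian n :=
  hom FB (mdeg (\val W)) (group_eval (\val W)).

Lemma brunnian_genE (W : K n 1) :
  rel_incl (brunnian_gen W) = eval_monomial (n := n) (\val W).
Proof.
rewrite /brunnian_gen rel_incl_hom ?eval_monomialE //;
  first exact: group_eval_lcs.
exact: brunnian_group_eval (set_mem (valP W)).
Qed.

Let mono_map : flie (K n 1) -> flie 'I_m :=
  flift (fun W : K n 1 => feval (\val W)).

(** Both sides are Lie homomorphisms with the same values on generators. This
    reduces injectivity and surjectivity to the Lie ring of all pure braids. *)
Lemma incl_lift u : rel_incl (flift brunnian_gen u) = Phi (mono_map u).
Proof.
have hi := rel_incl_lie_hom F (brunnian_subgroup n).
apply: (flie_hom_ext (lie_hom_comp hi (flift_hom brunnian_gen))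
                     (lie_hom_comp (@Phi_hom m) (flift_hom _))) => W /=.
by rewrite flift_gen brunnian_genE /mono_map flift_gen Phi_feval.
Qed.

Lemma brunnian_gen_inj : injective (flift brunnian_gen).
Proof.
move=> u v uv; have K_fr : free_monomials (K n 1) by rewrite K1E; exact: K_free.
by apply: (free_monomials_inj K_fr); apply: Phi_inj; rewrite -!incl_lift uv.
Qed.

(** The class of a Brunnian braid is [Phi u] with u killed by every [kill k],
    hence by [K_span] a Lie polynomial in the K-monomials. *)
Lemma brunnian_gen_surj y : exists u, flift brunnian_gen u = y.
Proof.
elim/(@gr_ind _ FB): y => [|q x y [qx bx] [v <-]].
  by exists 0; exact: lie_hom0 (flift_hom _).
have px := lcs_pure qx; have [_ rx] := bx.
have [_ [u uE]] := kernel_Phi (lcs_kernel qx (rx m (ltnSn m))).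
have su : lie_span (@feval 'I_m) (K n 1) (fun=> 0%N) 0 u.
  by rewrite K1E; apply: K_span => k _; exact: (brunnian_kill _ bx qx uE).
have [|u' _ u'E] := lie_span_lift (b := @fgen (K n 1)) (Q := fun=> True)
  (v := fun=> 0%N) (phi := mono_map) (flift_hom _) _ su.
  move=> W KW; exists (exist _ W (mem_set KW)); split=> //.
  exact: flift_gen.
exists (u' + v); rewrite (lie_homD (flift_hom _)); congr (_ + _).
apply: (@rel_incl_inj _ F _ (brunnian_subgroup n)).
by rewrite incl_lift u'E uE rel_incl_hom.
Qed.

End FreeGenerators.

Theorem theorem2p11 (n : nat) (n_ge1 : (1 <= n)%N) :
  exists gen : K n 1 -> lie_brunnian n,
    (forall W : K n 1, rel_incl (gen W) = eval_monomial (\val W))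
    /\ free_lie gen.
Proof.
case: n n_ge1 => // m _; exists (@brunnian_gen m); split.
  exact: brunnian_genE.
by apply: free_lie_bij; [exact: brunnian_gen_inj|exact: brunnian_gen_surj].
Qed.
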